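(* Let $M$ be a complete orientable cusped hyperbolic $3$-manifold. Let $\tau$ be a geometric ideal triangulation of $M$ with $m$ tetrahedra and all dihedral angles at least $\theta_0$ (where $\theta_0>0$). Then the systole length of $M$ is bounded below by $$2^{-9}\cdot\frac{(\sin\theta_0)^{4m+7/2}}{m^{3/2}}.$$
   Context: A cusped hyperbolic $3$-manifold is a non-compact complete hyperbolic $3$-manifold of finite volume. A geometric ideal triangulation of $M$ is a realisation of $M$ as the quotient of a (finite) collection of hyperbolic ideal tetrahedra by face-pairing isometries such that the tetrahedra glue together consistently to give the complete hyperbolic structure on $M$ (it need not be a simplicial complex). Since the three dihedral angles of an ideal tetrahedron at an ideal vertex sum to $\pi$, necessarily $0<\theta_0\le\pi/3$. The systole length of $M$ is the length of a shortest closed geodesic in $M$. *)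

(* Defs.v *)
From HB Require Import structures.
From Stdlib Require Import Relation_Operators.
From mathcomp Require Import all_boot all_order all_algebra.
From mathcomp Require Import all_classical all_reals all_analysis.

Set Implicit Arguments.
Unset Strict Implicit.
Unset Printing Implicit Defensive.

Import Order.TTheory GRing.Theory Num.Theory.
Import numFieldNormedType.Exports.

Local Open Scope classical_set_scope.
Local Open Scope ring_scope.

(* Hyperbolic 3-space is the upper sheet of the hyperboloid in Minkowski space
   R^{1,3}; points are row vectors and isometries act by right
   multiplication. *)

Definition minkJ {R : realType} : 'M[R]_4 :=
  diag_mx (\row_(i < 4) if i == 0 then -1 else 1).

Definition mink {R : realType} (x y : 'rV[R]_4) : R :=
  (x *m minkJ *m y^T) 0 0.

Definition hyp3 {R : realType} : set 'rV[R]_4 :=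
  [set x | mink x x = -1 /\ 0 < x 0 0].

Definition arcosh {R : realType} (u : R) : R :=
  ln (u + Num.sqrt (u ^+ 2 - 1)).

Definition hdist {R : realType} (x y : 'rV[R]_4) : R := arcosh (- mink x y).

(* The isometry group O^+(1,3) of hyperbolic space. *)
Definition lorentz {R : realType} (L : 'M[R]_4) : Prop :=
  L *m minkJ *m L^T = minkJ /\ 0 < L 0 0.

Definition orientation_preserving {R : realType} (L : 'M[R]_4) : Prop :=
  lorentz L /\ \det L = 1.

Definition hyp3_lift {R : realType} (p : R * R * R) : 'rV[R]_4 :=
  let: (a, b, c) := p in
  \row_(i < 4) [:: Num.sqrt (1 + a ^+ 2 + b ^+ 2 + c ^+ 2); a; b; c]`_i.

(* In the coordinates p = (a, b, c), the Riemannian metric induced on the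
   hyperboloid is I - p p^T / (1 + |p|^2), whose determinant is
   (1 + |p|^2)^-1. *)
Definition hvolume {R : realType} (A : set 'rV[R]_4) : \bar R :=
  (\int[(@lebesgue_measure R \x @lebesgue_measure R) \x @lebesgue_measure R]_(p
       in [set p : R * R * R | A (hyp3_lift p)])
     ((Num.sqrt (1 + p.1.1 ^+ 2 + p.1.2 ^+ 2 + p.2 ^+ 2))^-1)%:E)%E.

(* CompletePseudoMetric also provides a base point, which the measurable
   spaces of the library require. *)
#[short(type="completeMetricType")]
HB.structure Definition CompleteMetric (R : numDomainType) :=
  {M of CompletePseudoMetric R M & Metric R M}.

(* A hyperbolic manifold is a metric space whose distance is its Riemannian
   path distance; charts are isometries onto open sets of hyperbolic space. *)
Definition hyp_chart {R : realType} {M : metricType R}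
    (U : set M) (f : M -> 'rV[R]_4) : Prop :=
  [/\ open U,
      f @` U `<=` hyp3,
      (forall x y, U x -> U y -> hdist (f x) (f y) = mdist x y)
    & forall x, U x -> exists2 r : R, 0 < r &
        forall y, hyp3 y -> hdist (f x) y < r -> (f @` U) y].

(* A rectifiable curve of length at most L is, up to reparametrisation, a
   1-Lipschitz map on [0, L]. *)
Definition path_metric {R : realType} (M : metricType R) : Prop :=
  forall (x y : M) (e : R), 0 < e ->
    exists (L : R) (c : R -> M),
      [/\ 0 <= L < mdist x y + e, c 0 = x, c L = y
        & forall s t, 0 <= s <= L -> 0 <= t <= L ->
            mdist (c s) (c t) <= `|s - t|].

Definition hyperbolic3_manifold {R : realType} (M : metricType R) : Prop :=
  path_metric M /\
  forall x : M, exists (U : set M) (f : M -> 'rV[R]_4), hyp_chart U f /\ U x.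

Definition orientable {R : realType} (M : metricType R) : Prop :=
  exists A : set (set M * (M -> 'rV[R]_4)),
    [/\ (forall c, A c -> hyp_chart c.1 c.2),
        (forall x : M, exists2 c, A c & c.1 x)
      & forall c d (x : M), A c -> A d -> c.1 x -> d.1 x ->
          exists2 L, orientation_preserving L &
            \forall y \near x, d.2 y = c.2 y *m L].

(* mu is the Riemannian volume measure of M on its Borel sets. *)
Definition is_volume {R : realType} (M : completeMetricType R)
    (mu : {measure set (g_sigma_algebraType (@open M)) -> \bar R}) : Prop :=
  forall (U : set M) (f : M -> 'rV[R]_4), hyp_chart U f ->
    forall A : set (g_sigma_algebraType (@open M)), measurable A -> A `<=` U ->
      mu A = hvolume (f @` A).

Definition finite_volume {R : realType} (M : completeMetricType R) : Prop :=
  exists2 mu, @is_volume R M mu & (mu setT < +oo)%E.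

Record cusped_hyperbolic {R : realType} (M : completeMetricType R) : Prop := {
  cusped_manifold : hyperbolic3_manifold M ;
  cusped_noncompact : ~ compact [set: M] ;
  cusped_volume : finite_volume M }.

(* The rows of V are ideal points, i.e. future light-like vectors up to
   scaling; they are linearly independent iff the four ideal points do not lie
   on the boundary of a common hyperbolic plane. *)
Definition ideal_vertices {R : realType} (V : 'M[R]_4) : Prop :=
  (forall i, mink (row i V) (row i V) = 0 /\ 0 < V i 0) /\ V \in unitmx.

Definition tetrahedron {R : realType} (V : 'M[R]_4) : set 'rV[R]_4 :=
  [set x | hyp3 x /\
     exists a : 'rV[R]_4, (forall i, 0 <= a 0 i) /\ x = a *m V].

(* The face opposite to the vertex k. *)
Definition face {R : realType} (V : 'M[R]_4) (k : 'I_4) : set 'rV[R]_4 :=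
  [set x | hyp3 x /\
     exists a : 'rV[R]_4, [/\ (forall i, 0 <= a 0 i), a 0 k = 0 & x = a *m V]].

(* The Minkowski dual basis of the vertices: mink (inner_normal V i) (row j V)
   is 1 if i = j and 0 otherwise, so that inner_normal V i is orthogonal to the
   face opposite to the vertex i and points into the tetrahedron. *)
Definition inner_normal {R : realType} (V : 'M[R]_4) (i : 'I_4) : 'rV[R]_4 :=
  row i (invmx (minkJ *m V^T)).

(* The interior angle along the edge common to the faces i and j (i != j). *)
Definition dihedral_angle {R : realType} (V : 'M[R]_4) (i j : 'I_4) : R :=
  let n := inner_normal V in
  acos (- mink (n i) (n j)
        / (Num.sqrt (mink (n i) (n i)) * Num.sqrt (mink (n j) (n j)))).

Section Gluing.
Context {R : realType} {m : nat}.
Variables (V : 'I_m -> 'M[R]_4).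
Variables (s : 'I_m * 'I_4 -> 'I_m * 'I_4) (g : 'I_m * 'I_4 -> 'M[R]_4).

(* The face k of the tetrahedron i is glued by g (i, k) to the face s (i, k). *)
Definition face_glue (p q : 'I_m * 'rV[R]_4) : Prop :=
  exists2 k, face (V p.1) k p.2 &
    q = ((s (p.1, k)).1, p.2 *m g (p.1, k)).

Definition glued : 'I_m * 'rV[R]_4 -> 'I_m * 'rV[R]_4 -> Prop :=
  clos_refl_sym_trans _ face_glue.

End Gluing.

(* M is the quotient of m ideal tetrahedra by face-pairing isometries;
   tri_map i is the quotient map restricted to the i-th tetrahedron, and
   tri_isometric says that the hyperbolic structure glued from the tetrahedra
   is that of M. *)
Record geometric_ideal_triangulation {R : realType} (M : metricType R)
    (m : nat) := {
  tri_vertices : 'I_m -> 'M[R]_4 ;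
  tri_pairing : 'I_m * 'I_4 -> 'I_m * 'I_4 ;
  tri_isometry : 'I_m * 'I_4 -> 'M[R]_4 ;
  tri_map : 'I_m -> 'rV[R]_4 -> M ;
  tri_ideal : forall i, ideal_vertices (tri_vertices i) ;
  tri_pairingK : involutive tri_pairing ;
  tri_pairing_neq : forall f, tri_pairing f != f ;
  tri_lorentz : forall f, lorentz (tri_isometry f) ;
  tri_isometryK : forall f,
    tri_isometry f *m tri_isometry (tri_pairing f) = 1%:M ;
  tri_face : forall f,
    (fun x => x *m tri_isometry f) @` face (tri_vertices f.1) f.2
    = face (tri_vertices (tri_pairing f).1) (tri_pairing f).2 ;
  tri_surjective : forall p : M, exists i,
    (tri_map i @` tetrahedron (tri_vertices i)) p ;
  tri_identification : forall i j x y,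
    tetrahedron (tri_vertices i) x -> tetrahedron (tri_vertices j) y ->
    (tri_map i x = tri_map j y <->
     glued tri_vertices tri_pairing tri_isometry (i, x) (j, y)) ;
  tri_quotient_topology : forall U : set M,
    open U <->
    forall i x, tetrahedron (tri_vertices i) x -> U (tri_map i x) ->
      exists2 r : R, 0 < r &
        forall y, tetrahedron (tri_vertices i) y -> hdist x y < r ->
          U (tri_map i y) ;
  tri_isometric : forall i x, tetrahedron (tri_vertices i) x ->
    exists2 r : R, 0 < r &
      forall y z, tetrahedron (tri_vertices i) y ->
        tetrahedron (tri_vertices i) z -> hdist x y < r -> hdist x z < r ->
        mdist (tri_map i y) (tri_map i z) = hdist y z }.

(* A closed geodesic of length l, parametrised by arc length. *)
Definition closed_geodesic {R : realType} (M : metricType R)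
    (c : R -> M) (l : R) : Prop :=
  [/\ 0 < l, (forall t, c (t + l) = c t)
    & forall t, exists2 r : R, 0 < r &
        forall u v, `|u - t| < r -> `|v - t| < r ->
          mdist (c u) (c v) = `|u - v|].

Definition systole {R : realType} (M : metricType R) : \bar R :=
  ereal_inf [set l%:E | l in [set l : R | exists c : R -> M,
                                closed_geodesic c l]].

(* Main.v *)
(* Scale the light-like vectors representing the ideal vertices so that the face
   pairings match them exactly; this is possible because M is complete, a loop of cusp
   triangles with a nontrivial similarity factor producing a Cauchy sequence without
   limit. Normalise each cusp so that the sides of its link triangles are at most 1.
   Two sides of a link triangle have a ratio at least sin theta0, hence all sides are
   at least (sin theta0)^(4m).

   Follow a closed geodesic of length l through the tetrahedra. A vertex v developed
   along it cannot belong to all the tetrahedra met during four periods: by the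
   pigeonhole principle, the function t |-> - <gamma t, v>, which is a positive
   combination of exp t and exp (- t), would be periodic. So the geodesic reaches,
   within time 4l, the face opposite to the vertex v in some tetrahedron. Applied to a
   single vertex, this shows that the geodesic does not come close to the cusps.
   Applied to the three vertices of a face which the geodesic crosses, it gives a
   second crossed face sharing an edge with the first; the angle at this edge being at
   least theta0, the geodesic passes at a distance O(l / sin theta0) from the edge.
   Applied to the two ends of the edge, it gives a point of the geodesic on a face
   opposite to one of them; there the distance to the edge is at least
   (sin theta0)^(4m + 1). Hence 32 l >= (sin theta0)^(4m + 2), which is stronger than
   the required bound. *)

Require Import Defs.
From Stdlib Require Import Relation_Operators.
From mathcomp Require Import all_boot all_order all_algebra.
From mathcomp Require Import all_classical all_reals all_analysis.
From mathcomp Require Import ring lra.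

Set Implicit Arguments.
Unset Strict Implicit.
Unset Printing Implicit Defensive.

Import Order.TTheory GRing.Theory Num.Theory.
Import numFieldNormedType.Exports.

Local Open Scope classical_set_scope.
Local Open Scope ring_scope.

(** * Hyperbolic functions *)

(** No universal cover or developing map is built. Horospheres are light-like vectors, link
    triangles and dihedral angles are expressions in the Gram matrix of the vertices, and developing
    along the geodesic is recorded by scalars only: products of the developed vertices with the
    geodesic and with one another.

    The obstacle is that [tri_map] is only a quotient map, isometric near each point of each
    tetrahedron. Points of M near a given one could a priori be represented far out in a cusp;
    [no_escape] and [tri_map_near] exclude this. The geodesic could also change tetrahedra
    infinitely often near some time, so no list of crossed faces is formed; real induction on time
    replaces it.

    The exponent 4m counts the link triangles, all of which a simple path may visit. The constant 32
    comes from sinh (4l) <= 8l: a distance at most 8l / sin theta0 to the edge contributes 16l, as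
    does the motion during the last four periods. *)

Section Cosh.
Context {R : realType}.
Implicit Types s t u : R.

Definition cosh s : R := (expR s + expR (- s)) / 2.
Definition sinh s : R := (expR s - expR (- s)) / 2.

Lemma expRMN s : expR s * expR (- s) = 1.
Proof. by rewrite -expRD subrr expR0. Qed.

Lemma cosh2_sinh2 s : cosh s ^+ 2 - sinh s ^+ 2 = 1.
Proof. by rewrite -[RHS](expRMN s) /cosh /sinh; field. Qed.

Lemma coshD s t : cosh (s + t) = cosh s * cosh t + sinh s * sinh t.
Proof. by rewrite /cosh /sinh opprD !expRD; field. Qed.

Lemma sinhD s t : sinh (s + t) = sinh s * cosh t + cosh s * sinh t.
Proof. by rewrite /cosh /sinh opprD !expRD; field. Qed.

Lemma coshN s : cosh (- s) = cosh s.
Proof. by rewrite /cosh opprK addrC. Qed.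

Lemma sinhN s : sinh (- s) = - sinh s.
Proof. by rewrite /sinh opprK -mulNr opprB. Qed.

Lemma coshB s t : cosh (s - t) = cosh s * cosh t - sinh s * sinh t.
Proof. by rewrite coshD coshN sinhN mulrN. Qed.

Lemma cosh0 : cosh (0 : R) = 1.
Proof. by rewrite /cosh oppr0 expR0; lra. Qed.

Lemma sinh0 : sinh (0 : R) = 0.
Proof. by rewrite /sinh oppr0 expR0; lra. Qed.

Lemma cosh_ge1 s : 1 <= cosh s.
Proof.
have : 0 < cosh s by rewrite /cosh divr_gt0 // addr_gt0 // expR_gt0.
by have := cosh2_sinh2 s; nra.
Qed.

Lemma sinh_gt0 s : 0 < s -> 0 < sinh s.
Proof. by move=> s0; rewrite /sinh divr_gt0 // subr_gt0 ltr_expR gtrN. Qed.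

Lemma sinh_ge0 s : 0 <= s -> 0 <= sinh s.
Proof. by rewrite le_eqVlt => /predU1P[<-|/sinh_gt0/ltW//]; rewrite sinh0. Qed.

Lemma cosh_abs s : cosh `|s| = cosh s.
Proof. by case: (ger0P s) => // _; rewrite coshN. Qed.

Lemma sinh_abs s : sinh `|s| = `|sinh s|.
Proof.
case: (ger0P s) => [s0|/ltW s0]; first by rewrite ger0_norm // sinh_ge0.
by rewrite sinhN ler0_norm // -oppr_ge0 -sinhN sinh_ge0 // oppr_ge0.
Qed.

Lemma ltr_cosh s t : 0 <= s -> 0 <= t -> (cosh s < cosh t) = (s < t).
Proof.
have mono (a b : R) : 0 <= a -> a < b -> cosh a < cosh b.
  move=> a0 ab; have b0 : 0 < b - a by rewrite subr_gt0.
  rewrite -(subrK a b) coshD; have S0 := sinh_gt0 b0.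
  have := sinh_ge0 a0; have := cosh_ge1 a.
  have : 1 < cosh (b - a).
    by have := cosh2_sinh2 (b - a); have := cosh_ge1 (b - a); nra.
  by nra.
move=> s0 t0; case: (ltgtP s t) => [st|ts|->]; last by rewrite ltxx.
- exact: mono.
- by apply/negbTE; rewrite -leNgt ltW // mono.
Qed.

Lemma ler_cosh s t : 0 <= s -> 0 <= t -> (cosh s <= cosh t) = (s <= t).
Proof. by move=> s0 t0; rewrite leNgt ltr_cosh // -leNgt. Qed.

Lemma cosh_inj s t : 0 <= s -> 0 <= t -> cosh s = cosh t -> s = t.
Proof.
by move=> s0 t0 /eqP; rewrite eq_le !ler_cosh // -eq_le => /eqP.
Qed.

Lemma arcosh_ge0 u : 1 <= u -> 0 <= arcosh u.
Proof.
move=> u1; rewrite /arcosh ln_ge0 //.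
by have := sqrtr_ge0 (u ^+ 2 - 1); lra.
Qed.

Lemma cosh_arcosh u : 1 <= u -> cosh (arcosh u) = u.
Proof.
move=> u1; rewrite /cosh /arcosh.
have h : 0 <= u ^+ 2 - 1 by nra.
have := sqr_sqrtr h; have := sqrtr_ge0 (u ^+ 2 - 1).
set v := Num.sqrt _ => v0 v2; have p : 0 < u + v by lra.
rewrite expRN lnK ?posrE //.
have -> : (u + v)^-1 = u - v.
  by apply: (mulfI (lt0r_neq0 p)); rewrite divff ?lt0r_neq0 //; nra.
by lra.
Qed.

Lemma arcosh_cosh s : 0 <= s -> arcosh (cosh s) = s.
Proof.
move=> s0; apply: cosh_inj => //; first exact/arcosh_ge0/cosh_ge1.
exact/cosh_arcosh/cosh_ge1.
Qed.

(** The root is exp (s/2) - exp (-s/2), which is at least s/2 because the first term is at least 1 +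
    s/2 and the second at most 1. *)
Lemma le_sqrt_cosh s : 0 <= s -> s <= 2 * Num.sqrt (2 * (cosh s - 1)).
Proof.
move=> s0; rewrite -ler_pdivrMl // -(ger0_norm (_ : 0 <= 2^-1 * s)); last by lra.
rewrite -sqrtr_sqr ler_wsqrtr // /cosh.
have -> : expR s = expR (s / 2) * expR (s / 2) by rewrite -expRD -splitr.
have -> : expR (- s) = expR (- (s / 2)) * expR (- (s / 2)).
  by rewrite -expRD -opprD -splitr.
have := expRMN (s / 2); have := expR_ge1Dx (s / 2).
have : expR (- (s / 2)) <= 1 by rewrite -[leRHS]expR0 ler_expR; lra.
set e := expR _; set f := expR _ => f1 e1 fe.
have -> : 2 * ((f * f + e * e) / 2 - 1) = (f - e) ^+ 2.
  by rewrite [in RHS]sqrrB fe; field.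
rewrite -[leLHS]/((2^-1 * s) * (2^-1 * s)) expr2.
by apply: ler_pM; lra.
Qed.

Lemma expR_le_small s : 0 <= s -> s <= 4^-1 -> expR s <= 1 + 4 / 3 * s.
Proof.
move=> s0 s1; have := expRMN s; have := expR_ge1Dx (- s); have := expR_gt0 s.
by nra.
Qed.

Lemma sinh_le_small s : 0 <= s -> s <= 4^-1 -> sinh s <= 2 * s.
Proof.
move=> s0 s1; have := expR_le_small s0 s1; have := expR_ge1Dx (- s).
by rewrite /sinh; lra.
Qed.

Lemma cosh_le_small s : 0 <= s -> s <= 4^-1 -> cosh s <= 2.
Proof.
move=> s0 s1; have := expR_le_small s0 s1.
have : expR (- s) <= 1 by rewrite -expR0 ler_expR; lra.
by rewrite /cosh; lra.
Qed.

End Cosh.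

(** * Minkowski space *)

Section Minkowski.
Context {R : realType}.
Implicit Types x y z u v w p : 'rV[R]_4.

Lemma minkDl x y z : mink (x + y) z = mink x z + mink y z.
Proof. by rewrite /mink !mulmxDl mxE. Qed.

Lemma minkZl (a : R) x z : mink (a *: x) z = a * mink x z.
Proof. by rewrite /mink -!scalemxAl mxE. Qed.

Lemma minkC x y : mink x y = mink y x.
Proof.
rewrite /mink -[in RHS](trmxK (y *m _ *m _)) [in RHS]mxE !trmx_mul trmxK mulmxA.
by rewrite /minkJ tr_diag_mx.
Qed.

Lemma minkDr x y z : mink z (x + y) = mink z x + mink z y.
Proof. by rewrite minkC minkDl !(minkC _ z). Qed.

Lemma minkZr (a : R) x z : mink z (a *: x) = a * mink z x.
Proof. by rewrite minkC minkZl (minkC _ z). Qed.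

Lemma minkNl x z : mink (- x) z = - mink x z.
Proof. by rewrite -scaleN1r minkZl mulN1r. Qed.

Lemma minkNr x z : mink z (- x) = - mink z x.
Proof. by rewrite minkC minkNl minkC. Qed.

Definition minkE := (minkDl, minkDr, minkZl, minkZr, minkNl, minkNr).

Lemma mink_comb (s t s' t' : R) x y x' y' :
  mink (s *: x + t *: y) (s' *: x' + t' *: y') =
  s * s' * mink x x' + s * t' * mink x y' + t * s' * mink y x' + t * t' * mink y y'.
Proof. by rewrite !minkE; ring. Qed.

Lemma mink0l z : mink 0 z = 0.
Proof. by rewrite -(scale0r 0) minkZl mul0r. Qed.

Lemma mink0r z : mink z 0 = 0.
Proof. by rewrite minkC mink0l. Qed.

Lemma mink_suml (I : Type) (r : seq I) (P : pred I) (F : I -> 'rV[R]_4) z :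
  mink (\sum_(i <- r | P i) F i) z = \sum_(i <- r | P i) mink (F i) z.
Proof.
by elim/big_rec2: _ => [|i y1 y2 _ <-]; rewrite ?mink0l ?minkDl.
Qed.

Lemma mink_sumr (I : Type) (r : seq I) (P : pred I) (F : I -> 'rV[R]_4) z :
  mink z (\sum_(i <- r | P i) F i) = \sum_(i <- r | P i) mink z (F i).
Proof. by rewrite minkC mink_suml; apply: eq_bigr => i _; rewrite minkC. Qed.

Lemma mink_mul (L : 'M[R]_4) x y : L *m minkJ *m L^T = minkJ ->
  mink (x *m L) (y *m L) = mink x y.
Proof. by move=> h; rewrite /mink trmx_mul -!mulmxA (mulmxA L) (mulmxA _ L^T) h. Qed.

Definition edot x y : R := \sum_(i < 3) x 0 (lift ord0 i) * y 0 (lift ord0 i).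

Lemma mink_edot x y : mink x y = edot x y - x 0 0 * y 0 0.
Proof.
rewrite /mink /minkJ mul_mx_diag mxE big_ord_recl !mxE /= addrC.
congr (_ + _); last by rewrite mulrN1 mulNr.
by apply: eq_bigr => i _; rewrite !mxE /= mulr1.
Qed.

Lemma edot_ge0 x : 0 <= edot x x.
Proof. by apply: sumr_ge0 => i _; rewrite -expr2 sqr_ge0. Qed.

Lemma edot_cauchy x y : edot x y ^+ 2 <= edot x x * edot y y.
Proof.
rewrite /edot !big_ord_recr !big_ord0 /= !add0r.
set a := x _ _; set b := x _ _; set c := x _ _.
set a' := y _ _; set b' := y _ _; set c' := y _ _.
rewrite -subr_ge0.
(* Lagrange's identity. *)
have -> : (a * a + b * b + c * c) * (a' * a' + b' * b' + c' * c') -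
  (a * a' + b * b' + c * c') ^+ 2 = (a * b' - b * a') ^+ 2 +
  (a * c' - c * a') ^+ 2 + (b * c' - c * b') ^+ 2 by ring.
by rewrite !addr_ge0 ?sqr_ge0.
Qed.

Lemma edot_eq0 x : edot x x = 0 -> forall i, x 0 (lift ord0 i) = 0.
Proof.
move=> /psumr_eq0P h i; apply/eqP; rewrite -sqrf_eq0 expr2; apply/eqP/h => //.
by move=> j _; rewrite -expr2 sqr_ge0.
Qed.

(** By Cauchy-Schwarz on the spatial parts. With [mink_orth_eq0] it makes [mink] positive definite
    orthogonally to a timelike vector, which yields the distance estimates and a way to identify two
    points. *)
Lemma mink_orth_ge0 p w : mink p p < 0 -> mink w p = 0 -> 0 <= mink w w.
Proof.
rewrite !mink_edot => h1 h2; have := edot_cauchy w p; have := edot_ge0 p.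
by have := edot_ge0 w; nra.
Qed.

Lemma mink_orth_eq0 p w :
  mink p p < 0 -> mink w p = 0 -> mink w w = 0 -> w = 0.
Proof.
rewrite !mink_edot => h1 h2 h3.
have := edot_cauchy w p; have := edot_ge0 p; have := edot_ge0 w => g1 g2 g3.
have w0 : w 0 0 = 0.
  have : (w 0 0 ^+ 2) * (p 0 0 * p 0 0 - edot p p) <= 0 by nra.
  rewrite pmulr_lle0 ?expr2; last by lra.
  by move=> h; apply/eqP; rewrite -sqrf_eq0 expr2 eq_le h -expr2 sqr_ge0.
have : edot w w = 0 by move: h3; rewrite w0 mul0r subr0.
move=> /edot_eq0 h; apply/rowP => i; rewrite mxE.
by case: (unliftP ord0 i) => [j ->|->]; rewrite ?h.
Qed.

Lemma mink_causal_ge0 x y : mink x x <= 0 -> 0 < x 0 0 ->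
  mink y y <= 0 -> 0 < y 0 0 -> mink x y <= 0.
Proof.
rewrite !mink_edot !subr_le0 -!expr2 => hx x0 hy y0.
have := edot_cauchy x y; have := edot_ge0 x; have := edot_ge0 y => g1 g2 g3.
have : edot x y ^+ 2 <= (x 0 0 * y 0 0) ^+ 2.
  by rewrite exprMn (le_trans g3) // ler_pM.
rewrite -ler_sqrt ?sqr_ge0 // !sqrtr_sqr (gtr0_norm (mulr_gt0 x0 y0)).
exact: le_trans (ler_norm _).
Qed.

Lemma mink_causal_gt0 x y : mink x x < 0 -> 0 < x 0 0 ->
  mink y y <= 0 -> 0 < y 0 0 -> mink x y < 0.
Proof.
move=> hx x0 hy y0; rewrite lt_neqAle mink_causal_ge0 ?(ltW hx) // andbT.
apply/eqP => h; have := @mink_orth_ge0 x y hx; rewrite minkC => /(_ h) h1.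
have h2 : mink y y = 0 by apply/eqP; rewrite eq_le hy.
move: y0; rewrite (@mink_orth_eq0 x y) ?mxE ?ltxx //.
by rewrite minkC.
Qed.

Lemma mink_causal_future x z : mink x x < 0 -> 0 < x 0 0 ->
  mink z z < 0 -> mink z x < 0 -> 0 < z 0 0.
Proof.
move=> hx x0 hz hzx; rewrite ltNge; apply/negP; rewrite le_eqVlt => /predU1P[h|h].
  by move: hz; rewrite mink_edot h mulr0 subr0; have := edot_ge0 z; lra.
have := @mink_causal_gt0 x (- z) hx x0; rewrite minkNl !minkNr opprK mxE.
by rewrite oppr_gt0 (minkC x) => /(_ (ltW hz) h); lra.
Qed.

Lemma hyp3_timelike x : hyp3 x -> mink x x < 0.
Proof. by case=> -> _; lra. Qed.

Lemma hyp3_ge1 x y : hyp3 x -> hyp3 y -> 1 <= - mink x y.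
Proof.
move=> hx hy; have hx' := hyp3_timelike hx; have hy' := hyp3_timelike hy.
have c0 := mink_causal_gt0 hx' hx.2 (ltW hy') hy.2.
have := @mink_orth_ge0 x (y + mink x y *: x) hx'.
rewrite !minkE (minkC y x) hx.1 hy.1 mulrN1 subrr => /(_ erefl); nra.
Qed.

Lemma hyp3_eq1 x y : hyp3 x -> hyp3 y -> mink x y = -1 -> x = y.
Proof.
move=> hx hy h; apply/esym/subr0_eq/(mink_orth_eq0 (hyp3_timelike hx)).
  by rewrite minkDl minkNl (minkC y) h hx.1 subrr.
by rewrite !minkE (minkC y x) h hx.1 hy.1; lra.
Qed.

Lemma hdist_ge0 x y : hyp3 x -> hyp3 y -> 0 <= hdist x y.
Proof. by move=> hx hy; rewrite arcosh_ge0 // hyp3_ge1. Qed.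

Lemma cosh_hdist x y : hyp3 x -> hyp3 y -> cosh (hdist x y) = - mink x y.
Proof. by move=> hx hy; rewrite cosh_arcosh // hyp3_ge1. Qed.

Lemma hdist_eq0 x y : hyp3 x -> hyp3 y -> hdist x y = 0 -> x = y.
Proof.
move=> hx hy h; apply: hyp3_eq1 => //.
by apply: oppr_inj; rewrite opprK -cosh_hdist // h cosh0.
Qed.

Lemma hdistxx x : hyp3 x -> hdist x x = 0.
Proof. by move=> hx; rewrite /hdist hx.1 opprK -cosh0 arcosh_cosh. Qed.

Lemma hdist_lt x y (r : R) : hyp3 x -> hyp3 y -> 0 < r ->
  (hdist x y < r) = (- mink x y < cosh r).
Proof.
by move=> hx hy r0; rewrite -cosh_hdist // ltr_cosh ?hdist_ge0 // ltW.
Qed.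

Definition hline x u (s : R) : 'rV[R]_4 := cosh s *: x + sinh s *: u.

Lemma hline_hyp3 x u s : hyp3 x -> mink x u = 0 -> mink u u = 1 ->
  hyp3 (hline x u s).
Proof.
move=> hx hxu hu; have hh : mink (hline x u s) (hline x u s) = -1.
  rewrite /hline !minkE (minkC u x) hxu hu hx.1.
  by have := cosh2_sinh2 s; rewrite !expr2; lra.
split=> //; apply: (@mink_causal_future x) => //.
- exact: hyp3_timelike.
- exact: hx.2.
- by rewrite hh; lra.
- rewrite /hline !minkE (minkC u x) hxu hx.1.
  by have := cosh_ge1 s; lra.
Qed.

Lemma hline0 x u : hline x u 0 = x.
Proof. by rewrite /hline cosh0 sinh0 scale1r scale0r addr0. Qed.

Lemma mink_hline x u s y : mink (hline x u s) y = cosh s * mink x y + sinh s * mink u y.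
Proof. by rewrite /hline !minkE. Qed.

(** [x 0 0] is the hyperbolic cosine of the distance from x to (1, 0, 0, 0), so this is a triangle
    inequality combined with cosh (s + t) <= 2 cosh s cosh t. Points with large first coordinate are
    thus far from x. *)
Lemma le_coord_mink x y : hyp3 x -> hyp3 y -> y 0 0 <= 2 * x 0 0 * - mink x y.
Proof.
case=> + x0 [+ y0]; rewrite !mink_edot => hx hy.
have := edot_cauchy x y; have := edot_ge0 x; have := edot_ge0 y => g1 g2 g3.
have ex : edot x x = x 0 0 ^+ 2 - 1 by rewrite expr2; lra.
have ey : edot y y = y 0 0 ^+ 2 - 1 by rewrite expr2; lra.
move: g1 g2 g3; rewrite ex ey.
set a := x 0 0 in x0 *; set b := y 0 0 in y0 *; set S := edot x y => g1 g2 g3.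
suff : 2 * a * S <= b * (2 * a ^+ 2 - 1) by nra.
have h0 : 0 <= b * (2 * a ^+ 2 - 1) by apply: mulr_ge0; nra.
rewrite (le_trans (ler_norm _)) // -(ger0_norm h0) -!sqrtr_sqr ler_wsqrtr //.
have : 4 * a ^+ 2 * S ^+ 2 <= 4 * a ^+ 2 * ((a ^+ 2 - 1) * (b ^+ 2 - 1)).
  by rewrite ler_wpM2l // mulr_ge0 // sqr_ge0.
have : 4 * a ^+ 2 * ((a ^+ 2 - 1) * (b ^+ 2 - 1)) <= 4 * a ^+ 2 * ((a ^+ 2 - 1) * b ^+ 2).
  by apply: ler_wpM2l; [rewrite mulr_ge0 ?sqr_ge0|apply: ler_wpM2l => //; lra].
have := sqr_ge0 b; nra.
Qed.

End Minkowski.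

(** * Ideal tetrahedra *)

Section FourIndices.
Implicit Types a b c d : 'I_4.

Lemma sum_ord4 (T : nmodType) (F : 'I_4 -> T) a b c d : uniq [:: a; b; c; d] ->
  \sum_k F k = F a + F b + F c + F d.
Proof.
move=> h; rewrite (eq_bigl (fun k => k \in [:: a; b; c; d])); last first.
  move=> k; have /eqP := card_uniqP h; rewrite /= => hc.
  have := subset_cardP _ (subset_predT (mem [:: a; b; c; d])).
  by rewrite card_ord (eqP hc) => /(_ erefl k) ->.
rewrite -big_uniq //= !big_cons big_nil addr0 !addrA //.
Qed.

Lemma ord4_complete3 a b c : uniq [:: a; b; c] -> exists d, uniq [:: a; b; c; d].
Proof.
move=> h; have : #|[set: 'I_4] :\: [set x in [:: a; b; c]]| = 1%N.
  rewrite cardsD cardsT card_ord finset.setTI cardsE.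
  by move/card_uniqP: h => ->.
move=> /eqP/cards1P[d] /setP/(_ d); rewrite !inE eqxx andbT => hd.
exists d; rewrite -[[:: a; b; c; d]]/(rcons [:: a; b; c] d) rcons_uniq h andbT.
by rewrite !inE hd.
Qed.

Lemma ord4_complete2 a b : a != b -> exists c d, uniq [:: a; b; c; d].
Proof.
move=> ab; have [c hc|] := @pickP _ [pred c | c \notin [:: a; b]].
  have [|d] := @ord4_complete3 a b c; last by exists c, d.
  by rewrite -[[:: a; b; c]]/(rcons [:: a; b] c) rcons_uniq [c \notin _]hc /= inE ab.
move=> h; have : (#|'I_4| <= #|[:: a; b]|)%N.
  by apply/subset_leq_card/fintype.subsetP => x _; have /negbFE := h x.
by rewrite card_ord (card_uniqP _) //= inE ab.
Qed.

Lemma ord4_complete1 a : exists b c d, uniq [:: a; b; c; d].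
Proof.
have [b ab] : exists b, a != b.
  exists (if a == ord0 then ord_max else ord0).
  by case: (eqVneq a ord0) => [->|].
by exists b; apply: ord4_complete2.
Qed.

End FourIndices.

(** For i != j, half of this number is the exponential of the signed distance between the
    horospheres encoded by the two vertex vectors. *)
Definition vgram {R : realType} (V : 'M[R]_4) (i j : 'I_4) : R :=
  - mink (row i V) (row j V).

(* s plays the role of the sine of a lower bound on the dihedral angles: by the
   law of cosines the right-hand side is [4 q_ac q_bd q_ad q_bc] times the squared
   sine of the dihedral angle along the edge ab. *)
Definition fat {R : realType} (s : R) (V : 'M[R]_4) : Prop :=
  forall a b c d : 'I_4, uniq [:: a; b; c; d] -> let q := vgram V in
  s ^+ 2 * (4 * (q a c * q b d * (q a d * q b c))) <=
  4 * (q a c * q b d * (q a d * q b c)) -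
  (q a c * q b d + q a d * q b c - q a b * q c d) ^+ 2.

Section IdealTetrahedron.
Context {R : realType}.
Variable V : 'M[R]_4.
Hypothesis idealV : ideal_vertices V.
Implicit Types a b c d i j k : 'I_4.
Implicit Types x y u w : 'rV[R]_4.
Local Notation q := (vgram V).
Local Notation v := (fun i => row i V).

Lemma unit_vertices : V \in unitmx. Proof. exact: idealV.2. Qed.

Lemma vgramC i j : q i j = q j i. Proof. by rewrite /vgram minkC. Qed.

Lemma mink_vertex i : mink (v i) (v i) = 0. Proof. exact: (idealV.1 i).1. Qed.

Lemma vgramii i : q i i = 0. Proof. by rewrite /vgram mink_vertex oppr0. Qed.

Lemma vertex_future i : 0 < v i 0 0. Proof. by rewrite mxE; exact: (idealV.1 i).2. Qed.

Definition bcoord x : 'rV[R]_4 := x *m invmx V.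

Lemma bcoordK x : bcoord x *m V = x.
Proof. by rewrite /bcoord mulmxKV // unit_vertices. Qed.

Lemma bcoord_mul x : bcoord (x *m V) = x.
Proof. by rewrite /bcoord mulmxK // unit_vertices. Qed.

Lemma bcoord_sum x : x = \sum_k bcoord x 0 k *: v k.
Proof. by rewrite -mulmx_sum_row bcoordK. Qed.

Lemma bcoordD x y : bcoord (x + y) = bcoord x + bcoord y.
Proof. exact: mulmxDl. Qed.

Lemma bcoordZ (t : R) x : bcoord (t *: x) = t *: bcoord x.
Proof. by rewrite /bcoord -scalemxAl. Qed.

Lemma bcoord_vertex k : bcoord (v k) = delta_mx 0 k.
Proof. by rewrite /= rowE bcoord_mul. Qed.

Lemma tetrahedronP x :
  tetrahedron V x <-> hyp3 x /\ forall i, 0 <= bcoord x 0 i.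
Proof.
split=> -[hx h]; split=> //; last by exists (bcoord x); rewrite bcoordK.
by have [a [a0 ->]] := h; rewrite bcoord_mul.
Qed.

Lemma faceP k x : face V k x <->
  [/\ hyp3 x, forall i, 0 <= bcoord x 0 i & bcoord x 0 k = 0].
Proof.
split=> [[hx]|[hx h k0]]; last by split=> //; exists (bcoord x); rewrite bcoordK.
by move=> [a [a0 ak xe]]; split=> //; rewrite xe bcoord_mul.
Qed.

Lemma face_tetrahedron k x : face V k x -> tetrahedron V x.
Proof. by move=> /faceP[? ? _]; apply/tetrahedronP. Qed.

Lemma mink_nondegenerate x : (forall k, mink x (v k) = 0) -> x = 0.
Proof.
move=> h; have : x *m (minkJ *m V^T) = 0.
  apply/rowP => k; rewrite mulmxA [RHS]mxE -(h k) /mink !mxE.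
  by apply: eq_bigr => j _; rewrite !mxE.
have U : minkJ *m V^T \in unitmx.
  rewrite unitmx_mul unitmx_tr unit_vertices andbT unitmxE det_diag.
  rewrite unitfE; apply/prodf_neq0 => i _; rewrite mxE.
  by case: ifP; rewrite ?oppr_eq0 oner_eq0.
by move/(congr1 (mulmx^~ (invmx (minkJ *m V^T)))); rewrite mulmxK // mul0mx.
Qed.

Lemma bcoord_inj_sum (be : 'I_4 -> R) :
  \sum_k be k *: v k = 0 -> forall k, be k = 0.
Proof.
move=> h k; have : bcoord (\sum_k be k *: v k) = \row_k be k.
  rewrite -(bcoord_mul (\row_k be k)) mulmx_sum_row; congr bcoord.
  by apply: eq_bigr => j _; rewrite mxE.
by move/rowP/(_ k); rewrite h /bcoord mul0mx !mxE => <-.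
Qed.

Lemma vgram_gt0 i j : i != j -> 0 < q i j.
Proof.
move=> ij; rewrite /vgram oppr_gt0 lt_neqAle; apply/andP; split; last first.
  by apply: mink_causal_ge0; rewrite ?mink_vertex ?vertex_future.
apply/eqP => h0.
pose p : 'rV[R]_4 := delta_mx 0 0.
(* The first coordinate of w is zero. If v i and v j were orthogonal, w would also be null, hence
   zero, against the independence of the vertices. *)
pose w : 'rV[R]_4 := V j 0 *: v i - V i 0 *: v j.
have ed y : edot y p = 0.
  by rewrite /edot big1 // => l _; rewrite !mxE /= mulr0.
have hp : mink p p < 0 by rewrite mink_edot ed !mxE /=; lra.
have hwp : mink w p = 0 by rewrite mink_edot ed !mxE /=; ring.
have hw : mink w w = 0.
  by rewrite /w !minkE !mink_vertex (minkC (v j)) h0; ring.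
have [k [l ijkl]] := ord4_complete2 ij.
pose be (m : 'I_4) : R := if m == i then V j 0 else if m == j then - V i 0 else 0.
have : \sum_m be m *: v m = 0.
  rewrite -[RHS](mink_orth_eq0 hp hwp hw).
  have /= -> := sum_ord4 (fun m => be m *: row m V) ijkl; rewrite /be !eqxx.
  move: ijkl; rewrite /= !inE !negb_or => /and4P[/and3P[h1 h2 h3] /andP[h4 h5] _ _].
  rewrite (eq_sym j i) (negbTE h1) (eq_sym k i) (negbTE h2) (eq_sym k j).
  rewrite (negbTE h4) (eq_sym l i) (negbTE h3) (eq_sym l j) (negbTE h5).
  by rewrite !scale0r !addr0 scaleNr.
move/bcoord_inj_sum/(_ i); rewrite /be eqxx => /eqP.
by rewrite gt_eqF //; have := (idealV.1 j).2.
Qed.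

Lemma vgram_ge0 i j : 0 <= q i j.
Proof. by case: (eqVneq i j) => [->|/vgram_gt0/ltW//]; rewrite vgramii. Qed.

Lemma mink_sum_vertex (be : 'I_4 -> R) i :
  - mink (\sum_k be k *: v k) (v i) = \sum_k be k * q k i.
Proof.
rewrite mink_suml -sumrN; apply: eq_bigr => k _.
by rewrite minkZl -mulrN.
Qed.

Lemma mink_bcoord x i : - mink x (v i) = \sum_k bcoord x 0 k * q k i.
Proof. by rewrite {1}(bcoord_sum x) mink_sum_vertex. Qed.

Lemma mink_bcoord2 x : - mink x x = \sum_k bcoord x 0 k * - mink x (v k).
Proof.
rewrite {2}(bcoord_sum x) mink_sumr -sumrN; apply: eq_bigr => k _.
by rewrite minkZr mulrN.
Qed.

Lemma mink_hyp3_vertex x i : hyp3 x -> 0 < - mink x (v i).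
Proof.
move=> hx; rewrite oppr_gt0; apply: mink_causal_gt0; rewrite ?mink_vertex ?vertex_future //.
- exact: hyp3_timelike.
- exact: hx.2.
Qed.

Section Edge.
Variables a b c d : 'I_4.
Hypothesis abcd : uniq [:: a; b; c; d].

Lemma uniq4_neq :
  [/\ [/\ a != b, a != c & a != d], [/\ b != a, b != c & b != d],
      [/\ c != a, c != b & c != d] & [/\ d != a, d != b & d != c]].
Proof.
move: abcd; rewrite /= !inE !negb_or => /and4P[/and3P[h1 h2 h3] /andP[h4 h5] h6 _].
by do ![split] => //; rewrite eq_sym.
Qed.

(* The projection of the vertex k to the plane orthogonal to the edge ab. *)
Definition eproj k : 'rV[R]_4 :=
  v k - (q b k / q a b) *: v a - (q a k / q a b) *: v b.

Lemma qab_neq0 : q a b != 0.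
Proof. by rewrite gt_eqF // vgram_gt0 //; case: uniq4_neq => -[]. Qed.

Lemma eproj_orth k : mink (eproj k) (v a) = 0 /\ mink (eproj k) (v b) = 0.
Proof.
have e i j : mink (v i) (v j) = - q i j by rewrite /vgram opprK.
rewrite /eproj !minkE !e !vgramii (vgramC b a) (vgramC k a) (vgramC k b).
by split; field; exact: qab_neq0.
Qed.

Lemma mink_eproj_vertex k l : mink (eproj k) (eproj l) = mink (eproj k) (v l).
Proof.
have [h1 h2] := eproj_orth k.
by rewrite {2}/eproj !minkDr !minkNr !minkZr h1 h2 !mulr0 !oppr0 !addr0.
Qed.

Lemma mink_eproj k l : mink (eproj k) (eproj l) =
  (q a k * q b l + q a l * q b k - q a b * q k l) / q a b.
Proof.
rewrite mink_eproj_vertex /eproj !minkE.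
have e i j : mink (v i) (v j) = - q i j by rewrite /vgram opprK.
by rewrite !e; field; exact: qab_neq0.
Qed.

Let A := mink (eproj c) (eproj c).
Let B := mink (eproj d) (eproj d).
Let C := mink (eproj c) (eproj d).

Lemma eproj_gt0 k : k != a -> k != b -> 0 < mink (eproj k) (eproj k).
Proof.
move=> ka kb; rewrite mink_eproj vgramii mulr0 subr0.
have [[ab _ _] _ _ _] := uniq4_neq.
by rewrite divr_gt0 ?vgram_gt0 // addr_gt0 // mulr_gt0 // vgram_gt0 // eq_sym.
Qed.

Let A_gt0 : 0 < A.
Proof. by have [_ _ [? ? _] _] := uniq4_neq; exact: eproj_gt0. Qed.
Let mink_eproj_comb : mink (A *: eproj d - C *: eproj c) (A *: eproj d - C *: eproj c)
  = A * (A * B - C ^+ 2).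
Proof. by rewrite -scaleNr mink_comb (minkC (eproj d) (eproj c)) -/A -/B -/C; ring. Qed.

(** Strict Cauchy-Schwarz: both projections are orthogonal to the timelike vector v a + v b, so they
    lie in a definite subspace, and they are independent because the vertices are. *)
Lemma eproj_cauchy : 0 < A * B - C ^+ 2.
Proof.
pose p := v a + v b.
have [[ab _ _] _ _ _] := uniq4_neq.
have qab := vgram_gt0 ab.
have hp : mink p p < 0.
  rewrite /p !minkE !mink_vertex (minkC (v b)).
  by move: qab; rewrite /vgram; lra.
pose z := A *: eproj d - C *: eproj c.
have hzp : mink z p = 0.
  have [h1 h2] := eproj_orth c; have [h3 h4] := eproj_orth d.
  by rewrite /z /p !minkDl !minkNl !minkZl !minkDr h1 h2 h3 h4; ring.
have hz : mink z z = A * (A * B - C ^+ 2) := mink_eproj_comb.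
have h := mink_orth_ge0 hp hzp.
rewrite -(pmulr_rgt0 _ A_gt0) -hz lt_neqAle h andbT eq_sym; apply/eqP => h0.
have z0 := mink_orth_eq0 hp hzp h0.
have [_ _ [ca cb cd] [da db dc]] := uniq4_neq.
have : bcoord z 0 d = 0 by rewrite z0 /bcoord mul0mx mxE.
rewrite /bcoord /z /eproj !(mulmxBl, =^~ scalemxAl) -!/(bcoord _).
rewrite !bcoord_vertex !mxE !eqxx /= (negbTE da) (negbTE db) (negbTE dc).
by rewrite !(mulr0n, mulr1n, mulr0, subr0, mulr1) => h1; move: A_gt0; rewrite h1 ltxx.
Qed.

Lemma inner_normalP i j : mink (inner_normal V i) (v j) = (i == j)%:R.
Proof.
have U : minkJ *m V^T \in unitmx.
  rewrite unitmx_mul unitmx_tr unit_vertices andbT unitmxE det_diag.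
  rewrite unitfE; apply/prodf_neq0 => k _; rewrite mxE.
  by case: ifP; rewrite ?oppr_eq0 oner_eq0.
have /matrixP/(_ i j) := mulVmx U; rewrite [RHS]mxE => <-.
rewrite /mink /inner_normal tr_row -mulmxA -row_mul !mxE.
by apply: eq_bigr => k _; rewrite !mxE; congr (_ * _); apply: eq_bigr => l _; rewrite !mxE.
Qed.

(** The normal is orthogonal to the vertices a, b and c, so it is proportional to the component of
    [eproj d] orthogonal to [eproj c]. *)
Lemma inner_normalE :
  inner_normal V d = (A * B - C ^+ 2)^-1 *: (A *: eproj d - C *: eproj c).
Proof.
have D0 := eproj_cauchy; have [_ _ [ca cb cd] [da db dc]] := uniq4_neq.
apply/subr0_eq/mink_nondegenerate => k.
rewrite minkDl minkNl inner_normalP minkZl minkDl minkNl !minkZl.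
have [h1 h2] := eproj_orth c; have [h3 h4] := eproj_orth d.
have : k \in [:: a; b; c; d].
  have /eqP := card_uniqP abcd; rewrite /= => hc.
  have := subset_cardP _ (subset_predT (mem [:: a; b; c; d])).
  by rewrite card_ord (eqP hc) => /(_ erefl k) ->.
rewrite !inE => /or4P[] /eqP ->.
- by rewrite (negbTE da) /= h1 h3; ring.
- by rewrite (negbTE db) /= h2 h4; ring.
- rewrite (negbTE dc) -!mink_eproj_vertex -/A (minkC (eproj d)) -/C.
  by rewrite (mulrC C A) subrr mulr0 mulr0n subr0.
- rewrite eqxx -!mink_eproj_vertex -/B -/C -expr2.
  by rewrite mulVf ?subrr // gt_eqF.
Qed.

Lemma mink_inner_normal :
  mink (inner_normal V d) (inner_normal V d) = A / (A * B - C ^+ 2).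
Proof.
have D0 := eproj_cauchy.
by rewrite inner_normalE minkZl minkZr mink_eproj_comb; field; rewrite gt_eqF.
Qed.

Lemma mink_inner_normal_edge :
  mink (inner_normal V c) (inner_normal V d) = - C / (A * B - C ^+ 2).
Proof.
have D0 := eproj_cauchy; have [_ _ [ca cb cd] [da db dc]] := uniq4_neq.
rewrite inner_normalE minkZr minkDr minkNr !minkZr.
rewrite /eproj !minkDr !minkNr !minkZr !inner_normalP.
rewrite eqxx (negbTE ca) (negbTE cb) (negbTE cd).
by rewrite !(mulr0n, mulr1n); field; rewrite gt_eqF ?qab_neq0.
Qed.

End Edge.

Lemma uniq4_swap (a b c d : 'I_4) : uniq [:: a; b; c; d] -> uniq [:: a; b; d; c].
Proof. by rewrite -(perm_uniq (_ : perm_eq [:: a; b; c; d] _)) // !perm_cons -cat1s -[[:: d; c]]cat1s perm_catC. Qed.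

(** The angle along the edge ab is the angle between the projections of c and d to the plane
    orthogonal to the edge, with cosine C / sqrt (A B). *)
Lemma dihedral_angleE (a b c d : 'I_4) : uniq [:: a; b; c; d] ->
  dihedral_angle V c d = acos ((q a c * q b d + q a d * q b c - q a b * q c d) /
    (2 * Num.sqrt (q a c * q b d * (q a d * q b c)))).
Proof.
move=> h; have h' := uniq4_swap h; have [[ab ac ad] [_ bc bd] _ _] := uniq4_neq h.
have qab := vgram_gt0 ab; have qac := vgram_gt0 ac; have qad := vgram_gt0 ad.
have qbc := vgram_gt0 bc; have qbd := vgram_gt0 bd.
rewrite /dihedral_angle /= (mink_inner_normal_edge h) (mink_inner_normal h).
rewrite (mink_inner_normal h').
have D0 := eproj_cauchy h.
have Q0 := qab_neq0 h.
rewrite (minkC (eproj a b d) (eproj a b c)) (mulrC (mink (eproj a b d) _) (mink (eproj a b c) _)).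
set A := mink (eproj a b c) (eproj a b c) in D0 *.
set B := mink (eproj a b d) (eproj a b d) in D0 *.
set C := mink (eproj a b c) (eproj a b d) in D0 *.
have A0 : 0 < A.
  by case: (uniq4_neq h) => _ _ [? ? _] _; apply: eproj_gt0 h _ _ _.
have B0 : 0 < B.
  by case: (uniq4_neq h) => _ _ _ [? ? _]; apply: eproj_gt0 h _ _ _.
congr acos; rewrite -sqrtrM ?divr_ge0 ?ltW //.
set D := A * B - C ^+ 2 in D0 *.
have -> : B / D * (A / D) = A * B * (D ^-1) ^+ 2 by field; rewrite gt_eqF.
have -> : A * B = (q a c * q b d * (q a d * q b c)) * (2 / q a b) ^+ 2.
  by rewrite /A /B !(mink_eproj h) !vgramii; field.
rewrite /C (mink_eproj h).
set W := q a c * q b d * _; have W0 : 0 < W by rewrite !mulr_gt0.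
have S0 : 0 < Num.sqrt W by rewrite sqrtr_gt0.
set N := _ + _ - _.
rewrite -mulrA -exprMn sqrtrM ?(ltW W0) // sqrtr_sqr ger0_norm; last first.
  by rewrite mulr_ge0 ?invr_ge0 ?(ltW D0) // divr_ge0 ?(ltW qab).
by field; rewrite !gt_eqF.
Qed.

End IdealTetrahedron.

(* The square of the side joining the vertices b and c of the Euclidean triangle
   that the tetrahedron cuts on the horosphere [mink x (row a V) = -1]. *)
Definition link_side {R : realType} (V : 'M[R]_4) (a b c : 'I_4) : R :=
  2 * vgram V b c / (vgram V a b * vgram V a c).

(* The squared hyperbolic sine of the distance from x to the edge ab. *)
Definition edge_sinh2 {R : realType} (V : 'M[R]_4) (a b : 'I_4) (x : 'rV[R]_4) : R :=
  2 * (mink x (row a V) * mink x (row b V)) / vgram V a b - 1.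

Lemma finite_min_gt0 (R : realType) (I : finType) (P : I -> R -> Prop) :
  (forall i, exists2 e, 0 < e & forall e', 0 < e' -> e' <= e -> P i e') ->
  exists2 e, 0 < e & forall i e', 0 < e' -> e' <= e -> P i e'.
Proof.
move=> h; have /choice[f hf] : forall i, exists e : R, 0 < e /\
    forall e', 0 < e' -> e' <= e -> P i e'.
  by move=> i; have [e] := h i; exists e.
exists (\big[Order.min/1]_i f i).
  by apply/lt_bigmin => // i _; exact: (hf i).1.
move=> i e' e0 he; apply: (hf i).2 => //; apply: le_trans he _.
exact: bigmin_le_cond.
Qed.

(** * Estimates from the lower bound on the dihedral angles *)

Section Fatness.
Context {R : realType}.
Variable V : 'M[R]_4.
Hypothesis idealV : ideal_vertices V.
Local Notation q := (vgram V).
Implicit Types a b c d : 'I_4.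
Implicit Types x u w y z : 'rV[R]_4.

Lemma uniq4I a b c d :
  a != b -> a != c -> a != d -> b != c -> b != d -> c != d -> uniq [:: a; b; c; d].
Proof. by rewrite /= !inE !negb_or => -> -> -> -> -> ->. Qed.

Lemma mem_uniq4 a b c d k : uniq [:: a; b; c; d] -> k \in [:: a; b; c; d].
Proof.
move=> h; have /eqP := card_uniqP h; rewrite /= => hc.
have := subset_cardP _ (subset_predT (mem [:: a; b; c; d])).
by rewrite card_ord (eqP hc) => /(_ erefl k) ->.
Qed.

Lemma disc_gt0 a b c d : uniq [:: a; b; c; d] ->
  0 < 4 * (q a c * q b d * (q a d * q b c)) -
      (q a c * q b d + q a d * q b c - q a b * q c d) ^+ 2.
Proof.
move=> h; have := eproj_cauchy idealV h; rewrite !(mink_eproj idealV h) !(vgramii idealV).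
have [[ab _ _] _ _ _] := uniq4_neq h; have qab := vgram_gt0 idealV ab.
set X := (X in 0 < X -> _); set Y := (X in _ -> 0 < X).
have -> : X = Y / q a b ^+ 2 by rewrite /X /Y; field; rewrite gt_eqF.
by rewrite pmulr_lgt0 // invr_gt0 exprn_gt0.
Qed.

Lemma dihedral_bound a b c d (W := q a c * q b d * (q a d * q b c))
    (N := q a c * q b d + q a d * q b c - q a b * q c d) : uniq [:: a; b; c; d] ->
  0 < W /\ -1 <= N / (2 * Num.sqrt W) <= 1.
Proof.
move=> h; have D0 := disc_gt0 h; rewrite -/W -/N in D0.
have W0 : 0 < W by have := sqr_ge0 N; lra.
split=> //; have S0 : 0 < Num.sqrt W by rewrite sqrtr_gt0.
have SW := sqr_sqrtr (ltW W0).
rewrite ler_pdivlMr ?ler_pdivrMr ?mulr_gt0 // mul1r mulN1r -ler_norml.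
rewrite -(ger0_norm (_ : 0 <= 2 * Num.sqrt W)) ?mulr_ge0 ?(ltW S0) //.
by rewrite -!sqrtr_sqr ler_wsqrtr // exprMn SW; lra.
Qed.

Lemma dihedral_le_pi a b : a != b -> dihedral_angle V a b <= pi.
Proof.
move=> ab; have [c [d h]] := ord4_complete2 ab.
have h' : uniq [:: c; d; a; b].
  by case: (uniq4_neq h) => -[? ? ?] [? ? ?] [? ? ?] [? ? ?]; apply: uniq4I.
by rewrite (dihedral_angleE idealV h') acos_lepi //; have [] := dihedral_bound h'.
Qed.

(** An angle between t and pi/2 has sine at least sin t. An obtuse angle is bounded through another
    angle of the link triangle: if the angle along ab is obtuse, then P > Q + S for the products P,
    Q, S of opposite Gram entries, so the angle along ac is acute. The discriminant for ac is the
    same, and its lower bound contains P S > Q S. *)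
Lemma fat_sin (t : R) : 0 <= t <= pi ->
  (forall a b, a != b -> t <= dihedral_angle V a b) -> fat (sin t) V.
Proof.
move=> t0 ht.
have key a b c d : uniq [:: a; b; c; d] ->
    0 <= q a c * q b d + q a d * q b c - q a b * q c d ->
    sin t ^+ 2 * (4 * (q a c * q b d * (q a d * q b c))) <=
    4 * (q a c * q b d * (q a d * q b c)) -
    (q a c * q b d + q a d * q b c - q a b * q c d) ^+ 2.
  move=> h; have [_ _ _ [_ _ dc]] := uniq4_neq h.
  have := ht c d; rewrite eq_sym dc => /(_ isT); rewrite (dihedral_angleE idealV h).
  have [] := dihedral_bound h; set W := q a c * q b d * _; set N := _ - q a b * _.
  move=> W0 hz; set z := N / _ in hz *.
  have S0 : 0 < Num.sqrt W by rewrite sqrtr_gt0.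
  have SW := sqr_sqrtr (ltW W0) => hc N0.
  have : z <= cos t.
    rewrite -[leLHS]acosK ?in_itv //= leNgt ltr_cos ?in_itv //= -?leNgt //.
    by rewrite acos_ge0 // acos_lepi.
  rewrite ler_pdivrMr ?mulr_gt0 // => hN; rewrite sin2cos2.
  suff : N ^+ 2 <= (cos t * (2 * Num.sqrt W)) ^+ 2 by rewrite !exprMn SW; lra.
  by rewrite !expr2 ler_pM.
move=> a b c d h /=.
have [N0|N0] := leP 0 (q a c * q b d + q a d * q b c - q a b * q c d); first exact: key.
have h' : uniq [:: a; c; b; d].
  by case: (uniq4_neq h) => -[? ? ?] [? ? ?] [? ? ?] [? ? ?]; apply: uniq4I.
have := key _ _ _ _ h'; rewrite !(vgramC V c b).
have [_ /andP[_ _]] := dihedral_bound h.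
have [[ab ac ad] [_ bc bd] [_ _ cd] _] := uniq4_neq h.
have P0 : 0 < q a b * q c d by rewrite mulr_gt0 ?(vgram_gt0 idealV).
have Q0 : 0 < q a c * q b d by rewrite mulr_gt0 ?(vgram_gt0 idealV).
have R0 : 0 < q a d * q b c by rewrite mulr_gt0 ?(vgram_gt0 idealV).
move: P0 Q0 R0 N0; set P := q a b * q c d; set Q := q a c * q b d.
set R' := q a d * q b c => P0 Q0 R0 N0.
have N1 : 0 <= P + R' - Q by lra.
move/(_ N1) => h1.
have : sin t ^+ 2 * (4 * (Q * R')) <= sin t ^+ 2 * (4 * (P * R')).
  by rewrite ler_wpM2l ?sqr_ge0 // ler_pM2l // ler_pM2r //; lra.
by move/le_trans => /(_ _ h1) /le_trans; apply; lra.
Qed.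

(** D is Heron's polynomial 2 (P Q + Q S + S P) - P^2 - Q^2 - S^2. Being symmetric, it is unchanged
    when the vertices are permuted in [fat]. *)
Lemma fat_disc s a b c d (P := q a b * q c d) (Q := q a c * q b d)
    (S := q a d * q b c) (D := 4 * (Q * S) - (Q + S - P) ^+ 2) :
  fat s V -> uniq [:: a; b; c; d] ->
  [/\ s ^+ 2 * (4 * (Q * S)) <= D, s ^+ 2 * (4 * (P * S)) <= D &
      s ^+ 2 * (4 * (P * Q)) <= D].
Proof.
move=> hf h; split; first exact: hf h.
- have h' : uniq [:: a; c; b; d].
    by case: (uniq4_neq h) => -[? ? ?] [? ? ?] [? ? ?] [? ? ?]; apply: uniq4I.
  have := hf _ _ _ _ h' => /=; rewrite !(vgramC V c b) -/P -/Q -/S => /le_trans; apply.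
  by rewrite /D; lra.
- have h' : uniq [:: a; d; b; c].
    by case: (uniq4_neq h) => -[? ? ?] [? ? ?] [? ? ?] [? ? ?]; apply: uniq4I.
  have := hf _ _ _ _ h' => /=; rewrite !(vgramC V d) -/P -/Q -/S => /le_trans; apply.
  by rewrite /D; lra.
Qed.

Lemma fat_le1 s : 0 <= s -> fat s V -> s <= 1.
Proof.
move=> s0 hf; have [b [c [d h]]] := ord4_complete1 ord0.
have [+ _ _] := fat_disc hf h; have [W0 _] := dihedral_bound h.
set W := q _ _ * _ * _ in W0 *.
set N := q ord0 c * q b d + q ord0 d * q b c - q ord0 b * q c d => h1.
have : s ^+ 2 <= 1.
  have W4 : 0 < 4 * W by rewrite mulr_gt0.
  by rewrite -(ler_pM2r W4) mul1r (le_trans h1) // lerBlDr lerDl sqr_ge0.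
by rewrite expr_le1.
Qed.

Lemma link_sideC a b c : link_side V a b c = link_side V a c b.
Proof. by rewrite /link_side (vgramC V b c) (mulrC (q a b)). Qed.

Lemma link_side_gt0 a b c : a != b -> a != c -> b != c -> 0 < link_side V a b c.
Proof.
by move=> ? ? ?; rewrite /link_side divr_gt0 ?mulr_gt0 // vgram_gt0.
Qed.

(** Law of sines in the link triangle at a. The discriminant is 4 P Q - (P + Q - R')^2, hence at
    most 4 P Q, and [fat] bounds it below by 4 s^2 P R'. *)
Lemma link_side_adjacent s a b c d : fat s V -> uniq [:: a; b; c; d] ->
  s ^+ 2 * link_side V a b c <= link_side V a b d.
Proof.
move=> hf h; have [[ab ac ad] [_ bc bd] [_ _ cd] _] := uniq4_neq h.
have q1 := vgram_gt0 idealV ab; have q2 := vgram_gt0 idealV ac.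
have q3 := vgram_gt0 idealV ad; have q4 := vgram_gt0 idealV bc.
have q5 := vgram_gt0 idealV bd; have q6 := vgram_gt0 idealV cd.
have [_ h1 _] := fat_disc hf h; move: h1.
set P := q a b * q c d; set Q := q a c * q b d; set R' := q a d * q b c => h1.
have P0 : 0 < P by rewrite mulr_gt0.
have h2 : s ^+ 2 * R' <= Q.
  have P4 : 0 < 4 * P by rewrite mulr_gt0.
  rewrite -(ler_pM2r P4); have := sqr_ge0 (P + Q - R').
  have -> : s ^+ 2 * R' * (4 * P) = s ^+ 2 * (4 * (P * R')) by ring.
  by move=> h2; apply: le_trans h1 _; lra.
have -> : link_side V a b c = 2 / (q a b * q a c * q a d) * R'.
  by rewrite /link_side /R'; field; rewrite !gt_eqF.
have -> : link_side V a b d = 2 / (q a b * q a c * q a d) * Q.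
  by rewrite /link_side /Q; field; rewrite !gt_eqF.
by rewrite mulrCA ler_wpM2l // divr_ge0 ?mulr_ge0 ?ltW.
Qed.

(** Two sides of a triangle share a vertex; the case distinction finds it in order to apply
    [link_side_adjacent]. *)
Lemma link_side_ratio s a i j k l : 0 <= s -> fat s V ->
  a != i -> a != j -> i != j -> a != k -> a != l -> k != l ->
  s ^+ 2 * link_side V a i j <= link_side V a k l.
Proof.
move=> s0 hf ai aj ij.
have base i' j' l' : a != i' -> a != j' -> i' != j' -> a != l' -> i' != l' ->
    s ^+ 2 * link_side V a i' j' <= link_side V a i' l'.
  move=> h1 h2 h3 h4 h5; case: (eqVneq j' l') => [<-|h6].
    rewrite ler_piMl //; first by rewrite ltW // link_side_gt0.
    by rewrite expr_le1 // fat_le1.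
  by apply: link_side_adjacent => //=; rewrite !inE !negb_or h1 h2 h4 h3 h5 h6.
move=> ak al kl.
have [d hd] : exists d, uniq [:: a; i; j; d].
  by apply: ord4_complete3; rewrite /= !inE !negb_or ai aj ij.
have mem m : m \in [:: a; i; j; d] := mem_uniq4 m hd.
case: (eqVneq i k) => [ik|ik]; first by rewrite -ik in kl *; apply: base.
case: (eqVneq i l) => [il|il].
  by rewrite (link_sideC a k) -il; apply: base => //; rewrite il eq_sym.
case: (eqVneq j k) => [jk|jk].
  rewrite (link_sideC a i) -jk; apply: base => //; first by rewrite eq_sym.
  by rewrite jk.
case: (eqVneq j l) => [jl|jl].
  rewrite (link_sideC a i) (link_sideC a k) -jl; by apply: base => //; rewrite eq_sym.
have := mem k; rewrite !inE (eq_sym k a) (negbTE ak) (eq_sym k i) (negbTE ik).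
rewrite (eq_sym k j) (negbTE jk) /= => /eqP kd.
have := mem l; rewrite !inE (eq_sym l a) (negbTE al) (eq_sym l i) (negbTE il).
by rewrite (eq_sym l j) (negbTE jl) /= -kd eq_sym (negbTE kl).
Qed.

Lemma hyp3_bcoord x a b c d (e := fun k => bcoord V x 0 k) :
  hyp3 x -> uniq [:: a; b; c; d] ->
  1 = 2 * (e a * e b * q a b + e a * e c * q a c + e a * e d * q a d +
           e b * e c * q b c + e b * e d * q b d + e c * e d * q c d).
Proof.
move=> hx h; have := mink_bcoord2 idealV x; rewrite hx.1 opprK => e1; rewrite [LHS]e1.
rewrite (sum_ord4 _ h) !(mink_bcoord idealV) !(sum_ord4 _ h) !(vgramii idealV) -/e.
rewrite (vgramC V b a) (vgramC V c a) (vgramC V d a) (vgramC V c b).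
rewrite (vgramC V d b) (vgramC V d c).
by rewrite /e; ring.
Qed.

(** With a at infinity, - [mink x (row a V)] is the inverse of a height, and 1 / sqrt 3 is the
    circumradius of an equilateral triangle of side 1. Algebraically, if X, Y, Z are the three terms
    of this product, the bounds on the sides turn the norm equation of x into 1 <= XY + YZ + ZX <=
    (X + Y + Z)^2 / 3. *)
Lemma face_height a x : face V a x -> (forall i j, a != i -> a != j -> i != j -> link_side V a i j <= 1) ->
  3 <= mink x (row a V) ^+ 2.
Proof.
move=> /(faceP idealV)[hx he ea] hs; have [b [c [d h]]] := ord4_complete1 a.
have := hyp3_bcoord hx h; rewrite ea.
have : - mink x (row a V) = _ := mink_bcoord idealV x a.
rewrite (sum_ord4 _ h) ea mul0r add0r => hf.
have [[ab ac ad] [_ bc bd] [_ _ cd] _] := uniq4_neq h.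
have side i j : a != i -> a != j -> i != j -> 2 * q i j <= q i a * q j a.
  move=> ai aj ij; have := hs _ _ ai aj ij; rewrite /link_side (vgramC V a i) (vgramC V a j).
  by rewrite ler_pdivrMr ?mul1r // mulr_gt0 // vgram_gt0 // eq_sym.
have s1 := side _ _ ab ac bc; have s2 := side _ _ ab ad bd; have s3 := side _ _ ac ad cd.
have eb := he b; have ec := he c; have ed := he d.
rewrite -sqrrN hf => h1.
have t1 : bcoord V x 0 b * bcoord V x 0 c * (2 * q b c) <= bcoord V x 0 b * bcoord V x 0 c * (q b a * q c a).
  by rewrite ler_wpM2l // mulr_ge0.
have t2 : bcoord V x 0 b * bcoord V x 0 d * (2 * q b d) <= bcoord V x 0 b * bcoord V x 0 d * (q b a * q d a).
  by rewrite ler_wpM2l // mulr_ge0.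
have t3 : bcoord V x 0 c * bcoord V x 0 d * (2 * q c d) <= bcoord V x 0 c * bcoord V x 0 d * (q c a * q d a).
  by rewrite ler_wpM2l // mulr_ge0.
have h2 := sqr_ge0 (bcoord V x 0 b * q b a - bcoord V x 0 c * q c a).
have h3 := sqr_ge0 (bcoord V x 0 b * q b a - bcoord V x 0 d * q d a).
have h4 := sqr_ge0 (bcoord V x 0 c * q c a - bcoord V x 0 d * q d a).
move: h1 t1 t2 t3 h2 h3 h4; clear; set B := bcoord V x 0 b; set C := bcoord V x 0 c; set D := bcoord V x 0 d.
by rewrite !sqrrB !sqrrD; lra.
Qed.

(** Put b at infinity. The edge ab is a vertical line, and x lies above the side cd of the link
    triangle, whose Euclidean distance to a is at least s times the side ac. The hyperbolic sine of
    the distance to a vertical line is the horizontal distance divided by the height. *)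
Lemma edge_sinh2_face s a b c d x : fat s V -> uniq [:: a; b; c; d] -> face V a x ->
  s ^+ 2 * link_side V b a c * mink x (row b V) ^+ 2 <= edge_sinh2 V a b x.
Proof.
move=> hf h /(faceP idealV)[hx he ea].
have [[ab ac ad] [_ bc bd] [_ _ cd] _] := uniq4_neq h.
have q1 := vgram_gt0 idealV ab; have q2 := vgram_gt0 idealV ac.
have q3 := vgram_gt0 idealV ad; have q4 := vgram_gt0 idealV bc.
have q5 := vgram_gt0 idealV bd; have q6 := vgram_gt0 idealV cd.
have := hyp3_bcoord hx h; rewrite ea.
have : - mink x (row a V) = _ := mink_bcoord idealV x a.
have : - mink x (row b V) = _ := mink_bcoord idealV x b.
rewrite !(sum_ord4 _ h) ea !(vgramii idealV) !(mul0r, mulr0, add0r, addr0) => fb fa h1.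
have -> : edge_sinh2 V a b x = 2 * (- mink x (row a V) * - mink x (row b V)) / q a b - 1.
  by rewrite /edge_sinh2 mulrNN.
rewrite -(sqrrN (mink x _)) fb fa [X in _ - X]h1.
have [_ _] := fat_disc hf h.
rewrite /link_side (vgramC V b a) (vgramC V c a) (vgramC V c b) (vgramC V d a).
rewrite (vgramC V d b).
set C := bcoord V x 0 c; set D := bcoord V x 0 d; set B := bcoord V x 0 b.
set X := C * q b c; set Y := D * q b d; set Q := q a c * q b d.
set P := q a b * q c d; set S := q a d * q b c; set N := Q + S - P => h2.
have P0 : 0 < P by rewrite mulr_gt0.
have h3 : s ^+ 2 * Q * (X + Y) ^+ 2 <= Q * X ^+ 2 + N * (X * Y) + S * Y ^+ 2.
  have P4 : 0 < 4 * P by rewrite mulr_gt0.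
  rewrite -(ler_pM2r P4).
  have h4 : s ^+ 2 * (4 * (P * Q)) * (X + Y) ^+ 2 <=
            (4 * (Q * S) - N ^+ 2) * (X + Y) ^+ 2 by rewrite ler_wpM2r ?sqr_ge0.
  (* Completing the square: 4 P (Q X^2 + N X Y + S Y^2) equals (4 Q S - N^2) (X + Y)^2 plus this
     square. *)
  have := sqr_ge0 (X * (N - 2 * Q) + Y * (2 * S - N)).
  by rewrite /N; move: h4; rewrite /N; lra.
have -> : s ^+ 2 * (2 * q a c / (q a b * q b c)) * (X + Y) ^+ 2 =
    2 / (q a b * q b c * q b d) * (s ^+ 2 * Q * (X + Y) ^+ 2).
  by rewrite /Q; field; rewrite !gt_eqF.
apply: (le_trans (ler_wpM2l _ h3)); first by rewrite divr_ge0 ?mulr_ge0 ?ltW.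
by rewrite le_eqVlt; apply/orP; left; apply/eqP; rewrite /X /Y /N /Q /S /P; field; rewrite !gt_eqF.
Qed.

(** The planes opposite to c and d meet along the edge ab. For x in the first, the hyperbolic sine
    of the distance to the second is that of the distance to the edge times the sine of the dihedral
    angle; and the line from x reaches the second plane at time t. *)
Lemma edge_sinh2_pencil s a b c d x u (t : R) : fat s V -> uniq [:: a; b; c; d] ->
  hyp3 x -> mink x u = 0 -> mink u u = 1 -> bcoord V x 0 c = 0 ->
  bcoord V (hline x u t) 0 d = 0 ->
  s ^+ 2 * edge_sinh2 V a b x <= sinh t ^+ 2.
Proof.
move=> hf h hx hxu hu xc xd.
have [[ab ac ad] [_ bc bd] [_ _ cd] _] := uniq4_neq h.
have q1 := vgram_gt0 idealV ab; have q2 := vgram_gt0 idealV ac.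
have q3 := vgram_gt0 idealV ad; have q4 := vgram_gt0 idealV bc.
have q5 := vgram_gt0 idealV bd; have q6 := vgram_gt0 idealV cd.
pose n := inner_normal V d.
have bn y : mink n y = bcoord V y 0 d.
  rewrite {1}(bcoord_sum idealV y) mink_sumr (sum_ord4 _ h) !minkZr.
  rewrite !(inner_normalP idealV) eqxx mulr1n.
  have [_ _ _ [/negbTE -> /negbTE -> /negbTE ->]] := uniq4_neq h.
  by rewrite !mulr0n; ring.
have hn : mink n n = _ := mink_inner_normal idealV h.
move: xd; rewrite -bn minkC mink_hline !(minkC _ n) => hd.
have := @mink_orth_ge0 _ x (n + mink n x *: x - mink n u *: u) (hyp3_timelike hx).
rewrite !minkE !(minkC u x) !(minkC _ n) hxu hu hx.1 => /(_ ltac:(by ring)) hc.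
(* The squared hyperbolic sine of the distance from x to the plane orthogonal to n is
   [mink n x ^+ 2 / mink n n]. *)
have hcs : mink n x ^+ 2 <= sinh t ^+ 2 * mink n n.
  have e1 : cosh t ^+ 2 * mink n x ^+ 2 = sinh t ^+ 2 * mink n u ^+ 2.
    apply/eqP; rewrite -subr_eq0 -!exprMn subr_sqr hd mulr0 //.
  have hct : cosh t ^+ 2 = 1 + sinh t ^+ 2 by rewrite -(cosh2_sinh2 t) subrK.
  move: e1; rewrite hct.
  have hc' : mink n u ^+ 2 <= mink n n + mink n x ^+ 2 by move: hc; lra.
  have : sinh t ^+ 2 * mink n u ^+ 2 <= sinh t ^+ 2 * (mink n n + mink n x ^+ 2).
    by rewrite ler_wpM2l ?sqr_ge0.
  by move: (mink n n) (mink n x ^+ 2) (mink n u ^+ 2) (sinh t ^+ 2) (cosh t ^+ 2); clear=> *; lra.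
have hK : edge_sinh2 V a b x = mink n x ^+ 2 * mink (eproj V a b d) (eproj V a b d).
  have := hyp3_bcoord hx h; rewrite bn xc => h1.
  have : - mink x (row a V) = _ := mink_bcoord idealV x a.
  have : - mink x (row b V) = _ := mink_bcoord idealV x b.
  rewrite !(sum_ord4 _ h) xc !(vgramii idealV) !(mul0r, mulr0, add0r, addr0) => fb fa.
  have -> : edge_sinh2 V a b x = 2 * (- mink x (row a V) * - mink x (row b V)) / q a b - 1.
    by rewrite /edge_sinh2 mulrNN.
  rewrite fa fb [X in _ - X]h1 (mink_eproj idealV h) (vgramii idealV) (vgramC V b a).
  by rewrite !(vgramC V d); field; rewrite gt_eqF.
have D0 := eproj_cauchy idealV h.
have [W1 _ _] := fat_disc hf h.
have B0 : 0 < mink (eproj V a b d) (eproj V a b d).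
  by case: (uniq4_neq h) => _ _ _ [? ? _]; apply: (eproj_gt0 idealV h).
have A0 : 0 < mink (eproj V a b c) (eproj V a b c).
  by case: (uniq4_neq h) => _ _ [? ? _] _; apply: (eproj_gt0 idealV h).
move: hn D0 hK A0 B0; rewrite -/n.
set A := mink (eproj V a b c) (eproj V a b c).
set B := mink (eproj V a b d) (eproj V a b d).
set C := mink (eproj V a b c) (eproj V a b d) => hn D0 -> A0 B0.
have W2 : s ^+ 2 * (A * B) <= A * B - C ^+ 2.
  rewrite /A /B /C !(mink_eproj idealV h) !(vgramii idealV) !mulr0 !subr0.
  have q12 : 0 < q a b ^+ 2 by rewrite exprn_gt0.
  rewrite -(ler_pM2r q12); move: W1; congr (_ <= _); field; exact: lt0r_neq0.
rewrite mulrA -(ler_pM2r A0).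
have -> : s ^+ 2 * mink n x ^+ 2 * B * A = mink n x ^+ 2 * (s ^+ 2 * (A * B)) by ring.
apply: le_trans (ler_wpM2l (sqr_ge0 _) W2) _.
apply: le_trans (ler_wpM2r (ltW D0) hcs) _.
by rewrite hn -mulrA divfK // gt_eqF.
Qed.

End Fatness.

(** * Nearby points of a tetrahedron and points near its cusps *)

Section Toward.
Context {R : realType}.
Implicit Types x y z w u : 'rV[R]_4.

(** For small e, this moves x slightly towards a causal vector w, which will be an ideal vertex or
    the sum of the four vertices. *)
Definition toward x w (e : R) : 'rV[R]_4 :=
  (Num.sqrt (- mink (x + e *: w) (x + e *: w)))^-1 *: (x + e *: w).

Let norm2E x w (e : R) : hyp3 x ->
  - mink (x + e *: w) (x + e *: w) = 1 + 2 * e * - mink x w + e ^+ 2 * - mink w w.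
Proof. by move=> hx; rewrite !minkE (minkC w x) hx.1; ring. Qed.

Let norm2_ge1 x w (e : R) : hyp3 x -> mink w w <= 0 -> mink x w < 0 -> 0 <= e ->
  1 <= Num.sqrt (- mink (x + e *: w) (x + e *: w)).
Proof.
move=> hx hw hxw e0; rewrite -[leLHS]sqrtr1 ler_wsqrtr // norm2E //.
rewrite -addrA lerDl addr_ge0 // !mulr_ge0 ?sqr_ge0 // oppr_ge0 //; exact: ltW.
Qed.

Lemma toward_hyp3 x w (e : R) : hyp3 x -> mink w w <= 0 -> mink x w < 0 -> 0 <= e ->
  hyp3 (toward x w e).
Proof.
move=> hx hw hxw e0; have n1 := norm2_ge1 hx hw hxw e0.
rewrite /toward; set n := Num.sqrt _ in n1 *.
have n0 : 0 < n by exact: lt_le_trans n1.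
have hm : mink (n^-1 *: (x + e *: w)) (n^-1 *: (x + e *: w)) = -1.
  rewrite minkZl minkZr mulrA -expr2 exprVn sqr_sqrtr.
    rewrite -[X in _ * X]opprK mulrN mulVf // norm2E //.
    rewrite gt_eqF // -addrA ltr_pwDl // addr_ge0 // !mulr_ge0 ?sqr_ge0 // oppr_ge0 //.
    exact: ltW.
  by rewrite norm2E // -addrA !addr_ge0 // !mulr_ge0 ?sqr_ge0 // oppr_ge0 // ltW.
split=> //; apply: (@mink_causal_future _ x) => //; first exact: hyp3_timelike.
- exact: hx.2.
- by rewrite hm; lra.
- rewrite minkZl pmulr_rlt0 ?invr_gt0 // minkDl minkZl hx.1 (minkC w).
  have := mulr_ge0_le0 e0 (ltW hxw); lra.
Qed.

Lemma toward_near x w (r : R) : hyp3 x -> mink w w <= 0 -> mink x w < 0 -> 0 < r ->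
  exists2 e, 0 < e & forall e', 0 < e' -> e' <= e -> hdist x (toward x w e') < r.
Proof.
move=> hx hw hxw r0; have c1 : 1 < cosh r by rewrite -cosh0 ltr_cosh // ltW.
exists ((cosh r - 1) / (2 * - mink x w)).
  by rewrite divr_gt0 ?subr_gt0 // mulr_gt0 ?oppr_gt0.
move=> e e0; rewrite ler_pdivlMr ?mulr_gt0 ?oppr_gt0 // => he.
have n1 := norm2_ge1 hx hw hxw (ltW e0).
rewrite hdist_lt //; last exact/toward_hyp3/ltW.
rewrite /toward minkZr; set n := Num.sqrt _ in n1 *.
have n0 : 0 < n by exact: lt_le_trans n1.
rewrite minkDr minkZr hx.1 -mulrN mulrC ltr_pdivrMr //.
have : cosh r <= cosh r * n by rewrite ler_peMr // (le_trans _ (ltW c1)).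
have : 0 < e * - mink x w by rewrite mulr_gt0 ?oppr_gt0.
by lra.
Qed.

Lemma toward_coord x w : hyp3 x -> mink w w <= 0 -> mink x w < 0 -> 0 <= w 0 0 ->
  exists2 e, 0 < e & forall e', 0 < e' -> e' <= e -> x 0 0 - 1 < toward x w e' 0 0.
Proof.
move=> hx hw hxw w0; set F := - mink x w; set E := - mink w w.
have F0 : 0 < F by rewrite oppr_gt0.
have E0 : 0 <= E by rewrite oppr_ge0.
have x0 := hx.2; set K := 2 * F + E; have K0 : 0 < K by rewrite /K; lra.
exists (Num.min 1 (2 * x 0 0 * K)^-1).
  by rewrite lt_min ltr01 invr_gt0 !mulr_gt0.
move=> e e0; rewrite le_min => /andP[e1 he].
have n1 := norm2_ge1 hx hw hxw (ltW e0); rewrite /toward !mxE; set n := Num.sqrt _ in n1 *.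
have n0 : 0 < n by exact: lt_le_trans n1.
have n2 : n ^+ 2 = 1 + 2 * e * F + e ^+ 2 * E.
  rewrite sqr_sqrtr norm2E // -/F -/E.
  by rewrite !addr_ge0 // !mulr_ge0 // ltW.
have hn : n <= 1 + e * K.
  have : n <= n ^+ 2 by rewrite expr2 ler_peMr // ltW.
  have : e ^+ 2 * E <= e * E by rewrite ler_wpM2r // expr2 ler_piMr // ltW.
  by rewrite n2 /K; lra.
have hxe : x 0 0 * (e * K) <= 2^-1.
  by move: he; rewrite -[_^-1]mul1r ler_pdivlMr ?mulr_gt0 //; lra.
rewrite mulrC ltr_pdivlMr //.
have : 0 <= e * w 0 0 by rewrite mulr_ge0 // ltW.
have : x 0 0 * (n - 1) <= 2^-1.
  by apply: le_trans hxe; rewrite ler_pM2l //; lra.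
lra.
Qed.

End Toward.

Section TetrahedronPoints.
Context {R : realType}.
Variable V : 'M[R]_4.
Hypothesis idealV : ideal_vertices V.
Local Notation q := (vgram V).
Implicit Types a b c d k : 'I_4.
Implicit Types x u w y z p : 'rV[R]_4.

Lemma bcoordDE x y k : bcoord V (x + y) 0 k = bcoord V x 0 k + bcoord V y 0 k.
Proof. by rewrite bcoordD mxE. Qed.

Lemma bcoordZE (t : R) x k : bcoord V (t *: x) 0 k = t * bcoord V x 0 k.
Proof. by rewrite bcoordZ mxE. Qed.

Lemma bcoord_vertexE j k : bcoord V (row j V) 0 k = (k == j)%:R.
Proof. by rewrite (bcoord_vertex idealV) mxE eqxx. Qed.

Lemma gram_entry (W : 'M[R]_4) k l :
  (W *m minkJ *m W^T) k l = mink (row k W) (row l W).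
Proof.
rewrite /mink -row_mul tr_row !mxE; apply: eq_bigr => j _.
by rewrite !mxE.
Qed.

Lemma tetrahedron_hyp3 x : tetrahedron V x -> hyp3 x. Proof. by case. Qed.

Lemma bcoord_hyp3 x : (forall k, 0 <= bcoord V x 0 k) -> mink x x = -1 -> hyp3 x.
Proof.
move=> h hx; split=> //.
have x0 : 0 <= x 0 0.
  rewrite (bcoord_sum idealV x) summxE; apply: sumr_ge0 => k _.
  by rewrite mxE mulr_ge0 // ltW // vertex_future.
rewrite lt_neqAle x0 andbT; apply/eqP => h0.
by move: hx; rewrite mink_edot -h0 mulr0 subr0 => h1; have := edot_ge0 x; lra.
Qed.

Lemma bcoord_toward x w (e : R) k : bcoord V (toward x w e) 0 k =
  (Num.sqrt (- mink (x + e *: w) (x + e *: w)))^-1 * (bcoord V x 0 k + e * bcoord V w 0 k).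
Proof. by rewrite /toward bcoordZE bcoordDE bcoordZE. Qed.

(** Moving x slightly towards an ideal vertex exhibits this vertex as a combination of x and a
    nearby point y. Linear identities known only near x inside the tetrahedron thus extend to the
    vertices, which span the space. Faces through the vertex are preserved, so that y may be kept in
    a face. *)
Lemma tetrahedron_toward_vertex x k (r : R) : tetrahedron V x -> 0 < r ->
  exists y (al be : R), [/\ tetrahedron V y, hdist x y < r,
    forall j, j != k -> face V j x -> face V j y & row k V = al *: y + be *: x].
Proof.
move=> Tx r0; have /(tetrahedronP idealV)[hx bx] := Tx.
have vk : mink (row k V) (row k V) <= 0 by rewrite mink_vertex.
have xk : mink x (row k V) < 0 by rewrite -oppr_gt0 mink_hyp3_vertex.
have [e e0 he] := toward_near hx vk xk r0.
have hy := toward_hyp3 hx vk xk (ltW e0).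
pose n := Num.sqrt (- mink (x + e *: row k V) (x + e *: row k V)).
have by0 j : 0 <= bcoord V (toward x (row k V) e) 0 j.
  rewrite bcoord_toward bcoord_vertexE mulr_ge0 ?invr_ge0 ?sqrtr_ge0 //.
  by rewrite addr_ge0 // mulr_ge0 // ltW.
exists (toward x (row k V) e), (e^-1 * n), (- e^-1); split.
- exact/(tetrahedronP idealV).
- exact: he.
- move=> j jk /(faceP idealV)[_ _ xj]; apply/(faceP idealV); split=> //.
  by rewrite bcoord_toward xj bcoord_vertexE (negbTE jk) mulr0 addr0 mulr0.
- have n0 : n != 0.
    apply/eqP => n0; have : toward x (row k V) e = 0.
      by rewrite /toward -/n n0 invr0 scale0r.
    by move=> h; have := hy.2; rewrite h mxE ltxx.
  rewrite /toward -/n scalerA -mulrA divff // mulr1 scalerDr scalerA.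
  by rewrite mulVf ?gt_eqF // scale1r scaleNr addrAC subrr add0r.
Qed.

(** Interior points are not identified with others in the quotient. The bound on the first
    coordinate ensures that approximations of an escaping sequence still escape. *)
Lemma tetrahedron_interior_near x (r : R) : tetrahedron V x -> 0 < r ->
  exists z, [/\ hyp3 z, forall k, 0 < bcoord V z 0 k, hdist x z < r & x 0 0 - 1 < z 0 0].
Proof.
move=> Tx r0; have /(tetrahedronP idealV)[hx bx] := Tx.
pose w : 'rV[R]_4 := \sum_k row k V.
have bw k : bcoord V w 0 k = 1.
  rewrite /bcoord /w mulmx_suml summxE (bigD1 k) //= big1 ?addr0.
    by rewrite -/(bcoord V (row k V)) bcoord_vertexE eqxx.
  move=> j jk; by rewrite -/(bcoord V (row j V)) bcoord_vertexE eq_sym (negbTE jk).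
have ww : mink w w <= 0.
  rewrite mink_suml -oppr_ge0 -sumrN sumr_ge0 // => i _.
  by rewrite mink_sumr -sumrN sumr_ge0 // => j _; exact: vgram_ge0.
have xw : mink x w < 0.
  rewrite mink_sumr -oppr_gt0 -sumrN (bigD1 ord0) //= ltr_pwDl ?mink_hyp3_vertex //.
  by apply: sumr_ge0 => j _; rewrite ltW // mink_hyp3_vertex.
have w0 : 0 <= w 0 0.
  by rewrite summxE sumr_ge0 // => k _; rewrite ltW // vertex_future.
have [e1 e10 h1] := toward_near hx ww xw r0.
have [e2 e20 h2] := toward_coord hx ww xw w0.
pose e := Num.min e1 e2; have e0 : 0 < e by rewrite lt_min e10.
have hz := toward_hyp3 hx ww xw (ltW e0).
exists (toward x w e); split=> //.
- move=> k; rewrite bcoord_toward bw mulr1 mulr_gt0 ?ltr_wpDl //.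
  rewrite invr_gt0 lt_neqAle sqrtr_ge0 andbT eq_sym; apply/eqP => n0.
  by have := hz.2; rewrite /toward n0 invr0 scale0r mxE ltxx.
- by apply: h1; rewrite ?e0 // ge_min lexx.
- by apply: h2; rewrite ?e0 // ge_min lexx orbT.
Qed.

(** Each vertex is a combination of x and a nearby point; W collects the same combinations of their
    images. W has the Gram matrix of V, so the matrix A sending V to W preserves the form, and the
    products with the vertices determine every image. This also works at boundary points x. *)
Lemma local_isometry_linear x (r : R) (phi : 'rV[R]_4 -> 'rV[R]_4) :
  tetrahedron V x -> 0 < r ->
  (forall y z, tetrahedron V y -> tetrahedron V z -> hdist x y < r -> hdist x z < r ->
     mink (phi y) (phi z) = mink y z) ->
  exists2 A, A *m minkJ *m A^T = minkJ :> 'M[R]_4 &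
    forall y, tetrahedron V y -> hdist x y < r -> phi y = y *m A.
Proof.
move=> Tx r0 hphi; have hx := tetrahedron_hyp3 Tx.
have xx : hdist x x < r by rewrite hdistxx.
have /choice[Y hY] : forall k, exists yab : 'rV[R]_4 * R * R,
    [/\ tetrahedron V yab.1.1, hdist x yab.1.1 < r &
      row k V = yab.1.2 *: yab.1.1 + yab.2 *: x].
  move=> k; have [y [al [be [h1 h2 _ h3]]]] := tetrahedron_toward_vertex k Tx r0.
  by exists (y, al, be).
pose W := \matrix_k ((Y k).1.2 *: phi (Y k).1.1 + (Y k).2 *: phi x).
have hW k z : tetrahedron V z -> hdist x z < r -> mink (row k W) (phi z) = mink (row k V) z.
  move=> Tz xz; have [h1 h2 ->] := hY k; rewrite rowK !minkDl !minkZl.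
  by rewrite !hphi.
have hWW k l : mink (row k W) (row l W) = mink (row k V) (row l V).
  have [h1 h2 e] := hY l; rewrite [in RHS]e [row l W]rowK !minkDr !minkZr.
  by rewrite !hW.
pose A := invmx V *m W; have VA : V *m A = W by rewrite mulKVmx // unit_vertices.
have hA : A *m minkJ *m A^T = minkJ.
  have e : W *m minkJ *m W^T = V *m minkJ *m V^T.
    by apply/matrixP => k l; rewrite !gram_entry.
  have U := unit_vertices idealV.
  have -> : A *m minkJ *m A^T = invmx V *m (W *m minkJ *m W^T) *m (invmx V)^T.
    by rewrite /A trmx_mul !mulmxA.
  rewrite e !mulmxA mulVmx // mul1mx -mulmxA -trmx_mul mulVmx // trmx1 mulmx1 //.
have rA k : row k W = row k V *m A by rewrite -row_mul VA.
exists A => // y Ty xy.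
have UA : A \in unitmx.
  have UJ : (minkJ : 'M[R]_4) \in unitmx.
    rewrite unitmxE det_diag unitfE; apply/prodf_neq0 => k _; rewrite mxE.
    by case: ifP; rewrite ?oppr_eq0 oner_eq0.
  by move: UJ; rewrite -{1}hA !unitmx_mul => /andP[/andP[]].
rewrite -[LHS](mulmxKV UA); congr (_ *m A); apply/subr0_eq/(mink_nondegenerate idealV) => k.
rewrite minkDl minkNl -(mink_mul (phi y *m invmx A) _ hA) mulmxKV // -rA.
by rewrite minkC hW // minkC subrr.
Qed.

(* The point at height 1/t over w in the upper half-space with the vertex a at
   infinity. *)
Definition horopoint a w (t : R) : 'rV[R]_4 :=
  t *: w + ((1 + t ^+ 2 * mink w w) / (2 * t)) *: row a V.

(** Modulo multiples of the vertex a, such a w is a point of the link triangle at a. *)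
Definition horobase a w : Prop :=
  mink w (row a V) = -1 /\ forall k, 0 <= bcoord V w 0 k.

Lemma mink_horopoint a w w' (t : R) : 0 < t -> mink w (row a V) = -1 ->
  mink w' (row a V) = -1 ->
  mink (horopoint a w t) (horopoint a w' t) = -1 - t ^+ 2 * mink (w - w') (w - w') / 2.
Proof.
move=> t0 hw hw'; rewrite /horopoint mink_comb mink_vertex // hw (minkC (row a V)) hw'.
by rewrite !minkE (minkC w'); field; rewrite gt_eqF.
Qed.

Lemma horopoint_tetrahedron a w (t : R) : 0 < t -> horobase a w ->
  t ^+ 2 * - mink w w <= 1 -> tetrahedron V (horopoint a w t).
Proof.
move=> t0 [hw bw] ht; apply/(tetrahedronP idealV).
have b0 k : 0 <= bcoord V (horopoint a w t) 0 k.
  rewrite /horopoint bcoordDE !bcoordZE bcoord_vertexE.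
  rewrite addr_ge0 ?mulr_ge0 ?bw ?invr_ge0 ?(ltW t0) ?mulr_ge0 ?ler0n ?(ltW t0) //.
  by lra.
split=> //; apply: bcoord_hyp3 => //.
by rewrite mink_horopoint // subrr mink0l; lra.
Qed.

Lemma bcoord_horopoint a w (t : R) k : k != a -> bcoord V (horopoint a w t) 0 k = t * bcoord V w 0 k.
Proof.
move=> ka; rewrite /horopoint bcoordDE !bcoordZE bcoord_vertexE (negbTE ka).
by rewrite mulr0 addr0.
Qed.

Lemma hdist_horopoint a w w' (t : R) : 0 < t -> mink w (row a V) = -1 ->
  mink w' (row a V) = -1 -> hyp3 (horopoint a w t) -> hyp3 (horopoint a w' t) ->
  hdist (horopoint a w t) (horopoint a w' t) <= 2 * t * Num.sqrt (mink (w - w') (w - w')).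
Proof.
move=> t0 hw hw' h h'; apply: le_trans (le_sqrt_cosh (hdist_ge0 h h')) _.
rewrite cosh_hdist // mink_horopoint //.
have -> : 2 * (- (-1 - t ^+ 2 * mink (w - w') (w - w') / 2) - 1) =
  t ^+ 2 * mink (w - w') (w - w') by field.
rewrite sqrtrM ?sqr_ge0 // sqrtr_sqr gtr0_norm // mulrA //.
Qed.

End TetrahedronPoints.

Lemma exists_nat_gt {R : realType} (x : R) : exists n : nat, x < n%:R.
Proof.
exists (Num.bound `|x|); apply: le_lt_trans (ler_norm x) _.
exact/archi_boundP/normr_ge0.
Qed.

(** * Compactness of bounded parts of a tetrahedron *)

Section Compactness.
Context {R : realType}.
Variable V : 'M[R]_4.
Hypothesis idealV : ideal_vertices V.
Implicit Types x y z : 'rV[R]_4.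

Lemma coord_cvg x i : (fun z : 'rV[R]_4 => z 0 i : R) z @[z --> x] --> x 0 i.
Proof. exact: (@coord_continuous R 1 4 0 i x). Qed.

Lemma linear_form_cvg (c : 'I_4 -> R) (F : set_system 'rV[R]_4) (FF : Filter F) x :
  (forall i, (fun z : 'rV[R]_4 => z 0 i : R) @ F --> x 0 i) ->
  (fun z : 'rV[R]_4 => \sum_k z 0 k * c k) @ F --> \sum_k x 0 k * c k.
Proof.
move=> h; rewrite !big_ord_recr big_ord0 /=.
under eq_fun do rewrite !big_ord_recr big_ord0 /=.
do 4![apply: cvgD; last by apply: cvgM; [exact: h|exact: cvg_cst]].
exact: cvg_cst.
Qed.

Lemma linear_form_continuous (c : 'I_4 -> R) :
  continuous (fun z : 'rV[R]_4 => \sum_k z 0 k * c k).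
Proof. by move=> x; exact: (@linear_form_cvg c (nbhs x) (nbhs_filter x) x (@coord_cvg x)). Qed.

Lemma mink_self_cvg (F : set_system 'rV[R]_4) (FF : Filter F) x :
  (forall i, (fun z : 'rV[R]_4 => z 0 i : R) @ F --> x 0 i) ->
  (fun z : 'rV[R]_4 => mink z z) @ F --> mink x x.
Proof.
move=> h; rewrite mink_edot /edot !big_ord_recr big_ord0 /=.
under eq_fun do rewrite mink_edot /edot !big_ord_recr big_ord0 /=.
apply: cvgB; last by apply: cvgM; exact: h.
do 3![apply: cvgD; last by apply: cvgM; exact: h].
exact: cvg_cst.
Qed.

Lemma mink_self_continuous : continuous (fun z : 'rV[R]_4 => mink z z).
Proof. by move=> x; exact: (@mink_self_cvg (nbhs x) (nbhs_filter x) x (@coord_cvg x)). Qed.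

Lemma tetrahedron_closed : closed (tetrahedron V).
Proof.
have -> : tetrahedron V = [set z | mink z z = -1] `&`
    \bigcap_k [set z | 0 <= bcoord V z 0 k].
  apply/seteqP; split=> z.
    by move=> /(tetrahedronP idealV)[hz h]; split; [exact: hz.1|move=> k _; exact: h].
  move=> [hz h]; have b0 k : 0 <= bcoord V z 0 k := h k I.
  by apply/(tetrahedronP idealV); split=> //; exact: (bcoord_hyp3 idealV).
apply: closedI.
  apply: (@preimage_closed _ _ (fun z : 'rV[R]_4 => mink z z) [set t | t = -1]).
    by move=> z _; exact: mink_self_continuous.
  exact: closed_eq.
apply: closed_bigI => k _.
apply: (@preimage_closed _ _ (fun z : 'rV[R]_4 => bcoord V z 0 k) [set t | 0 <= t]).
  move=> z _; under eq_fun do rewrite /bcoord mxE.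
  exact: linear_form_continuous.
exact: closed_ge.
Qed.

Lemma hdist_small x (r : R) : hyp3 x -> 0 < r -> \forall z \near x, hyp3 z -> hdist x z < r.
Proof.
move=> hx r0; have c1 : 1 < cosh r by rewrite -cosh0 ltr_cosh // ltW.
have : (fun z : 'rV[R]_4 => mink (z - x) (z - x)) z @[z --> x] --> (0 : R).
  have e (z : 'rV[R]_4) : mink (z - x) (z - x) = mink z z - 2 * (\sum_k z 0 k * (minkJ *m x^T) k 0) + mink x x.
    rewrite !minkE (minkC x z).
    have -> : mink z x = \sum_k z 0 k * (minkJ *m x^T) k 0 by rewrite /mink -mulmxA mxE.
    by ring.
  have -> : 0 = mink (x - x) (x - x) by rewrite subrr mink0l.
  rewrite e; under eq_fun do rewrite e.
  have FF := nbhs_filter x; move: FF (@coord_cvg x); move: (nbhs x) => F FF hF.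
  apply: cvgD; last exact: cvg_cst.
  apply: cvgB; first exact: mink_self_cvg.
  by apply: cvgM; [exact: cvg_cst|exact: linear_form_cvg].
move=> /cvgr_lt /(_ (2 * (cosh r - 1))) h.
have /h : 0 < 2 * (cosh r - 1) by rewrite mulr_gt0 // subr_gt0.
apply: filterS => z /= hz hz3; rewrite hdist_lt //; move: hz.
by rewrite !minkE (minkC z x) hx.1 hz3.1; lra.
Qed.

Lemma tetrahedron_accumulation (y : nat -> 'rV[R]_4) (B : R) :
  (forall n, tetrahedron V (y n)) -> (forall n, y n 0 0 <= B) ->
  exists2 x, tetrahedron V x &
    forall r, 0 < r -> forall N, exists2 n, (N <= n)%N & hdist x (y n) < r.
Proof.
move=> Ty yB; pose K := [set z : 'rV[R]_4 | forall i, z ord0 i \in `[- B, B]].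
have cK : compact K.
  apply: (@rV_compact _ _ (fun=> `[- B, B]%classic)).
  by move=> _; exact: segment_compact.
have yK n : K (y n).
  have [h _] := Ty n; have y0 := h.2; have hB := yB n.
  (* On the hyperboloid the first coordinate dominates the spatial part, so B bounds all
     coordinates. *)
  have e2 : edot (y n) (y n) <= y n 0 0 ^+ 2.
    by have := h.1; rewrite mink_edot expr2; lra.
  move=> i; rewrite in_itv /= -ler_norml; apply: le_trans hB.
  case: (unliftP ord0 i) => [j ->|->]; last by rewrite gtr0_norm.
  rewrite -(gtr0_norm y0) -!sqrtr_sqr ler_wsqrtr // (le_trans _ e2) //.
  rewrite /edot (bigD1 j) //= -expr2 lerDl sumr_ge0 // => l _.
  by rewrite -expr2 sqr_ge0.
have [x [Kx cx]] := cK (y @ \oo) _ (filterE _ yK).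
have acc (U : set 'rV[R]_4) : nbhs x U -> forall N, exists2 n, (N <= n)%N & U (y n).
  move=> Ux N; have [] := cx (y @` [set n | (N <= n)%N]) U _ Ux.
    by exists N => // n /= Nn; exists n.
  by move=> z [[n /= Nn <-] Uz]; exists n.
have Tx : tetrahedron V x.
  apply: (tetrahedron_closed) => U Ux; have [n _ Un] := acc U Ux 0%N.
  by exists (y n); split.
exists x => // r r0 N.
have [n Nn h] := acc _ (hdist_small Tx.1 r0) N; exists n => //.
by apply: h; case: (Ty n).
Qed.

End Compactness.

(** * The quotient map of a triangulation *)

Section Triangulation.
Context {R : realType} {M : metricType R} {m : nat}.
Variable tau : geometric_ideal_triangulation M m.
Local Notation V := (tri_vertices tau).
Local Notation T := (tri_map tau).
Local Notation s := (tri_pairing tau).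
Local Notation g := (tri_isometry tau).
Local Notation ideal := (tri_ideal tau).
Implicit Types i j : 'I_m.
Implicit Types x y z : 'rV[R]_4.

(** An interior point lies on no face, so no elementary gluing starts or ends there. *)
Lemma glued_interior (p p' : 'I_m * 'rV[R]_4) : glued V s g p p' ->
  (forall k, 0 < bcoord (V p.1) p.2 0 k) \/ (forall k, 0 < bcoord (V p'.1) p'.2 0 k) ->
  p = p'.
Proof.
have nf j y k : face (V j) k y -> ~ forall k, 0 < bcoord (V j) y 0 k.
  by move=> /(faceP (ideal j))[_ _ h] /(_ k); rewrite h ltxx.
elim=> {p p'}[p p' [k fk ->]||p p' _ IH|p p' p'' _ IH1 _ IH2] //.
- case=> h; first by case: (nf _ _ _ fk h).
  have := tri_face tau (p.1, k) => /seteqP[] /(_ (p.2 *m g (p.1, k))) + _.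
  by move=> /(_ (ex_intro2 _ _ _ fk erefl)) /nf /(_ h).
- by move=> h; rewrite IH //; case: h; [right|left].
- case=> h; first by rewrite -(IH1 (or_introl h)) in IH2 *; apply: IH2; left.
  by rewrite (IH2 (or_intror h)) in IH1 *; apply: IH1; right.
Qed.

Lemma tri_map_interior i j x y : tetrahedron (V i) x -> tetrahedron (V j) y ->
  (forall k, 0 < bcoord (V i) x 0 k) -> T i x = T j y -> (i, x) = (j, y).
Proof.
move=> Tx Ty h /(tri_identification Tx Ty) /glued_interior; apply.
by left.
Qed.

Lemma interior_tetrahedron i x : hyp3 x -> (forall k, 0 < bcoord (V i) x 0 k) ->
  tetrahedron (V i) x.
Proof. by move=> hx h; apply/(tetrahedronP (ideal i)); split=> // k; exact: ltW. Qed.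

Lemma openP_mdist (U : set M) (p : M) : open U -> U p ->
  exists2 r : R, 0 < r & forall q, mdist p q < r -> U q.
Proof.
move=> oU Up; have /nbhs_ballP[r /= r0 h] := open_nbhs_nbhs (conj oU Up).
by exists r => // q hq; apply: h; rewrite ballEmdist.
Qed.

(* Interior points approximating the y n form a set which is closed in M by the
   quotient topology, because it is finite in every bounded region. *)
Lemma no_escape i (y : nat -> 'rV[R]_4) (p : M) :
  (forall n, tetrahedron (V i) (y n)) -> (forall n, n%:R < y n 0 0) ->
  (forall n, mdist p (T i (y n)) < n.+1%:R^-1) -> False.
Proof.
move=> Ty yn py.
(* The z n are interior because the image of an interior point has a single preimage among all
   tetrahedra. *)
have /choice[z hz] : forall n, exists z, [/\ hyp3 z, forall k, 0 < bcoord (V i) z 0 k,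
    n%:R - 1 < z 0 0 & mdist p (T i z) < 2 * n.+1%:R^-1].
  move=> n; have [r r0 hr] := tri_isometric (Ty n).
  have r'0 : 0 < Num.min r n.+1%:R^-1 by rewrite lt_min r0 invr_gt0 ltr0n.
  have [z [hz bz + hz0]] := tetrahedron_interior_near (ideal i) (Ty n) r'0.
  rewrite lt_min => /andP[yz yz'].
  exists z; split=> //; first by have := yn n; lra.
  apply: le_lt_trans (metric_triangle _ (T i (y n)) _) _.
  have hy := (Ty n).1.
  rewrite hr ?hdistxx //; last exact: interior_tetrahedron.
  by rewrite mulr_natl mulr2n ltrD.
have Tz n : tetrahedron (V i) (z n) by have [h1 h2 _ _] := hz n; exact: interior_tetrahedron.
have zeq n j x : tetrahedron (V j) x -> T i (z n) = T j x -> (i, z n) = (j, x).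
  by move=> Tx; have [_ h2 _ _] := hz n; exact: tri_map_interior.
(* Two of the z n with the same image are equal, and their first coordinates tend to infinity, so p
   is the image of finitely many. *)
have [N hN] : exists N, forall n, (N <= n)%N -> T i (z n) <> p.
  have [[n0 h0]|h] := pselect (exists n0, T i (z n0) = p); last first.
    by exists 0%N => n _ hn; apply: h; exists n.
  have [N hN] := exists_nat_gt (z n0 0 0 + 1).
  exists N => n Nn; rewrite -h0 => /(zeq _ _ _ (Tz n0))[e].
  have [_ _ + _] := hz n; rewrite e.
  have : (N%:R : R) <= n%:R by rewrite ler_nat.
  by lra.
pose U := [set q | forall n, (N <= n)%N -> T i (z n) <> q].
have oU : open U.
  apply/(tri_quotient_topology) => j x Tx Ux.
  have hx := Tx.1.
  have [N' hN'] := exists_nat_gt (2 * x 0 0 * cosh 1 + 1).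
  (* By [le_coord_mink], a unit ball around x contains only finitely many z n; [near] treats these
     one at a time. *)
  have far y' n : tetrahedron (V j) y' -> hdist x y' < 1 -> (N' <= n)%N -> T i (z n) <> T j y'.
    move=> Ty' xy' N'n /(zeq _ _ _ Ty')[_ e].
    have [_ _ + _] := hz n; rewrite e => h.
    have := le_coord_mink hx Ty'.1; rewrite -cosh_hdist //; last exact: Ty'.1.
    have : 2 * x 0 0 * cosh (hdist x y') <= 2 * x 0 0 * cosh 1.
      rewrite ler_pM2l ?mulr_gt0 ?hx.2 // ler_cosh ?hdist_ge0 ?(ltW xy') //.
      exact: Ty'.1.
    have : (N'%:R : R) <= n%:R by rewrite ler_nat.
    by lra.
  have near n : exists2 r : R, 0 < r & (N <= n)%N -> forall y', tetrahedron (V j) y' ->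
      hdist x y' < r -> T i (z n) <> T j y'.
    have [e|ne] := pselect (z n = x); last first.
      exists (hdist x (z n)).
        rewrite lt_neqAle hdist_ge0 // ?andbT; last exact: (Tz n).1.
        by apply/eqP => /esym/hdist_eq0 e; apply: ne; rewrite e //; exact: (Tz n).1.
      by move=> _ y' Ty' + /(zeq _ _ _ Ty')[_ e]; rewrite -e ltxx.
    exists 1 => // Nn y' Ty' _ /(zeq _ _ _ Ty')[eij e2].
    have [_ h2 _ _] := hz n; apply: (Ux n Nn).
    by rewrite e; congr (T _ _); exact: eij.
  have [r r0 hr] : exists2 r : R, 0 < r & forall n, (n < N')%N -> (N <= n)%N ->
      forall y', tetrahedron (V j) y' -> hdist x y' < r -> T i (z n) <> T j y'.
    clear hN' far; elim: N' => [|N' [r r0 hr]]; first by exists 1.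
    have [r' r'0 hr'] := near N'; exists (Num.min r r'); first by rewrite lt_min r0.
    move=> n; rewrite ltnS leq_eqVlt => /predU1P[->|nN'] Nn y' Ty'; rewrite lt_min => /andP[h1 h2].
      exact: hr'.
    exact: hr.
  exists (Num.min 1 r); first by rewrite lt_min ltr01.
  move=> y' Ty'; rewrite lt_min => /andP[h1 h2] n Nn.
  by have [n1|n1] := ltnP n N'; [exact: hr|exact: far].
have [r r0 hr] := openP_mdist oU hN.
have [n hn] := exists_nat_gt (2 / r).
pose n' := maxn n N; have [_ _ _ h] := hz n'.
apply: (hr (T i (z n')) _ n' (leq_maxr _ _)) => //.
apply: lt_trans h _; rewrite ltr_pdivrMr ?ltr0n // mulrC -ltr_pdivrMr //.
apply: lt_le_trans hn _; rewrite ler_nat.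
by apply: leq_trans (leqnSn _); exact: leq_maxl.
Qed.

(** Otherwise some points outside W have images tending to p. Either their first coordinates can be
    chosen to tend to infinity, against [no_escape], or they accumulate at a point of the fibre over
    p, against the hypothesis on W. *)
Lemma tri_map_near i (p : M) (W : set 'rV[R]_4) :
  (forall x, tetrahedron (V i) x -> T i x = p ->
     exists2 r : R, 0 < r & forall y, tetrahedron (V i) y -> hdist x y < r -> W y) ->
  exists2 e : R, 0 < e & forall y, tetrahedron (V i) y -> mdist p (T i y) < e -> W y.
Proof.
move=> hW; apply: contrapT => hne.
have bad (e : R) : 0 < e -> exists y, [/\ tetrahedron (V i) y, mdist p (T i y) < e & ~ W y].
  move=> e0; apply: contrapT => h; apply: hne; exists e => // y Ty hy.
  by apply: contrapT => nW; apply: h; exists y.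
have [[B hB]|nB] := pselect (exists B : R, forall e : R, 0 < e -> exists y,
    [/\ tetrahedron (V i) y, mdist p (T i y) < e, ~ W y & y 0 0 <= B]); last first.
  have /choice[y hy] : forall n : nat, exists y, [/\ tetrahedron (V i) y,
      mdist p (T i y) < n.+1%:R^-1 & n%:R < y 0 0].
    move=> n; apply: contrapT => h; apply: nB; exists n%:R => e e0.
    have e'0 : 0 < Num.min e n.+1%:R^-1 by rewrite lt_min e0 invr_gt0 ltr0n.
    have [y [Ty + nWy]] := bad _ e'0; rewrite lt_min => /andP[h1 h2].
    exists y; split=> //; rewrite leNgt; apply/negP => h3.
    by apply: h; exists y.
  apply: (@no_escape i y p) => n; by have [] := hy n.
have /choice[y hy] : forall n : nat, exists y, [/\ tetrahedron (V i) y,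
    mdist p (T i y) < n.+1%:R^-1, ~ W y & y 0 0 <= B].
  by move=> n; apply: hB; rewrite invr_gt0 ltr0n.
have [||x Tx acc] := @tetrahedron_accumulation _ _ (ideal i) y B.
- by move=> n; have [] := hy n.
- by move=> n; have [] := hy n.
have px : T i x = p.
  apply/esym/mdist_positivity/eqP; rewrite eq_le mdist_ge0 andbT.
  apply/ler_addgt0Pl => e e0; rewrite addr0.
  have [r r0 hr] := tri_isometric Tx.
  have [n0 hn0] := exists_nat_gt (2 / e).
  have r'0 : 0 < Num.min r (e / 2) by rewrite lt_min r0 divr_gt0.
  have [n n0n] := acc _ r'0 n0; rewrite lt_min => /andP[h1 h2].
  have [Tyn hyn _ _] := hy n.
  apply: le_trans (metric_triangle _ (T i (y n)) _) _.
  rewrite (metric_sym (T i (y n))) hr ?hdistxx //; last exact: Tx.1.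
  have hn : n.+1%:R^-1 <= e / 2.
    rewrite invf_ple ?posrE ?ltr0n ?divr_gt0 // invf_div.
    apply: le_trans (ltW hn0) _; rewrite ler_nat.
    exact: leq_trans n0n (leqnSn _).
  by rewrite [leRHS]splitr lerD // ltW // (lt_le_trans hyn).
have [r r0 hr] := hW x Tx px.
have [n _ hn] := acc r r0 0%N; have [Tyn _ nW _] := hy n.
exact/nW/hr.
Qed.

End Triangulation.

(** * Lifting geodesics to tetrahedra *)

Section Lines.
Context {R : realType}.
Implicit Types x y z p w u : 'rV[R]_4.

Lemma mink_orth_cauchy p w w' : mink p p < 0 -> mink w p = 0 -> mink w' p = 0 ->
  mink w w' ^+ 2 <= mink w w * mink w' w'.
Proof.
move=> hp hw hw'; have B0 := mink_orth_ge0 hp hw'.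
move: B0; rewrite le_eqVlt => /predU1P[B0|B0].
  by rewrite (mink_orth_eq0 hp hw' (esym B0)) !mink0r expr0n mulr0.
have := @mink_orth_ge0 _ p (mink w' w' *: w - mink w w' *: w') hp.
rewrite -scaleNr minkDl !minkZl hw hw' !mulr0 addr0 => /(_ erefl).
rewrite mink_comb (minkC w' w).
set A := mink w w; set B := mink w' w' in B0 *; set C := mink w w' => h.
rewrite -subr_ge0 -(pmulr_rge0 _ B0); move: h; congr (0 <= _); ring.
Qed.

Lemma mink_sqrB x y : mink (x - y) (x - y) = mink x x - 2 * mink x y + mink y y.
Proof. by rewrite minkDl minkNl !minkDr !minkNr (minkC y x); ring. Qed.

(** After taking hyperbolic cosines this is Cauchy-Schwarz for the components of x and z orthogonal
    to y, of norms [sinh (hdist x y)] and [sinh (hdist y z)]. *)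
Lemma hdist_triangle y x z : hyp3 x -> hyp3 y -> hyp3 z ->
  hdist x z <= hdist x y + hdist y z.
Proof.
move=> hx hy hz; have a0 := hdist_ge0 hx hy; have b0 := hdist_ge0 hy hz.
rewrite -ler_cosh ?addr_ge0 ?hdist_ge0 // coshD.
have ca := cosh_hdist hx hy; have cb := cosh_hdist hy hz.
have sa := sinh_ge0 a0; have sb := sinh_ge0 b0.
have ta := cosh2_sinh2 (hdist x y); have tb := cosh2_sinh2 (hdist y z).
move: ca cb sa sb ta tb; rewrite (cosh_hdist hx hz).
move: (cosh (hdist x y)) (cosh (hdist y z)) (sinh (hdist x y)) (sinh (hdist y z)).
move=> a b sa sb ha hb sa0 sb0 ta tb.
have hw : mink (x - a *: y) y = 0 by rewrite minkDl minkNl minkZl hy.1 ha; ring.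
have hw' : mink (z - b *: y) y = 0 by rewrite minkDl minkNl minkZl hy.1 hb (minkC y); ring.
have := mink_orth_cauchy (hyp3_timelike hy) hw hw'.
have -> : mink (x - a *: y) (x - a *: y) = sa ^+ 2.
  have -> : sa ^+ 2 = a ^+ 2 - 1 by lra.
  by rewrite !minkE hx.1 hy.1 (minkC y x) ha; ring.
have -> : mink (z - b *: y) (z - b *: y) = sb ^+ 2.
  have -> : sb ^+ 2 = b ^+ 2 - 1 by lra.
  by rewrite !minkE hz.1 hy.1 (minkC z y) hb; ring.
have -> : mink (x - a *: y) (z - b *: y) = mink x z + a * b.
  by rewrite !minkE hy.1 ha hb; ring.
rewrite -exprMn => h.
have : `|mink x z + a * b| <= sa * sb.
  by rewrite -(ger0_norm (mulr_ge0 sa0 sb0)) -!sqrtr_sqr ler_wsqrtr.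
by rewrite ler_norml; lra.
Qed.

Definition hline_dir x u (s : R) : 'rV[R]_4 := sinh s *: x + cosh s *: u.

Lemma hline_dir_orth x u (s : R) : hyp3 x -> mink x u = 0 -> mink u u = 1 ->
  mink (hline x u s) (hline_dir x u s) = 0.
Proof. by move=> hx hxu hu; rewrite mink_comb (minkC u) hxu hu hx.1; ring. Qed.

Lemma hline_dir_unit x u (s : R) : hyp3 x -> mink x u = 0 -> mink u u = 1 ->
  mink (hline_dir x u s) (hline_dir x u s) = 1.
Proof.
move=> hx hxu hu; rewrite mink_comb (minkC u) hxu hu hx.1.
by have := cosh2_sinh2 s; rewrite !expr2; lra.
Qed.

Lemma hline_shift x u (s t : R) :
  hline (hline x u s) (hline_dir x u s) t = hline x u (t + s).
Proof.
rewrite /hline /hline_dir coshD sinhD !scalerDr !scalerDl !scalerA addrACA.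
by congr (_ + _); rewrite (addrC (_ *: u)).
Qed.

Lemma hline_mul x u (s : R) (A : 'M[R]_4) : hline x u s *m A = hline (x *m A) (u *m A) s.
Proof. by rewrite /hline mulmxDl -!scalemxAl. Qed.

Lemma geodesic_hline (p : R -> 'rV[R]_4) (t r : R) : 0 < r ->
  (forall a, `|a - t| < r -> hyp3 (p a)) ->
  (forall a b, `|a - t| < r -> `|b - t| < r -> mink (p a) (p b) = - cosh (a - b)) ->
  exists u, [/\ mink (p t) u = 0, mink u u = 1 &
    forall a, `|a - t| < r -> p a = hline (p t) u (a - t)].
Proof.
move=> r0 hp hpp; have tt : `|t - t| < r by rewrite subrr normr0.
(* A second point of the curve, at time t + d, determines the tangent vector u at p t. *)
pose d := r / 2; have d0 : 0 < d by rewrite divr_gt0.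
have dt : `|t + d - t| < r by rewrite addrAC subrr add0r gtr0_norm // /d; lra.
have S0 := sinh_gt0 d0; have SC := cosh2_sinh2 d.
pose u := (sinh d)^-1 *: (p (t + d) - cosh d *: p t).
have pt1 : mink (p t) (p t) = -1 by exact: (hp t tt).1.
have p1 : mink (p (t + d)) (p t) = - cosh d by rewrite hpp // addrAC subrr add0r.
have p11 : mink (p (t + d)) (p (t + d)) = -1 by exact: (hp _ dt).1.
have hu1 : mink (p t) u = 0.
  by rewrite /u minkZr minkDr minkNr minkZr pt1 minkC p1; ring.
have hu2 : mink u u = 1.
  rewrite /u minkZl minkZr !minkE p11 pt1 p1 (minkC (p t)) p1.
  apply: (mulfI (lt0r_neq0 S0)); apply: (mulfI (lt0r_neq0 S0)).
  rewrite mulVKf ?lt0r_neq0 // mulVKf ?lt0r_neq0 // mulr1 -expr2.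
  by move: SC; rewrite !expr2; lra.
exists u; split=> // a ha; apply/subr0_eq.
have pa1 : mink (p a) (p t) = - cosh (a - t) by exact: hpp.
have paa : mink (p a) (p a) = -1 by exact: (hp a ha).1.
have pau : mink (p a) u = sinh (a - t).
  rewrite /u minkZr minkDr minkNr minkZr pa1 hpp // opprD addrA coshB.
  by field; rewrite gt_eqF.
have e x' : mink (p a - hline (p t) u (a - t)) x' =
   mink (p a) x' - (cosh (a - t) * mink (p t) x' + sinh (a - t) * mink u x').
  by rewrite minkDl minkNl mink_hline.
apply: (mink_orth_eq0 (hyp3_timelike (hp t tt))).
  by rewrite e pa1 pt1 (minkC u) hu1; ring.
have hl := hline_hyp3 (a - t) (hp t tt) hu1 hu2.
rewrite mink_sqrB hl.1 paa minkC mink_hline !(minkC _ (p a)) pa1 pau.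
by have := cosh2_sinh2 (a - t); rewrite !expr2; lra.
Qed.

End Lines.

Section Lifts.
Context {R : realType} {M : metricType R} {m : nat}.
Variable tau : geometric_ideal_triangulation M m.
Local Notation V := (tri_vertices tau).
Local Notation T := (tri_map tau).
Local Notation s := (tri_pairing tau).
Local Notation g := (tri_isometry tau).
Local Notation ideal := (tri_ideal tau).
Implicit Types i j : 'I_m.
Implicit Types x y z u : 'rV[R]_4.

Hypothesis charts : forall p : M, exists (U : set M) (f : M -> 'rV[R]_4), hyp_chart U f /\ U p.
Variable c : R -> M.
Hypothesis geodesic : forall t, exists2 r : R, 0 < r &
  forall a b, `|a - t| < r -> `|b - t| < r -> mdist (c a) (c b) = `|a - b|.

(* In the coordinates of the i-th tetrahedron, the geodesic c passes through x at
   time t with unit tangent vector u. *)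
Record geodesic_lift i x u (t r : R) : Prop := {
  lift_tetrahedron : tetrahedron (V i) x;
  lift_map : T i x = c t;
  lift_orth : mink x u = 0;
  lift_unit : mink u u = 1;
  lift_radius : 0 < r;
  lift_dist : forall a y, `|a - t| < r -> tetrahedron (V i) y -> hdist x y < r ->
    mdist (c a) (T i y) = hdist (hline x u (a - t)) y }.

Lemma lift_shrink i x u (t r r' : R) : geodesic_lift i x u t r -> 0 < r' -> r' <= r -> geodesic_lift i x u t r'.
Proof.
case=> h1 h2 h3 h4 h5 h6 r'0 r'r; split=> // a y ha Ty hy.
by apply: h6 => //; exact: lt_le_trans r'r.
Qed.

(** A chart at c t turns the quotient map near x into a linear isometry A and the geodesic into a
    line; the tangent vector is pulled back by A. *)
Lemma lift_exists i x (t : R) : tetrahedron (V i) x -> T i x = c t ->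
  exists u r, geodesic_lift i x u t r.
Proof.
move=> Tx xt; have hx := Tx.1.
have [U [f [[oU fU fd _] Ut]]] := charts (c t).
have [r1 r10 hr1] := openP_mdist oU Ut.
have [r2 r20 hr2] := tri_isometric Tx.
have [r3 r30 hr3] := geodesic t.
pose r := Num.min r1 (Num.min r2 r3).
have r0 : 0 < r by rewrite !lt_min r10 r20.
have [rr1 rr2 rr3] : [/\ r <= r1, r <= r2 & r <= r3].
  by rewrite !ge_min !lexx !orbT.
have tt : `|t - t| < r by rewrite subrr normr0.
have UT y : tetrahedron (V i) y -> hdist x y < r -> U (T i y).
  move=> Ty xy; apply: hr1; rewrite -xt hr2 ?hdistxx //.
    exact: lt_le_trans rr1.
  exact: lt_le_trans rr2.
have Uc a : `|a - t| < r -> U (c a).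
  move=> ha; apply: hr1; rewrite hr3 ?(lt_le_trans _ rr3) // distrC.
  exact: lt_le_trans rr1.
have h3 p : U p -> hyp3 (f p) by move=> Up; apply: fU; exists p.
have fm p p' : U p -> U p' -> mink (f p) (f p') = - cosh (mdist p p').
  by move=> Up Up'; rewrite -fd // cosh_hdist ?opprK //; exact: h3.
have [y z Ty Tz xy xz|A hA phiA] := @local_isometry_linear _ _ (ideal i) x r (f \o T i) Tx r0.
  rewrite /= fm ?hr2 ?(lt_le_trans _ rr2) //; try exact: UT.
  by rewrite cosh_hdist ?opprK //; [exact: Ty.1|exact: Tz.1].
have [a ha|a b ha hb|q [q1 q2 hq]] := @geodesic_hline _ (f \o c) t r r0.
- exact/h3/Uc.
- by rewrite /= fm ?hr3 ?(lt_le_trans _ rr3) // ?cosh_abs //; exact: Uc.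
have UA : A \in unitmx.
  have UJ : (minkJ : 'M[R]_4) \in unitmx.
    rewrite unitmxE det_diag unitfE; apply/prodf_neq0 => k _; rewrite mxE.
    by case: ifP; rewrite ?oppr_eq0 oner_eq0.
  by move: UJ; rewrite -{1}hA !unitmx_mul => /andP[/andP[]].
have xA : x *m A = f (c t).
  by rewrite -phiA ?hdistxx //= xt.
pose u := q *m invmx A; have uA : u *m A = q by rewrite mulmxKV.
exists u, r; split=> //.
- by rewrite -(mink_mul _ _ hA) xA uA.
- by rewrite -(mink_mul _ _ hA) uA.
move=> a y ha Ty xy; rewrite -fd; [|exact: Uc|exact: UT].
rewrite -[f (c a)]/((f \o c) a) hq // -[f (T i y)]/((f \o T i) y) phiA //.
by rewrite /= -xA -uA -hline_mul /hdist mink_mul.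
Qed.

Lemma lift_mink i x u t r y (a : R) : geodesic_lift i x u t r -> `|a - t| < r ->
  tetrahedron (V i) y -> hdist x y < r ->
  mink (hline x u (a - t)) y = - cosh (mdist (c a) (T i y)).
Proof.
move=> L ha Ty xy; rewrite (lift_dist L) // cosh_hdist ?opprK //.
  apply: hline_hyp3; [exact: (lift_tetrahedron L).1|exact: lift_orth L|exact: lift_unit L].
exact: Ty.1.
Qed.

(** At a time slightly after t, the distances to nearby points of the tetrahedron determine their
    products with u, hence those of the ideal vertices. *)
Lemma lift_unique i x u u' t r r' : geodesic_lift i x u t r -> geodesic_lift i x u' t r' -> u = u'.
Proof.
move=> L L'; apply/subr0_eq/(mink_nondegenerate (ideal i)) => k.
rewrite minkDl minkNl; apply/eqP; rewrite subr_eq0; apply/eqP.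
pose d := Num.min r r'; have d0 : 0 < d by rewrite lt_min (lift_radius L) (lift_radius L').
have [y [al [be [Ty xy _ ->]]]] :=
  tetrahedron_toward_vertex (ideal i) k (lift_tetrahedron L) d0.
have {}L : geodesic_lift i x u t d by apply: lift_shrink L d0 _; rewrite ge_min lexx.
have {}L' : geodesic_lift i x u' t d by apply: lift_shrink L' d0 _; rewrite ge_min lexx orbT.
have ta : `|t + d / 2 - t| < d by rewrite addrAC subrr add0r gtr0_norm; lra.
have S0 : 0 < sinh (d / 2) by rewrite sinh_gt0 // divr_gt0.
have := lift_mink L ta Ty xy; rewrite -(lift_mink L' ta Ty xy) !mink_hline => /addrI.
rewrite addrAC subrr add0r => /(mulfI (lt0r_neq0 S0)) e.
by rewrite !minkDr !minkZr e !(minkC _ x) (lift_orth L) (lift_orth L').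
Qed.

Lemma lift_step i x u t r a y : geodesic_lift i x u t r -> `|a - t| < r ->
  tetrahedron (V i) y -> T i y = c a -> hdist x y < r ->
  y = hline x u (a - t) /\ exists r', geodesic_lift i y (hline_dir x u (a - t)) a r'.
Proof.
move=> L ha Ty ya xy; have hx := (lift_tetrahedron L).1.
have hl := hline_hyp3 (a - t) hx (lift_orth L) (lift_unit L).
have e : hline x u (a - t) = y.
  apply: hdist_eq0 => //; first exact: Ty.1.
  by rewrite -(lift_dist L) // ya mdistxx.
split=> //; pose r' := Num.min (r - `|a - t|) (r - hdist x y).
exists r'; split=> //.
- by rewrite -e hline_dir_orth // ?(lift_orth L) ?(lift_unit L).
- by rewrite hline_dir_unit // ?(lift_orth L) ?(lift_unit L).
- by rewrite lt_min !subr_gt0 ha.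
move=> b z; rewrite lt_min => /andP[hb _] Tz; rewrite lt_min => /andP[_ yz].
rewrite (lift_dist L) //.
- by rewrite -e hline_shift subrKA.
- by rewrite -(subrKA a) (le_lt_trans (ler_normD _ _)) // -ltrBrDr.
- by rewrite (le_lt_trans (hdist_triangle hx Ty.1 Tz.1)) // -ltrBrDl.
Qed.

Lemma face_glued i k x : face (V i) k x ->
  face (V (s (i, k)).1) (s (i, k)).2 (x *m g (i, k)) /\
  T (s (i, k)).1 (x *m g (i, k)) = T i x.
Proof.
move=> fx; have fx' : face (V (s (i, k)).1) (s (i, k)).2 (x *m g (i, k)).
  by have := tri_face tau (i, k) => /seteqP[] + _; apply; exists x.
split=> //; apply/esym/(tri_identification (face_tetrahedron (ideal i) fx)
  (face_tetrahedron (ideal _) fx')).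
by apply: rst_step; exists k.
Qed.

(** Both lifts see the points of the common face near x at the same distances from the geodesic.
    This compares the tangent vectors against the three vertices of that face, exactly those that
    are developed across it. *)
Lemma lift_face i k x u x' u' t r r' : face (V i) k x -> x' = x *m g (i, k) ->
  geodesic_lift i x u t r -> geodesic_lift (s (i, k)).1 x' u' t r' ->
  forall a, a != k -> mink u (row a (V i)) = mink u' (row a (V i) *m g (i, k)).
Proof.
move=> fx -> L L' a ak.
have hg := (tri_lorentz tau (i, k)).1.
pose d := Num.min r r'; have d0 : 0 < d by rewrite lt_min (lift_radius L) (lift_radius L').
have [y [al [be [Ty xy fy ->]]]] :=
  tetrahedron_toward_vertex (ideal i) a (lift_tetrahedron L) d0.
have {}fy : face (V i) k y by apply: fy; rewrite // eq_sym.
have {}L : geodesic_lift i x u t d by apply: lift_shrink L d0 _; rewrite ge_min lexx.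
have {}L' : geodesic_lift (s (i, k)).1 (x *m g (i, k)) u' t d.
  by apply: lift_shrink L' d0 _; rewrite ge_min lexx orbT.
have ta : `|t + d / 2 - t| < d by rewrite addrAC subrr add0r gtr0_norm; lra.
have S0 : 0 < sinh (d / 2) by rewrite sinh_gt0 // divr_gt0.
have [fy' ey] := face_glued fy.
have Ty' := face_tetrahedron (ideal _) fy'.
have xy' : hdist (x *m g (i, k)) (y *m g (i, k)) < d by rewrite /hdist mink_mul.
have := lift_mink L ta Ty xy; rewrite -ey -(lift_mink L' ta Ty' xy') !mink_hline.
rewrite mink_mul // => /addrI; rewrite addrAC subrr add0r => /(mulfI (lt0r_neq0 S0)) e.
rewrite mulmxDl -!scalemxAl !minkDr !minkZr e !(minkC _ x) (lift_orth L).
by rewrite (minkC u' (x *m _)) (lift_orth L').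
Qed.

(** Every representative of c a, for a close to t, lies near a representative of c t in the same
    tetrahedron: [tri_map_near] gives this in each of the finitely many tetrahedra. It is the local
    step of [develops_propagate]. *)
Lemma lift_near t : exists2 e : R, 0 < e & forall a j y, `|a - t| < e ->
  tetrahedron (V j) y -> T j y = c a ->
  exists x u r, [/\ geodesic_lift j x u t r, `|a - t| < r & hdist x y < r].
Proof.
pose W j : set 'rV[R]_4 := [set y | exists x u r, [/\ geodesic_lift j x u t r, hdist x y < r &
  mdist (T j x) (T j y) = hdist x y]].
have h j : exists2 e : R, 0 < e & forall y, tetrahedron (V j) y ->
    mdist (c t) (T j y) < e -> W j y.
  apply: tri_map_near => x Tx xt.
  have [u [r L]] := lift_exists Tx xt; have [r' r'0 hr'] := tri_isometric Tx.
  exists (Num.min r r'); first by rewrite lt_min (lift_radius L).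
  move=> y Ty; rewrite lt_min => /andP[h1 h2]; exists x, u, r; split=> //.
  by rewrite hr' ?hdistxx //; exact: Tx.1.
have [e e0 he] := @finite_min_gt0 _ _ (fun j e => forall y, tetrahedron (V j) y ->
    mdist (c t) (T j y) < e -> W j y) (fun j => let: ex_intro2 e e0 he := h j in
    ex_intro2 _ _ e e0 (fun e' _ le y Ty hy => he y Ty (lt_le_trans hy le))).
have [r r0 hr] := geodesic t.
have tt : `|t - t| < r by rewrite subrr normr0.
exists (Num.min e r); first by rewrite lt_min e0.
move=> a j y; rewrite lt_min => /andP[ae ar] Ty ya.
have hy : mdist (c t) (T j y) < e by rewrite ya hr // distrC.
have [x [u [r' [L xy dxy]]]] := he j e e0 (lexx e) y Ty hy.
exists x, u, r'; split=> //; move: dxy.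
by rewrite (lift_map L) ya hr // distrC => ->.
Qed.

End Lifts.

(** * Real induction and Cauchy sequences *)

Section RealInduction.
Context {R : realType}.

(** Applied at the supremum of the times where P holds, the hypothesis carries P from a time just
    before it to a time just after it. *)
Lemma real_induction (P : R -> Prop) (a b : R) : a <= b -> P a ->
  (forall t, a <= t <= b -> exists2 r, 0 < r & forall t1 t2, a <= t1 -> t1 <= t -> t <= t2 ->
     t2 <= b -> t - r < t1 -> t2 < t + r -> P t1 -> P t2) -> P b.
Proof.
move=> ab Pa h; pose A : set R := [set t | a <= t <= b /\ P t].
have Aa : A a by split=> //; rewrite lexx ab.
have ubA : ubound A b by move=> t [/andP[]].
have supA : has_sup A by split; [exists a|exists b].
have sa : a <= sup A by exact: sup_upper_bound.
have sb : sup A <= b by apply: ge_sup => //; exists a.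
have /h[r r0 hr] : a <= sup A <= b by rewrite sa sb.
have [t1 [/andP[at1 t1b] Pt1] st1] := sup_adherent r0 supA.
have t1s : t1 <= sup A by apply: sup_upper_bound => //; split=> //; rewrite at1.
pose t2 := Num.min b (sup A + r / 2).
have st2 : sup A <= t2 by rewrite le_min sb /=; lra.
have t2b : t2 <= b by rewrite ge_min lexx.
have Pt2 : P t2.
  apply: (hr t1) => //; rewrite gt_min; apply/orP; right; lra.
have : t2 <= sup A by apply: sup_upper_bound => //; split=> //; rewrite (le_trans sa).
rewrite ge_min => /orP[bs|]; last by lra.
suff -> : b = t2 by [].
by apply/eqP; rewrite eq_le t2b (le_trans bs).
Qed.

(** The radius depends on t, so the interval cannot simply be cut into equal pieces; real induction
    propagates the bound instead. *)
Lemma locally_lipschitz_mdist (M : metricType R) (h : R -> M) (L : R) :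
  (forall t, 0 <= t <= 1 -> exists2 r, 0 < r & forall t', 0 <= t' <= 1 ->
     `|t' - t| < r -> mdist (h t) (h t') <= L * `|t - t'|) ->
  mdist (h 0) (h 1) <= L.
Proof.
move=> hL; rewrite -[leRHS]mulr1.
apply: (@real_induction (fun t => mdist (h 0) (h t) <= L * t) 0 1) => //.
  by rewrite mdistxx mulr0.
move=> t t01; have [r r0 hr] := hL t t01; exists r => // t1 t2 h1 h2 h3 h4 h5 h6 h7.
have d1 : mdist (h t) (h t1) <= L * (t - t1).
  rewrite -(ger0_norm (_ : 0 <= t - t1)) ?subr_ge0 //; apply: hr.
    by rewrite h1 (le_trans h2) //; case/andP: t01.
  by rewrite distrC ger0_norm ?subr_ge0 //; lra.
have d2 : mdist (h t) (h t2) <= L * (t2 - t).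
  rewrite -(ger0_norm (_ : 0 <= t2 - t)) ?subr_ge0 // distrC; apply: hr.
    by rewrite h4 (le_trans _ h3) //; case/andP: t01.
  by rewrite ger0_norm ?subr_ge0 //; lra.
apply: le_trans (metric_triangle _ (h t) _) _.
apply: le_trans (lerD (metric_triangle _ (h t1) _) (lexx _)) _.
rewrite (metric_sym (h t1)).
have -> : L * t2 = L * t1 + L * (t - t1) + L * (t2 - t) by ring.
by rewrite !lerD.
Qed.

Lemma geometric_cvg (M : completeMetricType R) (u : nat -> M) (C q : R) :
  0 <= C -> 0 < q -> q < 1 -> (forall n, mdist (u n) (u n.+1) <= C * q ^+ n) ->
  exists p, forall e, 0 < e -> exists N, forall n, (N <= n)%N -> mdist p (u n) < e.
Proof.
move=> C0 q0 q1 hu; have q1' : 0 < 1 - q by rewrite subr_gt0.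
have hN n k : mdist (u n) (u (n + k)%N) <= C / (1 - q) * (q ^+ n - q ^+ (n + k)).
  elim: k => [|k IH]; first by rewrite addn0 mdistxx subrr mulr0.
  apply: le_trans (metric_triangle _ (u (n + k)%N) _) _.
  rewrite addnS; apply: le_trans (lerD IH (hu _)) _.
  rewrite le_eqVlt; apply/orP; left; apply/eqP.
  by rewrite exprSr; field; rewrite gt_eqF.
have pow0 (e : R) : 0 < e -> exists N, forall n, (N <= n)%N -> q ^+ n < e.
  move=> e0; have /cvg_expr : `|q| < 1 by rewrite gtr0_norm.
  by move=> /cvgr_lt /(_ e e0) [N _ hN']; exists N => n /hN'.
have cau : cauchy (u @ \oo).
  apply: cauchy_exP => e e0.
  have e'0 : 0 < e / (C / (1 - q) + 1).
    by rewrite divr_gt0 // ltr_wpDl // divr_ge0 // ltW.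
  have [N hN'] := pow0 _ e'0; exists (u N); exists N => // n /= Nn.
  rewrite ballEmdist /= -(subnKC Nn); apply: le_lt_trans (hN _ _) _.
  have := hN' N (leqnn N); rewrite ltr_pdivlMr; last first.
    by rewrite ltr_wpDl // divr_ge0 // ltW.
  have : 0 < q ^+ (N + (n - N)) by rewrite exprn_gt0.
  have : 0 < q ^+ N by rewrite exprn_gt0.
  have : 0 <= C / (1 - q) by rewrite divr_ge0 // ltW.
  set K := C / _; set x := q ^+ N; set y := q ^+ _ => *.
  have Ky : 0 <= K * y by rewrite mulr_ge0 // ltW.
  by rewrite mulrBr; lra.
have [p hp] := (cvg_ex _).1 (cauchy_cvg _ cau).
exists p => e e0.
have [N _ hN'] := hp _ (nbhsx_ballx p e e0).
by exists N => n /hN' /=; rewrite ballEmdist.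
Qed.

End RealInduction.

(** * Holonomy of the cusps *)

Section Cusps.
Context {R : realType} {M : completeMetricType R} {m : nat}.
Variable tau : geometric_ideal_triangulation M m.
Local Notation V := (tri_vertices tau).
Local Notation T := (tri_map tau).
Local Notation s := (tri_pairing tau).
Local Notation g := (tri_isometry tau).
Local Notation ideal := (tri_ideal tau).
Local Notation node := ('I_m * 'I_4)%type.
Implicit Types i j : 'I_m.
Implicit Types a b k : 'I_4.
Implicit Types x y z u w : 'rV[R]_4.
Implicit Types n : node.

Lemma tri_isometry_mink (f : node) x y : mink (x *m g f) (y *m g f) = mink x y.
Proof. exact/mink_mul/(tri_lorentz tau f).1. Qed.

Let ge0_limit (p q : R) : (forall e, 0 < e -> 0 <= p + e * q) -> 0 <= p.
Proof.
move=> h; rewrite leNgt; apply/negP => p0.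
have e0 : 0 < - p / (2 * (`|q| + 1)) by rewrite divr_gt0 ?oppr_gt0 // mulr_gt0 // ltr_wpDl.
have h1 := h _ e0.
have : - p / (2 * (`|q| + 1)) * q <= - p / 2.
  rewrite invfM mulrA -mulrA ler_piMr // ?divr_ge0 ?oppr_ge0 ?(ltW p0) //.
  rewrite mulrC ler_pdivrMr ?ltr_wpDl // mul1r.
  by rewrite (le_trans (ler_norm _)) // lerDl.
lra.
Qed.

(* The ideal vertices of a face span the isotropic rays of the cone over it, which
   the face-pairing isometry preserves. *)
Lemma vertex_image i k a : a != k -> exists b (la : R),
  [/\ b != (s (i, k)).2, 0 < la &
    row a (V i) *m g (i, k) = la *: row b (V (s (i, k)).1)].
Proof.
move=> ak; set j := (s (i, k)).1; set k' := (s (i, k)).2.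
have [c [d h]] := ord4_complete2 ak.
have [[_ ac _] [_ kc _] [ca ck _] _] := uniq4_neq h.
have qac := vgram_gt0 (ideal i) ac.
pose w := row a (V i) *m g (i, k); pose w' := row c (V i) *m g (i, k).
(* For c another vertex of the face, v a + e v c is, after normalisation, a point of the face, and
   so is its image; letting e tend to 0 isolates the image w of v a. *)
have pos (e : R) : 0 < e ->
    (forall l, 0 <= bcoord (V j) w 0 l + e * bcoord (V j) w' 0 l) /\
    bcoord (V j) w 0 k' + e * bcoord (V j) w' 0 k' = 0.
  move=> e0; pose y := row a (V i) + e *: row c (V i).
  pose n := Num.sqrt (2 * e * vgram (V i) a c).
  have n2 : 0 < 2 * e * vgram (V i) a c by rewrite !mulr_gt0.
  have n0 : 0 < n by rewrite sqrtr_gt0.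
  have yy : mink (n^-1 *: y) (n^-1 *: y) = -1.
    rewrite minkZl minkZr mulrA -expr2 exprVn sqr_sqrtr ?(ltW n2) //.
    rewrite /y !minkE !(mink_vertex (ideal i)) (minkC (row c _)).
    rewrite /vgram; field.
    by move: qac; rewrite /vgram oppr_gt0 => /lt_eqF ->; rewrite gt_eqF.
  have fy : face (V i) k (n^-1 *: y).
    have b0 l : 0 <= bcoord (V i) (n^-1 *: y) 0 l.
      rewrite bcoordZE bcoordDE bcoordZE !(bcoord_vertexE (ideal i)).
      by rewrite mulr_ge0 ?invr_ge0 ?(ltW n0) // addr_ge0 // mulr_ge0 // ltW.
    apply/(faceP (ideal i)); split=> //; first exact: bcoord_hyp3 (ideal i) _ b0 yy.
    rewrite bcoordZE bcoordDE bcoordZE !(bcoord_vertexE (ideal i)).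
    by rewrite (eq_sym k a) (negbTE ak) (negbTE kc) mulr0 addr0 mulr0.
  have [/(faceP (ideal j))[_ b0 bk] _] := face_glued fy.
  have e1 l : bcoord (V j) (n^-1 *: y *m g (i, k)) 0 l =
      n^-1 * (bcoord (V j) w 0 l + e * bcoord (V j) w' 0 l).
    by rewrite -scalemxAl mulmxDl -scalemxAl bcoordZE bcoordDE bcoordZE.
  split=> [l|].
    by have := b0 l; rewrite e1 pmulr_rge0 // invr_gt0.
  move: bk; rewrite e1 => /eqP; rewrite mulf_eq0 invr_eq0 (gt_eqF n0) /= => /eqP //.
have w0 l : 0 <= bcoord (V j) w 0 l.
  by apply: (@ge0_limit _ (bcoord (V j) w' 0 l)) => e e0; exact: (pos e e0).1.
have wk : bcoord (V j) w 0 k' = 0.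
  (* The values e = 1 and e = 2 eliminate the coordinate of w'. *)
  have := (pos 1 ltr01).2; have := (pos 2 (ltr0Sn _ _)).2.
  by move: (bcoord _ w _ _) (bcoord _ w' _ _) => p q; lra.
have ww : mink w w = 0 by rewrite tri_isometry_mink (mink_vertex (ideal i)).
have wn0 : w != 0.
  apply/eqP => w00; have := congr1 (mulmx^~ (g (s (i, k)))) w00.
  rewrite mul0mx -mulmxA tri_isometryK mulmx1 => e.
  by have := vertex_future (ideal i) a; rewrite e mxE ltxx.
have [b wb] : exists b, bcoord (V j) w 0 b != 0.
  apply: contrapT => hn; move/eqP: wn0; apply.
  rewrite (bcoord_sum (ideal j) w) big1 // => l _.
  have [->|ne] := eqVneq (bcoord (V j) w 0 l) 0; first by rewrite scale0r.
  by case: hn; exists l.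
exists b, (bcoord (V j) w 0 b); split.
- by apply: contraNneq wb => ->; rewrite wk.
- by rewrite lt_neqAle w0 eq_sym wb.
rewrite -/w [LHS](bcoord_sum (ideal j) w) (bigD1 b) //= big1 ?addr0 // => l lb.
suff -> : bcoord (V j) w 0 l = 0 by rewrite scale0r.
(* As w is null with nonnegative coordinates and distinct vertices have positive Gram entries, no
   two of its coordinates are nonzero. *)
have hs : \sum_p bcoord (V j) w 0 p * - mink w (row p (V j)) = 0.
  by rewrite -(mink_bcoord2 (ideal j)) ww oppr0.
have fp p : 0 <= - mink w (row p (V j)).
  rewrite (mink_bcoord (ideal j)) sumr_ge0 // => p' _.
  by rewrite mulr_ge0 ?w0 // (vgram_ge0 (ideal j)).
have /eqP : bcoord (V j) w 0 b * - mink w (row b (V j)) = 0.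
  by apply: (psumr_eq0P _ hs) => // p _; rewrite mulr_ge0.
rewrite mulf_eq0 (negbTE wb) /= (mink_bcoord (ideal j)) => /eqP hb.
have /eqP : bcoord (V j) w 0 l * vgram (V j) l b = 0.
  by apply: (psumr_eq0P _ hb) => // p _; rewrite mulr_ge0 ?w0 // (vgram_ge0 (ideal j)).
by rewrite mulf_eq0 (gt_eqF (vgram_gt0 (ideal j) lb)) orbF => /eqP.
Qed.

(* A pair (tetrahedron, vertex) stands for the triangle cut out of the link of a cusp;
   la compares the horospheres chosen at the two ends of the step. *)
Definition cusp_step n n' (la : R) : Prop := exists k,
  [/\ n.2 != k, n'.1 = (s (n.1, k)).1, n'.2 != (s (n.1, k)).2, 0 < la &
    row n.2 (V n.1) *m g (n.1, k) = la *: row n'.2 (V n'.1)].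

Inductive cusp_path n : node -> R -> Prop :=
| CuspPath0 : cusp_path n n 1
| CuspPathS n' n'' (la la' : R) : cusp_path n n' la -> cusp_step n' n'' la' ->
    cusp_path n n'' (la * la').

Lemma cusp_step_sym n n' (la : R) : cusp_step n n' la -> cusp_step n' n la^-1.
Proof.
case=> k [nk e1 e2 la0 e]; exists (s (n.1, k)).2.
have es : s (n'.1, (s (n.1, k)).2) = (n.1, k) by rewrite e1 -surjective_pairing tri_pairingK.
split=> //; rewrite ?es ?invr_gt0 //.
have -> : (n'.1, (s (n.1, k)).2) = s (n.1, k) by rewrite e1 -surjective_pairing.
apply: (scalerI (lt0r_neq0 la0)); rewrite scalerA mulfV ?gt_eqF // scale1r.
by rewrite scalemxAl -e -mulmxA tri_isometryK mulmx1.
Qed.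

Lemma cusp_path_cat n n' n'' (la la' : R) :
  cusp_path n n' la -> cusp_path n' n'' la' -> cusp_path n n'' (la * la').
Proof.
move=> h; elim=> [|p p' l l' _ IH hs]; first by rewrite mulr1.
by rewrite mulrA; exact: CuspPathS hs.
Qed.

Lemma cusp_path_sym n n' (la : R) : cusp_path n n' la -> cusp_path n' n la^-1.
Proof.
elim=> [|p p' l l' _ IH hs]; first by rewrite invr1; exact: CuspPath0.
rewrite invfM mulrC; apply: cusp_path_cat IH.
by rewrite -[_^-1]mul1r; apply: CuspPathS (CuspPath0 _) (cusp_step_sym hs).
Qed.

Lemma cusp_path_gt0 n n' (la : R) : cusp_path n n' la -> 0 < la.
Proof. by elim=> // p p' l l' _ IH [k [_ _ _ l'0 _]]; rewrite mulr_gt0. Qed.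

Lemma horobase_vertex i a b : a != b ->
  horobase (V i) a ((vgram (V i) a b)^-1 *: row b (V i)).
Proof.
move=> ab; have q0 := vgram_gt0 (ideal i) ab; split.
  rewrite minkZl minkC; apply: (mulfI (lt0r_neq0 q0)).
  by rewrite mulVKf ?gt_eqF // mulrN1 /vgram opprK.
move=> k; rewrite bcoordZE (bcoord_vertexE (ideal i)) mulr_ge0 // invr_ge0.
exact: ltW.
Qed.

Lemma mink_bcoord_le0 i w w' : (forall k, 0 <= bcoord (V i) w 0 k) ->
  (forall k, 0 <= bcoord (V i) w' 0 k) -> mink w w' <= 0.
Proof.
move=> h h'; rewrite (bcoord_sum (ideal i) w') mink_sumr -oppr_ge0 -sumrN.
apply: sumr_ge0 => k _; rewrite minkZr -mulrN mulr_ge0 //.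
rewrite (mink_bcoord (ideal i)) sumr_ge0 // => l _.
by rewrite mulr_ge0 ?h // (vgram_ge0 (ideal i)).
Qed.

(** The segment from w to w' in the link triangle is lifted to height 1/t, where its length is
    proportional to t. The choice of t0 keeps the lift inside the tetrahedron; as [tri_isometric] is
    only local, its length is bounded by [locally_lipschitz_mdist]. *)
Lemma mdist_horopoint i a w w' : horobase (V i) a w -> horobase (V i) a w' ->
  exists C t0 : R, [/\ 0 <= C, 0 < t0 & forall t, 0 < t -> t <= t0 ->
    mdist (T i (horopoint (V i) a w t)) (T i (horopoint (V i) a w' t)) <= C * t].
Proof.
move=> hw hw'; have [hw1 hw2] := hw; have [hw1' hw2'] := hw'.
pose N := mink (w - w') (w - w').
pose W (e : R) := (1 - e) *: w + e *: w'.
have hW (e : R) : 0 <= e <= 1 -> horobase (V i) a (W e).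
  move=> /andP[e0 e1]; split; first by rewrite /W minkDl !minkZl hw1 hw1'; ring.
  by move=> k; rewrite bcoordDE !bcoordZE addr_ge0 ?mulr_ge0 // subr_ge0.
pose A := - mink w w; pose B := - mink w w'; pose D := - mink w' w'.
have A0 : 0 <= A by rewrite oppr_ge0; exact: (mink_bcoord_le0 hw2 hw2).
have B0 : 0 <= B by rewrite oppr_ge0; exact: (mink_bcoord_le0 hw2 hw2').
have D0 : 0 <= D by rewrite oppr_ge0; exact: (mink_bcoord_le0 hw2' hw2').
pose K := A + 2 * B + D + 1; have K0 : 0 < K by rewrite /K; lra.
have WK (e : R) : 0 <= e <= 1 -> - mink (W e) (W e) <= K.
  move=> /andP[e0 e1]; rewrite mink_comb (minkC w').
  have -> : - ((1 - e) * (1 - e) * mink w w + (1 - e) * e * mink w w' +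
     e * (1 - e) * mink w w' + e * e * mink w' w') =
     (1 - e) ^+ 2 * A + 2 * (e * (1 - e)) * B + e ^+ 2 * D by rewrite /A /B /D; ring.
  have h1 : (1 - e) ^+ 2 * A <= A by rewrite ler_piMl // expr_le1 //; lra.
  have h2 : e ^+ 2 * D <= D by rewrite ler_piMl // expr_le1 //; lra.
  have h3 : 2 * (e * (1 - e)) * B <= 2 * B.
    rewrite ler_wpM2r // ler_piMr // mulr_ile1 //; lra.
  by rewrite /K; lra.
have WB (e e' : R) : mink (W e - W e') (W e - W e') = (e - e') ^+ 2 * N.
  have -> : W e - W e' = - (e - e') *: (w - w').
    by apply/rowP => k; rewrite !mxE; ring.
  by rewrite minkZl minkZr /N; ring.
exists (2 * Num.sqrt N), (Num.min 1 K^-1); split.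
- by rewrite mulr_ge0 ?sqrtr_ge0.
- by rewrite lt_min ltr01 invr_gt0.
move=> t t0; rewrite le_min => /andP[t1 tK].
have tt : t ^+ 2 * K <= 1.
  have : t ^+ 2 <= t by rewrite expr2 ler_piMl // ltW.
  move=> h; rewrite -(mulVf (lt0r_neq0 K0)) ler_pM2r //; exact: le_trans h tK.
have TW (e : R) : 0 <= e <= 1 -> tetrahedron (V i) (horopoint (V i) a (W e) t).
  move=> he; apply: (horopoint_tetrahedron (ideal i) t0 (hW e he)).
  by apply: le_trans tt; rewrite ler_wpM2l ?sqr_ge0 // WK.
have W0 : W 0 = w by rewrite /W subr0 scale1r scale0r addr0.
have W1 : W 1 = w' by rewrite /W subrr scale1r scale0r add0r.
rewrite -{1}W0 -{1}W1 -mulrA (mulrC _ t) mulrA.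
apply: (@locally_lipschitz_mdist _ _ (fun e => T i (horopoint (V i) a (W e) t))) => e he.
have [r r0 hr] := tri_isometric (TW e he).
have L0 : 0 <= 2 * t * Num.sqrt N by rewrite !mulr_ge0 ?sqrtr_ge0 // ltW.
have hd (e' : R) : 0 <= e' <= 1 -> hdist (horopoint (V i) a (W e) t) (horopoint (V i) a (W e') t) <=
    2 * t * Num.sqrt N * `|e - e'|.
  move=> he'; apply: le_trans (hdist_horopoint (ideal i) t0 (hW e he).1 (hW e' he').1
    (TW e he).1 (TW e' he').1) _.
  by rewrite WB sqrtrM ?sqr_ge0 // sqrtr_sqr -[leRHS]mulrA (mulrC (Num.sqrt N)).
exists (r / (2 * t * Num.sqrt N + 1)); first by rewrite divr_gt0 // ltr_wpDl.
move=> e' he' ee'; rewrite hr ?hdistxx //.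
- exact: hd.
- exact: TW.
- exact: TW.
- exact: (TW e he).1.
- apply: le_lt_trans (hd e' he') _; move: ee'; rewrite ltr_pdivlMr ?ltr_wpDl // distrC.
  apply: le_lt_trans; rewrite mulrC ler_wpM2l //; lra.
Qed.

(** Crossing a face with factor l' rescales the height by l', while horospherical distances stay
    O(t). The two tetrahedra of a step are compared at a point of their common face. *)
Lemma cusp_path_mdist n n' (la : R) : cusp_path n n' la -> forall w w',
  horobase (V n.1) n.2 w -> horobase (V n'.1) n'.2 w' ->
  exists C t0 : R, [/\ 0 <= C, 0 < t0 & forall t, 0 < t -> t <= t0 ->
    mdist (T n.1 (horopoint (V n.1) n.2 w t)) (T n'.1 (horopoint (V n'.1) n'.2 w' (t / la)))
      <= C * t].
Proof.
move=> h; have := cusp_path_gt0 h.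
elim: h => [la0 w w' hw hw'|p p' l l' hl IH [k [pk e1 p'k l'0 el']] ll0 w w' hw hw'].
  have [C [t0 [C0 t00 hC]]] := mdist_horopoint hw hw'.
  by exists C, t0; split=> // t t1 t2; rewrite divr1; exact: hC.
have l0 := cusp_path_gt0 hl.
(* The direction of another vertex b of the face k gives horopoints lying on this face. *)
have [b [d hb]] := ord4_complete2 pk.
have [[_ pb _] [_ kb _] _ _] := uniq4_neq hb.
have hw1 := horobase_vertex p.1 pb; set w1 := _ *: _ in hw1.
have q0 := vgram_gt0 (ideal p.1) pb.
have [|b' [be [b'k be0 hbe]]] := @vertex_image p.1 k b; first by rewrite eq_sym.
(* The factor l' restores the product -1 with the vertex vector chosen on the other side. *)
pose w2 := l' *: (w1 *m g (p.1, k)).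
have hw2 : horobase (V p'.1) p'.2 w2.
  split.
    by rewrite /w2 minkZl -minkZr -el' tri_isometry_mink hw1.1.
  move=> c; rewrite /w2 /w1 -scalemxAl hbe e1 !bcoordZE (bcoord_vertexE (ideal _)).
  by rewrite !mulr_ge0 ?invr_ge0 // ltW.
have [C1 [t1 [C10 t10 h1]]] := IH l0 _ _ hw hw1.
have [C2 [t2 [C20 t20 h2]]] := mdist_horopoint hw2 hw'.
exists (C1 + C2 / (l * l')), (Num.min (Num.min t1 (l * l' * t2)) (Num.min l (l * l'))); split.
- by rewrite addr_ge0 // divr_ge0 // ltW.
- by rewrite !lt_min t10 l0 ll0 mulr_gt0.
move=> t t0; rewrite !le_min => /andP[/andP[tt1 tt2] /andP[tl tll]].
rewrite mulrDl; apply: le_trans (metric_triangle _ (T p.1 (horopoint (V p.1) p.2 w1 (t / l))) _) _.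
apply: lerD; first exact: h1.
have tl0 : 0 < t / l by rewrite divr_gt0.
have tll0 : 0 < t / (l * l') by rewrite divr_gt0.
have w1w1 : mink w1 w1 = 0 by rewrite /w1 minkZl minkZr (mink_vertex (ideal _)) !mulr0.
have w2w2 : mink w2 w2 = 0.
  by rewrite minkZl minkZr tri_isometry_mink w1w1 !mulr0.
have Tp : tetrahedron (V p.1) (horopoint (V p.1) p.2 w1 (t / l)).
  by apply: (horopoint_tetrahedron (ideal _) tl0 hw1); rewrite w1w1 oppr0 mulr0 ler01.
have fp : face (V p.1) k (horopoint (V p.1) p.2 w1 (t / l)).
  apply/(faceP (ideal _)); have /(tetrahedronP (ideal _))[h3 h4] := Tp; split=> //.
  rewrite (bcoord_horopoint (ideal _)) 1?eq_sym // /w1 bcoordZE (bcoord_vertexE (ideal _)).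
  by rewrite (negbTE kb) !mulr0.
have [_ <-] := face_glued fp.
have -> : horopoint (V p.1) p.2 w1 (t / l) *m g (p.1, k) =
    horopoint (V (s (p.1, k)).1) p'.2 w2 (t / (l * l')).
  rewrite /horopoint mulmxDl; congr (_ + _).
    by rewrite -scalemxAl /w2 scalerA; congr (_ *: _); field; rewrite !gt_eqF.
  rewrite -scalemxAl el' e1 scalerA w1w1 w2w2 !mulr0 addr0.
  by congr (_ *: _); field; rewrite !gt_eqF.
rewrite -e1; apply: le_trans (h2 _ tll0 _) _.
  by rewrite ler_pdivrMr // mulrC.
by rewrite mulrA mulrAC.
Qed.

Lemma horopoint_coord i a b (t : R) : a != b -> 0 < t ->
  row a (V i) 0 0 / (2 * t) <= horopoint (V i) a ((vgram (V i) a b)^-1 *: row b (V i)) t 0 0.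
Proof.
move=> ab t0; rewrite /horopoint minkZl minkZr (mink_vertex (ideal i)) !mulr0 addr0 mul1r.
rewrite [leRHS]mxE [X in _ <= _ + X]mxE mulrC lerDr 2!mxE mulr_ge0 ?(ltW t0) // mulr_ge0 //.
  by rewrite invr_ge0 ltW // (vgram_gt0 (ideal i)).
by have := vertex_future (ideal i) b; rewrite mxE => /ltW.
Qed.

(* Going around a loop of cusp triangles with nontrivial similarity factor again and
   again yields a Cauchy sequence which leaves every bounded part of a tetrahedron. *)
Lemma cusp_loop_le1 n (la : R) : cusp_path n n la -> la <= 1.
Proof.
move=> h; rewrite leNgt; apply/negP => la1.
have la0 : 0 < la by exact: lt_trans la1.
have [b [c [d hb]]] := ord4_complete1 n.2; have [[nb _ _] _ _ _] := uniq4_neq hb.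
have hw := horobase_vertex n.1 nb; set w := _ *: _ in hw.
have [C [t0 [C0 t00 hC]]] := cusp_path_mdist h hw hw.
pose y (k : nat) := horopoint (V n.1) n.2 w (t0 * la^-1 ^+ k).
have q0 : 0 < la^-1 by rewrite invr_gt0.
have q1 : la^-1 < 1 by rewrite invf_lt1.
have tk (k : nat) : 0 < t0 * la^-1 ^+ k by rewrite mulr_gt0 // exprn_gt0.
have [|k|p hp] := @geometric_cvg _ M (fun k : nat => T n.1 (y k)) (C * t0) la^-1 _ q0 q1.
- by rewrite mulr_ge0 // ltW.
- have := hC _ (tk k); rewrite /y exprSr !mulrA; apply.
  by rewrite ler_piMr ?(ltW t00) // exprn_ile1 // ltW.
have v0 := vertex_future (ideal n.1) n.2.
have pow0 (e : R) : 0 < e -> exists N, forall k : nat, (N <= k)%N -> la^-1 ^+ k < e.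
  move=> e0; have /cvg_expr : `|la^-1| < 1 by rewrite gtr0_norm.
  by move=> /cvgr_lt /(_ e e0) [N _ hN']; exists N => k /hN'.
have /choice[f hf] : forall k : nat, exists j : nat,
    k%:R < y j 0 0 /\ mdist p (T n.1 (y j)) < k.+1%:R^-1.
  move=> k; have k0 : 0 < k.+1%:R^-1 :> R by rewrite invr_gt0 ltr0n.
  have [N1 hN1] := hp _ k0.
  have e0 : 0 < row n.2 (V n.1) 0 0 / (2 * t0 * k.+1%:R).
    by rewrite divr_gt0 // !mulr_gt0.
  have [N2 hN2] := pow0 _ e0.
  exists (maxn N1 N2); split; last exact/hN1/leq_maxl.
  apply: lt_le_trans (horopoint_coord n.1 nb (tk _)).
  have := hN2 _ (leq_maxr N1 N2); have := tk (maxn N1 N2).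
  set z := la^-1 ^+ _ => z0; rewrite ltr_pdivlMr ?mulr_gt0 // => hz.
  have z2 : 0 < 2 * (t0 * z) by rewrite mulr_gt0.
  rewrite (ltr_pdivlMr _ _ z2).
  apply: le_lt_trans hz.
  have -> : z * (2 * t0 * k.+1%:R) = k.+1%:R * (2 * (t0 * z)) by ring.
  by rewrite ler_wpM2r ?ler_nat // mulr_ge0 // ltW.
apply: (@no_escape _ _ _ tau n.1 (fun k : nat => y (f k)) p) => k; try by have [] := hf k.
apply: (horopoint_tetrahedron (ideal _) (tk _) hw).
by rewrite /w minkZl minkZr (mink_vertex (ideal _)) !mulr0 oppr0 mulr0.
Qed.

Lemma cusp_loop n (la : R) : cusp_path n n la -> la = 1.
Proof.
move=> h; have la0 := cusp_path_gt0 h; apply/eqP; rewrite eq_le (cusp_loop_le1 h) /=.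
by rewrite -invf_le1 // (cusp_loop_le1 (cusp_path_sym h)).
Qed.

End Cusps.

(** * Normalising the vertex vectors *)

Section Rescale.
Context {R : realType}.
Implicit Types (V : 'M[R]_4) (ka : 'I_4 -> R).

Definition rescale ka V : 'M[R]_4 := \matrix_a (ka a *: row a V).

Lemma row_rescale ka V a : row a (rescale ka V) = ka a *: row a V.
Proof. by rewrite rowK. Qed.

Lemma vgram_rescale ka V a b : vgram (rescale ka V) a b = ka a * ka b * vgram V a b.
Proof. by rewrite /vgram !row_rescale minkZl minkZr; ring. Qed.

Lemma mulmx_rescale ka V (x : 'rV[R]_4) : x *m rescale ka V = (\row_a (x 0 a * ka a)) *m V.
Proof.
rewrite !mulmx_sum_row; apply: eq_bigr => a _.
by rewrite row_rescale mxE scalerA.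
Qed.

Lemma fat_rescale ka V (s : R) : (forall a, 0 < ka a) -> fat s V -> fat s (rescale ka V).
Proof.
move=> ka0 hf a b c d h /=; rewrite !vgram_rescale.
have := hf a b c d h => /=; set P := vgram V a b * _; set Q := _ * vgram V b d; set S := _ * vgram V b c.
set K := ka a * ka b * ka c * ka d; have K0 : 0 < K by rewrite !mulr_gt0.
have -> : ka a * ka c * vgram V a c * (ka b * ka d * vgram V b d) = K * Q by rewrite /K /Q; ring.
have -> : ka a * ka d * vgram V a d * (ka b * ka c * vgram V b c) = K * S by rewrite /K /S; ring.
have -> : ka a * ka b * vgram V a b * (ka c * ka d * vgram V c d) = K * P by rewrite /K /P; ring.
have K20 : 0 < K ^+ 2 by rewrite exprn_gt0.
rewrite -(ler_pM2l K20); congr (_ <= _); ring.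
Qed.

Lemma link_side_rescale ka V a b c : (forall a, 0 < ka a) ->
  link_side (rescale ka V) a b c = link_side V a b c / ka a ^+ 2.
Proof.
move=> ka0; rewrite /link_side !vgram_rescale.
set x := vgram V b c; set y := vgram V a b; set z := vgram V a c.
have [->|y0] := eqVneq y 0; first by rewrite !(mulr0, mul0r, invr0).
have [->|z0] := eqVneq z 0; first by rewrite !(mulr0, mul0r, invr0).
by field; rewrite y0 z0 !gt_eqF.
Qed.

Lemma ideal_rescale ka V : (forall a, 0 < ka a) -> ideal_vertices V ->
  ideal_vertices (rescale ka V).
Proof.
move=> ka0 [h1 h2]; split.
  move=> i; rewrite row_rescale minkZl minkZr (h1 i).1 !mulr0; split=> //.
  by rewrite !mxE mulr_gt0 //; exact: (h1 i).2.
have -> : rescale ka V = diag_mx (\row_a ka a) *m V.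
  apply/row_matrixP => a; rewrite row_rescale row_mul.
  by apply/rowP => j; rewrite -row_mul mul_diag_mx !mxE.
rewrite unitmx_mul h2 andbT unitmxE det_diag unitfE; apply/prodf_neq0 => a _.
by rewrite mxE gt_eqF.
Qed.

Lemma tetrahedron_rescale ka V : (forall a, 0 < ka a) ->
  tetrahedron (rescale ka V) = tetrahedron V.
Proof.
move=> ka0; apply/seteqP; split=> x [hx [al [al0 e]]]; split=> //.
  exists (\row_a (al 0 a * ka a)); rewrite -mulmx_rescale; split=> // i.
  by rewrite mxE mulr_ge0 // ltW.
exists (\row_a (al 0 a / ka a)); split.
  by move=> i; rewrite mxE divr_ge0 // ltW.
rewrite mulmx_rescale e; congr (_ *m V); apply/rowP => a.
by rewrite !mxE divfK // gt_eqF.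
Qed.

Lemma face_rescale ka V k : (forall a, 0 < ka a) -> face (rescale ka V) k = face V k.
Proof.
move=> ka0; apply/seteqP; split=> x [hx [al [al0 alk e]]]; split=> //.
  exists (\row_a (al 0 a * ka a)); rewrite -mulmx_rescale; split=> // [i|].
    by rewrite mxE mulr_ge0 // ltW.
  by rewrite mxE alk mul0r.
exists (\row_a (al 0 a / ka a)); split.
- by move=> i; rewrite mxE divr_ge0 // ltW.
- by rewrite mxE alk mul0r.
rewrite mulmx_rescale e; congr (_ *m V); apply/rowP => a.
by rewrite !mxE divfK // gt_eqF.
Qed.

(** Tetrahedra and faces depend only on the rays of the vertex vectors, so every field carries
    over. *)
Lemma rescale_triangulation (M : metricType R) m (tau : geometric_ideal_triangulation M m)
    (ka : 'I_m * 'I_4 -> R) : (forall n, 0 < ka n) ->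
  exists tau' : geometric_ideal_triangulation M m,
    [/\ tri_vertices tau' = fun i => rescale (fun a => ka (i, a)) (tri_vertices tau i),
        tri_pairing tau' = tri_pairing tau & tri_isometry tau' = tri_isometry tau].
Proof.
move=> ka0; case: tau => V s g T h1 h2 h3 h4 h5 h6 h7 h8 h9 h10.
pose V' i := rescale (fun a => ka (i, a)) (V i).
have hT i : tetrahedron (V' i) = tetrahedron (V i) by exact: tetrahedron_rescale.
have hF i : face (V' i) = face (V i) by apply/funext => k; exact: face_rescale.
have hg : glued V' s g = glued V s g.
  rewrite /glued; congr clos_refl_sym_trans; apply/funext => p; apply/funext => p'.
  by rewrite /face_glue hF.
unshelve eexists (@Build_geometric_ideal_triangulation R M m V' s g T _ h2 h3 h4 h5 _ _ _ _ _).
- by move=> i; exact: ideal_rescale.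
- by move=> f; rewrite !hF.
- by move=> p; have [i] := h7 p; exists i; rewrite hT.
- by move=> i j x y; rewrite !hT hg; exact: h8.
- move=> U; rewrite h9; split=> h i x; have := h i x; rewrite !hT; exact.
- by move=> i x; rewrite hT => Tx; exact: h10.
- by split.
Qed.

End Rescale.

Section Normalisation.
Context {R : realType} {M : completeMetricType R} {m : nat}.
Local Notation node := ('I_m * 'I_4)%type.
Implicit Types tau : geometric_ideal_triangulation M m.

(* A light-like vector v encodes the horosphere [mink x v = -1]. *)
Definition matched tau : Prop := forall i k a, a != k ->
  exists2 b, b != (tri_pairing tau (i, k)).2 &
    row a (tri_vertices tau i) *m tri_isometry tau (i, k) =
    row b (tri_vertices tau (tri_pairing tau (i, k)).1).

Definition cusp_rel tau : rel node := fun n n' => `[< exists la, cusp_step tau n n' la >].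

Lemma cusp_rel_sym tau : connect_sym (cusp_rel tau).
Proof.
apply: sym_connect_sym => n n'; apply/asboolP/asboolP => -[la /cusp_step_sym h].
  by exists la^-1.
by exists la^-1.
Qed.

Lemma connect_cusp_path tau n n' : connect (cusp_rel tau) n n' ->
  exists la, cusp_path tau n n' la.
Proof.
move=> /connectP[p + ->]; elim/last_ind: p => [|p n'' IH].
  by move=> _; exists 1; exact: CuspPath0.
rewrite rcons_path last_rcons => /andP[/IH[la hla] /asboolP[la' hla']].
by exists (la * la'); exact: CuspPathS hla hla'.
Qed.

(** The vertex n is scaled by the factor of a path from a root of its cusp class. Two such paths
    joined by a face pairing close up to a loop, whose factor is 1 by [cusp_loop]. *)
Lemma exists_matched tau : exists tau' ka, [/\ forall n, 0 < ka n,
  tri_vertices tau' = (fun i => rescale (fun a => ka (i, a)) (tri_vertices tau i)) & matched tau'].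
Proof.
have /choice[ka hka] : forall n : node, exists la, cusp_path tau (fingraph.root (cusp_rel tau) n) n la.
  move=> n; apply: connect_cusp_path; rewrite cusp_rel_sym; exact: connect_root.
have ka0 n : 0 < ka n := cusp_path_gt0 (hka n).
have [tau' [h1 h2 h3]] := rescale_triangulation tau ka0.
exists tau', ka; split=> // i k a ak.
have [b [la [bk la0 e]]] := vertex_image tau i ak.
rewrite h1 h2 h3; exists b => //; rewrite !row_rescale -scalemxAl e scalerA.
set j := (tri_pairing tau (i, k)).1 in e *; congr (_ *: _).
have st : cusp_step tau (i, a) (j, b) la by exists k.
have rt : fingraph.root (cusp_rel tau) (i, a) = fingraph.root (cusp_rel tau) (j, b).
  apply/fingraph.rootP; first exact: cusp_rel_sym.
  by apply: connect1; apply/asboolP; exists la.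
have p1 := CuspPathS (hka (i, a)) st; rewrite rt in p1.
have := cusp_loop (cusp_path_cat p1 (cusp_path_sym (hka (j, b)))).
by move/(canRL (mulfK _)); rewrite mul1r invr_eq0 invrK gt_eqF // => ->.
Qed.

Section Matched.
Variable tau : geometric_ideal_triangulation M m.
Hypothesis mtau : matched tau.
Variable sn : R.
Hypothesis sn_ge0 : 0 <= sn.
Hypothesis fat_tau : forall i, fat sn (tri_vertices tau i).
Local Notation V := (tri_vertices tau).
Local Notation s := (tri_pairing tau).
Local Notation g := (tri_isometry tau).
Local Notation ideal := (tri_ideal tau).
Local Notation adj := (cusp_rel tau).

Let distinct3 (a b c : 'I_4) := [&& a != b, a != c & b != c].

Lemma matched_vgram i k a b a' b' : row a (V i) *m g (i, k) = row a' (V (s (i, k)).1) ->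
  row b (V i) *m g (i, k) = row b' (V (s (i, k)).1) ->
  vgram (V (s (i, k)).1) a' b' = vgram (V i) a b.
Proof. by move=> h h'; rewrite /vgram -h -h' tri_isometry_mink. Qed.

Lemma matched_neq i k a b a' b' : row a (V i) *m g (i, k) = row a' (V (s (i, k)).1) ->
  row b (V i) *m g (i, k) = row b' (V (s (i, k)).1) -> a != b -> a' != b'.
Proof.
move=> h h' ab; apply: contraTneq (vgram_gt0 (ideal i) ab) => e.
by rewrite -(matched_vgram h h') e (vgramii (ideal _)) ltxx.
Qed.

Lemma cusp_step_matched n n' (la : R) : cusp_step tau n n' la ->
  exists b c b' c', [/\ distinct3 n.2 b c, distinct3 n'.2 b' c' &
    link_side (V n'.1) n'.2 b' c' = link_side (V n.1) n.2 b c].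
Proof.
case: n n' => i a [j a'] /= [k /= [ak -> _ la0 e]].
have [a1 _ e1] := mtau i ak.
have {la0}aa : a1 = a'.
  have := e; rewrite e1 => /(congr1 (fun w => bcoord (V (s (i, k)).1) w 0 a1)).
  rewrite bcoordZE !(bcoord_vertexE (ideal _)) eqxx; case: eqVneq => //= _.
  by rewrite mulr0 => /eqP; rewrite oner_eq0.
rewrite {a1}aa in e1.
have [b [c h]] := ord4_complete2 ak.
have [[_ ab ac] [_ kb kc] [ba bk bc] [ca ck cb]] := uniq4_neq h.
have [b' _ eb] := mtau i bk; have [c' _ ec] := mtau i ck.
exists b, c, b', c'; rewrite /distinct3 ab ac bc.
rewrite (matched_neq e1 eb ab) (matched_neq e1 ec ac) (matched_neq eb ec bc); split=> //.
by rewrite /link_side (matched_vgram e1 eb) (matched_vgram e1 ec) (matched_vgram eb ec).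
Qed.

(** Adjacent triangles have a side of equal length in common, so only passing between sides inside
    each of the (size p) + 1 triangles costs a factor. *)
Lemma link_side_path p n b c b' c' : path adj n p -> distinct3 n.2 b c ->
  distinct3 (last n p).2 b' c' ->
  (sn ^+ 2) ^+ (size p).+1 * link_side (V n.1) n.2 b c <=
  link_side (V (last n p).1) (last n p).2 b' c'.
Proof.
elim: p n b c => [|n1 p IH] n b c /=.
  move=> _ /and3P[h1 h2 h3] /and3P[h4 h5 h6].
  by rewrite expr1; exact: (link_side_ratio (ideal _)).
move=> /andP[/asboolP[la st] hp] /and3P[h1 h2 h3] hl.
have [b1 [c1 [b2 [c2 [/and3P[d1 d2 d3] hd e]]]]] := cusp_step_matched st.
apply: le_trans (IH n1 b2 c2 hp hd hl); rewrite e exprSr -mulrA.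
by rewrite ler_wpM2l ?exprn_ge0 //; exact: (link_side_ratio (ideal _)).
Qed.

Lemma link_side_connect n n' b c b' c' : connect adj n n' -> distinct3 n.2 b c ->
  distinct3 n'.2 b' c' ->
  (sn ^+ 2) ^+ (4 * m) * link_side (V n.1) n.2 b c <= link_side (V n'.1) n'.2 b' c'.
Proof.
move=> /connectP[p0 /shortenP[p hp up _] ->] d d'.
have sn1 : sn <= 1 by exact: (fat_le1 (ideal n.1) sn_ge0 (fat_tau _)).
apply: le_trans (link_side_path hp d d').
(* A path without repetition visits at most all 4m link triangles. *)
have hs : ((size p).+1 <= 4 * m)%N.
  have := max_card (mem (n :: p)); rewrite (card_uniqP up) /= card_prod !card_ord mulnC.
  by apply.
case/and3P: d => d1 d2 d3.
rewrite ler_wpM2r ?(ltW (link_side_gt0 (ideal _) _ _ _)) //.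
by rewrite ler_wiXn2l // ?exprn_ge0 // expr_le1.
Qed.

Lemma matched_normalised : exists tau' : geometric_ideal_triangulation M m,
  [/\ forall i, fat sn (tri_vertices tau' i), matched tau' &
    forall i a b c, distinct3 a b c ->
    (sn ^+ 2) ^+ (4 * m) <= link_side (tri_vertices tau' i) a b c <= 1].
Proof.
have /choice[mu hmu] : forall r : node, exists mu : R, [/\ 0 < mu,
    forall n b c, connect adj r n -> distinct3 n.2 b c -> link_side (V n.1) n.2 b c <= mu &
    exists n b c, [/\ connect adj r n, distinct3 n.2 b c & link_side (V n.1) n.2 b c = mu]].
  move=> r; pose P := [pred x : node * ('I_4 * 'I_4) | connect adj r x.1 && distinct3 x.1.2 x.2.1 x.2.2].
  pose F (x : node * ('I_4 * 'I_4)) := link_side (V x.1.1) x.1.2 x.2.1 x.2.2.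
  have [b [c [d h]]] := ord4_complete1 r.2.
  have P0 : P (r, (b, c)).
    by case: (uniq4_neq h) => -[h1 h2 _] [_ h3 _] _ _; rewrite /P /= connect0 /distinct3 h1 h2.
  case: (arg_maxP F P0) => -[n [b' c']] /andP[/= rn /[dup] hd /and3P[d1 d2 d3]] hmax.
  exists (F (n, (b', c'))); split.
  - exact: (link_side_gt0 (ideal _)).
  - by move=> n' b1 c1 rn' hd'; apply: (hmax (n', (b1, c1))); rewrite /P /= rn' hd'.
  - by exists n, b', c'.
(* [link_side] is a squared length and is divided by [ka n ^+ 2], so this makes the longest side in
   each cusp class 1. *)
pose ka n := Num.sqrt (mu (fingraph.root adj n)).
have ka0 n : 0 < ka n by rewrite sqrtr_gt0; case: (hmu (fingraph.root adj n)).
have [tau' [h1 h2 h3]] := rescale_triangulation tau ka0.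
exists tau'; split.
- by move=> i; rewrite h1; apply: fat_rescale => // a; exact: ka0.
- move=> i k a ak; have [b bk e] := mtau i ak; exists b; rewrite h2 // h1 h3 !row_rescale.
  rewrite -scalemxAl e; congr (_ *: _); rewrite /ka; congr (Num.sqrt (mu _)).
  apply/fingraph.rootP; first exact: cusp_rel_sym.
  by apply: connect1; apply/asboolP; exists 1, k; rewrite scale1r /=; split.
- move=> i a b c hd; rewrite h1 link_side_rescale; last by move=> a'; exact: ka0.
  have [mu0 hle [n [b' [c' [rn hd' e]]]]] := hmu (fingraph.root adj (i, a)).
  rewrite /ka sqr_sqrtr ?(ltW mu0) //.
  have ra : connect adj (fingraph.root adj (i, a)) (i, a) by rewrite cusp_rel_sym connect_root.
  rewrite ler_pdivrMr // mul1r ler_pdivlMr // (hle (i, a)) // andbT -e.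
  apply: (@link_side_connect n (i, a)) => //.
  by apply: connect_trans ra; rewrite cusp_rel_sym.
Qed.

End Matched.

Lemma exists_normalised tau (sn : R) : 0 <= sn -> (forall i, fat sn (tri_vertices tau i)) ->
  exists tau' : geometric_ideal_triangulation M m,
  [/\ forall i, fat sn (tri_vertices tau' i), matched tau' &
    forall i a b c, [&& a != b, a != c & b != c] ->
    (sn ^+ 2) ^+ (4 * m) <= link_side (tri_vertices tau' i) a b c <= 1].
Proof.
move=> sn0 ftau; have [tau1 [ka [ka0 e mtau1]]] := exists_matched tau.
apply: (matched_normalised mtau1 sn0) => i; rewrite e.
by apply: fat_rescale => // a; exact: ka0.
Qed.

End Normalisation.

(** * Developing along a closed geodesic *)

Section LineBounds.
Context {R : realType}.
Implicit Types x y u v : 'rV[R]_4.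

Lemma mink_tangent_bound x u v : hyp3 x -> mink x u = 0 -> mink u u = 1 ->
  mink u v ^+ 2 <= mink x v ^+ 2 + mink v v.
Proof.
move=> hx hxu hu; pose w := v + mink x v *: x.
have wx : mink w x = 0 by rewrite /w minkDl minkZl hx.1 (minkC v); ring.
have ux : mink u x = 0 by rewrite minkC.
have := mink_orth_cauchy (hyp3_timelike hx) ux wx; rewrite hu mul1r.
have -> : mink u w = mink u v by rewrite /w minkDr minkZr ux; ring.
by rewrite {1}/w minkDl minkZl (minkC x w) wx mulr0 addr0 /w minkDr minkZr (minkC v x) expr2 addrC.
Qed.

(** The logarithm of - [mink x (row a V)] is a Busemann function, hence 1-Lipschitz. *)
Lemma vertex_growth V a x u (s : R) : ideal_vertices V -> hyp3 x -> mink x u = 0 ->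
  mink u u = 1 -> 0 <= s ->
  - mink (hline x u s) (row a V) <= expR s * - mink x (row a V).
Proof.
move=> iV hx hxu hu s0; have := mink_tangent_bound (row a V) hx hxu hu.
rewrite (mink_vertex iV) addr0 => h; have p0 := mink_hyp3_vertex iV a hx.
rewrite mink_hline; set P := mink x _ in h p0 *; set Q := mink u _ in h *.
have QP : - Q <= - P by nra.
have -> : expR s = cosh s + sinh s by rewrite /cosh /sinh; field.
by have := sinh_ge0 s0; nra.
Qed.

Lemma edge_sinh2C V a b x : ideal_vertices V -> edge_sinh2 V a b x = edge_sinh2 V b a x.
Proof. by move=> iV; rewrite /edge_sinh2 (vgramC V a b) (mulrC (mink _ _)). Qed.

(** If r is the distance from x to the edge, the right-hand side is sinh (r + s)^2, so this is the
    triangle inequality through the foot of the perpendicular from x. *)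
Lemma edge_sinh2_hline V a b x u (s : R) : ideal_vertices V -> a != b -> hyp3 x ->
  mink x u = 0 -> mink u u = 1 -> 0 <= s ->
  0 <= edge_sinh2 V a b x /\
  edge_sinh2 V a b (hline x u s) <=
  (sinh s * Num.sqrt (1 + edge_sinh2 V a b x) + cosh s * Num.sqrt (edge_sinh2 V a b x)) ^+ 2.
Proof.
move=> iV ab hx hxu hu s0; have q0 := vgram_gt0 iV ab.
have hl := hline_hyp3 s hx hxu hu.
have fa := mink_hyp3_vertex iV a hx; have fb := mink_hyp3_vertex iV b hx.
have ga := mink_hyp3_vertex iV a hl; have gb := mink_hyp3_vertex iV b hl.
set A := - mink x _ in fa; set B := - mink x _ in fb.
set A' := - mink _ _ in ga; set B' := - mink _ _ in gb.
set q := vgram V a b in q0.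
have eK : edge_sinh2 V a b x = 2 * (A * B) / q - 1 by rewrite /edge_sinh2 /A /B mulrNN.
have eK' : edge_sinh2 V a b (hline x u s) = 2 * (A' * B') / q - 1.
  by rewrite /edge_sinh2 /A' /B' mulrNN.
pose d := 2 * q * A * B; have d0 : 0 < d by rewrite !mulr_gt0.
pose mu := (Num.sqrt d)^-1.
have mu2 : mu ^+ 2 * d = 1 by rewrite exprVn sqr_sqrtr ?mulVf ?gt_eqF // ltW.
(* The point of the edge nearest to x. *)
pose y := (B * mu) *: row a V + (A * mu) *: row b V.
have yy : mink y y = -1.
  rewrite /y mink_comb !(mink_vertex iV) -[mink (row a V) (row b V)]opprK -/(vgram V a b) -/q.
  rewrite (minkC (row b V)) -[mink (row a V) (row b V)]opprK -/(vgram V a b) -/q -mu2 /d; ring.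
have yE z : mink z y = B * mu * mink z (row a V) + A * mu * mink z (row b V).
  by rewrite /y minkDr !minkZr.
have hK : mink x y ^+ 2 = 1 + edge_sinh2 V a b x.
  rewrite yE eK -[mink x (row a V)]opprK -[mink x (row b V)]opprK -/A -/B.
  have -> : (B * mu * - A + A * mu * - B) ^+ 2 = (mu ^+ 2 * d) * (2 * (A * B) / q).
    by rewrite /d; field; rewrite gt_eqF.
  by rewrite mu2; ring.
have hK' : 1 + edge_sinh2 V a b (hline x u s) <= mink (hline x u s) y ^+ 2.
  rewrite eK' yE -[mink _ (row a V)]opprK -[mink _ (row b V)]opprK -/A' -/B'.
  rewrite -subr_ge0.
  have -> : (B * mu * - A' + A * mu * - B') ^+ 2 - (1 + (2 * (A' * B') / q - 1)) =
            (B * mu * A' - A * mu * B') ^+ 2 + (mu ^+ 2 * d - 1) * (2 * (A' * B') / q).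
    by rewrite /d; field; rewrite gt_eqF.
  by rewrite mu2 subrr mul0r addr0 sqr_ge0.
have hQ := mink_tangent_bound y hx hxu hu; rewrite yy in hQ.
set K := edge_sinh2 V a b x in hK *.
have K0 : 0 <= K by have := sqr_ge0 (mink u y); lra.
split=> //; have K1 : 0 <= 1 + K by lra.
have := sqr_sqrtr K0; have := sqr_sqrtr K1; have := sqrtr_ge0 K; have := sqrtr_ge0 (1 + K).
set C := Num.sqrt (1 + K); set S := Num.sqrt K => C0 S0 C2 S2.
move: hK'; rewrite mink_hline; set P := mink x y in hK hQ *; set Q := mink u y in hQ *.
set K' := edge_sinh2 _ _ _ _ => hK'.
have hP : `|P| <= C by rewrite -(ler_pXn2r (n := 2)) ?nnegrE // real_normK ?num_real // C2 hK.
have hQS : `|Q| <= S by rewrite -(ler_pXn2r (n := 2)) ?nnegrE // real_normK ?num_real // S2; lra.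
have c1 := cosh_ge1 s; have sh0 := sinh_ge0 s0; have cs := cosh2_sinh2 s.
have hn : `|cosh s * P + sinh s * Q| <= cosh s * C + sinh s * S.
  have ch0 : 0 <= cosh s by lra.
  have eP : `|cosh s * P| = cosh s * `|P| by rewrite normrM ger0_norm.
  have eQ : `|sinh s * Q| = sinh s * `|Q| by rewrite normrM ger0_norm.
  rewrite (le_trans (ler_normD _ _)) // eP eQ.
  by apply: lerD; rewrite ler_wpM2l.
have := lerXn2r 2 _ _ hn; rewrite !nnegrE real_normK ?num_real // => /(_ (normr_ge0 _)) h2.
have {}h2 : (cosh s * P + sinh s * Q) ^+ 2 <= (cosh s * C + sinh s * S) ^+ 2.
  by apply: h2; apply: le_trans hn.
have e : (cosh s * C + sinh s * S) ^+ 2 - 1 = (sinh s * C + cosh s * S) ^+ 2.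
  have -> : (cosh s * C + sinh s * S) ^+ 2 = (sinh s * C + cosh s * S) ^+ 2 +
     (cosh s ^+ 2 - sinh s ^+ 2) * (C ^+ 2 - S ^+ 2) by ring.
  by rewrite cs C2 S2; ring.
by rewrite -e; lra.
Qed.

(** With S = sqrt K, the hypothesis gives sn S <= sinh (4l) <= 8l, and sqrt (1 + K) <= 1 + S. Since
    cosh s2 <= 2, the left-hand side is at most 8l (sn + sn S) + 2 sn S <= 16l + 16l. *)
Lemma edge_escape_bound (sn l K s1 s2 : R) : 0 < sn -> sn <= 1 -> 4 * l <= 4^-1 ->
  0 <= K -> `|s1| <= 4 * l -> 0 <= s2 <= 4 * l -> sn ^+ 2 * K <= sinh s1 ^+ 2 ->
  sn * (sinh s2 * Num.sqrt (1 + K) + cosh s2 * Num.sqrt K) <= 32 * l.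
Proof.
move=> sn0 sn1 l1 K0 hs1 /andP[s20 hs2] hK.
have l0 : 0 <= l by have := normr_ge0 s1; lra.
have K1 : 0 <= 1 + K by lra.
have := sqr_sqrtr K0; have := sqr_sqrtr K1; have := sqrtr_ge0 K; have := sqrtr_ge0 (1 + K).
set C := Num.sqrt (1 + K); set S := Num.sqrt K => C0 S0 C2 S2.
have s2l : sinh s2 <= 8 * l by apply: (le_trans (sinh_le_small _ _)); lra.
have c2 : cosh s2 <= 2 by apply: cosh_le_small => //; lra.
have s1l : `|sinh s1| <= 8 * l.
  by rewrite -sinh_abs; apply: (le_trans (sinh_le_small _ _)) => //; lra.
have l8 : 0 <= 8 * l by rewrite mulr_ge0.
have sS : sn * S <= 8 * l.
  rewrite -(ler_pXn2r (n := 2)) ?nnegrE ?mulr_ge0 ?(ltW sn0) //.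
  rewrite exprMn S2 (le_trans hK) // -[leLHS]real_normK ?num_real //.
  exact: lerXn2r.
have CS : C <= 1 + S.
  rewrite -(ler_pXn2r (n := 2)) ?nnegrE ?addr_ge0 // C2 -S2.
  have -> : (1 + S) ^+ 2 = 1 + S ^+ 2 + S *+ 2 by ring.
  by rewrite lerDl mulrn_wge0.
have h1 : sinh s2 * C <= 8 * l * (1 + S) by apply: ler_pM; rewrite // sinh_ge0.
have h2 : cosh s2 * S <= 2 * S by rewrite ler_wpM2r.
have h3 : 8 * l * (sn + sn * S) <= 8 * l * 2 by rewrite ler_wpM2l //; lra.
have h4 : sn * (sinh s2 * C + cosh s2 * S) <= sn * (8 * l * (1 + S) + 2 * S).
  by rewrite ler_wpM2l ?(ltW sn0) // lerD.
have e : sn * (8 * l * (1 + S) + 2 * S) = 8 * l * (sn + sn * S) + 2 * (sn * S) by ring.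
by rewrite (le_trans h4) // e; lra.
Qed.

End LineBounds.

Section Development.
Context {R : realType} {M : completeMetricType R} {m : nat}.
Variable tau : geometric_ideal_triangulation M m.
Local Notation V := (tri_vertices tau).
Local Notation T := (tri_map tau).
Local Notation s := (tri_pairing tau).
Local Notation g := (tri_isometry tau).
Local Notation ideal := (tri_ideal tau).
Implicit Types i j : 'I_m.
Implicit Types x y z u : 'rV[R]_4.

Hypothesis charts : forall p : M, exists (U : set M) (f : M -> 'rV[R]_4), hyp_chart U f /\ U p.
Hypothesis mtau : matched tau.
Variable c : R -> M.
Hypothesis geodesic : forall t, exists2 r : R, 0 < r &
  forall a b, `|a - t| < r -> `|b - t| < r -> mdist (c a) (c b) = `|a - b|.
Implicit Types (S : {set 'I_4}) (F : 'I_4 -> R -> R) (G : 'I_4 -> 'I_4 -> R).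
Implicit Type idx : 'I_4 -> 'I_4.
Local Notation lift := (geodesic_lift tau c).

(* Along c, the vertices of a tetrahedron labelled by S are followed from one
   tetrahedron to the next by developing. The logarithm of F a is, up to a constant,
   the distance from the lifted geodesic to a horosphere at the developed vertex a,
   and idx a is the position of this vertex in the current tetrahedron. *)
Record develops S F G t i x u idx : Prop := {
  develops_lift : exists r, lift i x u t r;
  develops_value : forall a, a \in S -> forall t', F a t' = - mink (hline x u (t' - t)) (row (idx a) (V i));
  develops_gram : forall a b, a \in S -> b \in S -> vgram (V i) (idx a) (idx b) = G a b }.

Definition develops_at S F G t i x := exists u idx, develops S F G t i x u idx.

(** Beyond the face opposite to a developed vertex, the next tetrahedron need not have this vertex;
    until then all of S can be followed. *)
Definition exit S F G t := exists i x u idx a,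
  [/\ develops S F G t i x u idx, a \in S & face (V i) (idx a) x].

Lemma develops_at_subset S S' F G t i x : S' \subset S -> develops_at S F G t i x -> develops_at S' F G t i x.
Proof.
move=> /fintype.subsetP h [u [idx [hl hv hg]]]; exists u, idx; split=> //.
  by move=> a /h; exact: hv.
by move=> a b /h Sa /h; exact: hg.
Qed.

Lemma develops_map S F G t i x : develops_at S F G t i x -> tetrahedron (V i) x /\ T i x = c t.
Proof. by case=> u [idx [[r L] _ _]]; split; [exact: lift_tetrahedron L|exact: lift_map L]. Qed.

Lemma develops_self S t i x u r : lift i x u t r ->
  develops_at S (fun a t' => - mink (hline x u (t' - t)) (row a (V i))) (vgram (V i)) t i x.
Proof. by move=> L; exists u, id; split=> //; exists r. Qed.

Lemma develops_step S F G i x u t r t' y : lift i x u t r -> `|t' - t| < r ->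
  tetrahedron (V i) y -> T i y = c t' -> hdist x y < r ->
  (develops_at S F G t i x <-> develops_at S F G t' i y).
Proof.
move=> L ht Ty yt xy; have [-> [r' L']] := lift_step L ht Ty yt xy.
have e a : hline (hline x u (t' - t)) (hline_dir x u (t' - t)) (a - t') = hline x u (a - t).
  by rewrite hline_shift; congr (hline _ _ _); ring.
split=> -[w [idx [[r1 L1] hv hg]]].
  have {w L1 hv}[L1 hv] : lift i x u t r1 /\ forall a, a \in S -> forall t',
      F a t' = - mink (hline x u (t' - t)) (row (idx a) (V i)).
    by rewrite (lift_unique L L1).
  exists (hline_dir x u (t' - t)), idx; split=> //; first by exists r'.
  by move=> a Sa t1; rewrite e; exact: hv.
have {w L1 hv}hv : forall a, a \in S -> forall t1,
    F a t1 = - mink (hline (hline x u (t' - t)) (hline_dir x u (t' - t)) (t1 - t')) (row (idx a) (V i)).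
  by rewrite (lift_unique L' L1).
exists u, idx; split=> //; first by exists r.
by move=> a Sa t1; rewrite hv // e.
Qed.

Lemma face_glue_sym p p' : face_glue V s g p p' -> face_glue V s g p' p.
Proof.
case: p p' => i x [j y] [k /= fx [-> ->]].
have [fy _] := face_glued fx.
exists (s (i, k)).2 => //=; rewrite -surjective_pairing tri_pairingK /=.
by rewrite -mulmxA tri_isometryK mulmx1.
Qed.

(** Without exit, the crossed face contains all the followed vertices. Matching sends them to
    vertices of the next tetrahedron with the same products. *)
Lemma develops_glue S F G t p p' : ~ exit S F G t -> face_glue V s g p p' ->
  develops_at S F G t p.1 p.2 -> develops_at S F G t p'.1 p'.2.
Proof.
case: p p' => i x [j y] hB [k /= fx [-> ->]] [u [idx h]].
have [[r L] hv hg] := h.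
have nk a : a \in S -> idx a != k.
  by move=> Sa; apply/eqP => e; apply: hB; exists i, x, u, idx, a; split=> //; rewrite e.
have [fy yt] := face_glued fx; have Ty := face_tetrahedron (ideal _) fy.
have [u' [r' L']] := lift_exists charts geodesic Ty (etrans yt (lift_map L)).
have hu := lift_face fx erefl L L'.
have /choice[idx' hidx] : forall a, exists b, a \in S ->
    row (idx a) (V i) *m g (i, k) = row b (V (s (i, k)).1).
  move=> a; have [Sa|_] := boolP (a \in S); last by exists a.
  by have [b _ e] := mtau i (nk a Sa); exists b.
exists u', idx'; split; first by exists r'.
  move=> a Sa t'; rewrite hv // !mink_hline -(hidx a Sa) -(hu _ (nk a Sa)).
  by rewrite tri_isometry_mink.
by move=> a b Sa Sb; rewrite (matched_vgram (hidx a Sa) (hidx b Sb)) hg.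
Qed.

Lemma develops_glued S F G t p p' : ~ exit S F G t -> glued V s g p p' ->
  (develops_at S F G t p.1 p.2 <-> develops_at S F G t p'.1 p'.2).
Proof.
move=> hB; elim=> [q q' h|q|q q' _ [h1 h2]|q q' q'' _ [h1 h2] _ [h3 h4]] //.
- by split; apply: develops_glue => //; exact: face_glue_sym.
- by split=> h; [apply/h3/h1|apply/h2/h4].
Qed.

Lemma develops_class S F G t i x j y : ~ exit S F G t -> develops_at S F G t i x ->
  tetrahedron (V j) y -> T j y = c t -> develops_at S F G t j y.
Proof.
move=> hB h Ty yt; have [Tx xt] := develops_map h.
by apply: (develops_glued hB ((tri_identification Tx Ty).1 _)).1 => //; rewrite xt yt.
Qed.

(** The property carried by real induction concerns every representative of c t in every
    tetrahedron, which makes it independent of how often the geodesic changes tetrahedra. Near t,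
    one passes from time a to a representative at time t, then to time b. *)
Lemma develops_propagate S F G t1 t2 i x : t1 <= t2 -> develops_at S F G t1 i x ->
  (forall t, t1 <= t <= t2 -> ~ exit S F G t) ->
  forall j y, tetrahedron (V j) y -> T j y = c t2 -> develops_at S F G t2 j y.
Proof.
move=> t12 h hB.
pose P t := forall j y, tetrahedron (V j) y -> T j y = c t -> develops_at S F G t j y.
apply: (@real_induction _ P t1 t2) => //.
  by move=> j y; apply: develops_class h; apply: hB; rewrite lexx.
move=> t ht; have [e e0 he] := lift_near tau charts geodesic t; exists e => //.
move=> a b ha at_ tb hb ae be Pa j y Ty yb.
have ha' : `|a - t| < e by rewrite ltr_distlC; apply/andP; split; lra.
have hb' : `|b - t| < e by rewrite ltr_distlC; apply/andP; split; lra.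
have [i0 [z Tz za]] := tri_surjective tau (c a).
have [x0 [u0 [r0 [L0 ar0 zr0]]]] := he a i0 z ha' Tz za.
have [x1 [u1 [r1 [L1 br1 yr1]]]] := he b j y hb' Ty yb.
apply/(develops_step S F G L1 br1 Ty yb yr1).
apply: (@develops_class _ _ _ _ i0 x0 _ _ (hB t ht)).
- by apply/(develops_step S F G L0 ar0 Tz za zr0); exact: Pa.
- exact: lift_tetrahedron L1.
- exact: lift_map L1.
Qed.

(** Adding the values at D and - D gives 2 cosh D times the value at 0, which is not zero, while
    periodicity would give 2 times it. *)
Lemma hline_vertex_nonperiodic V0 a x u (D : R) : ideal_vertices V0 -> hyp3 x ->
  mink x u = 0 -> mink u u = 1 -> 0 < D ->
  ~ forall t', mink (hline x u (t' + D)) (row a V0) = mink (hline x u t') (row a V0).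
Proof.
move=> iV hx hxu hu D0 h; have := h 0; have := h (- D).
rewrite addNr add0r !mink_hline coshN sinhN cosh0 sinh0.
have := mink_hyp3_vertex iV a hx; have := sinh_gt0 D0; have := cosh2_sinh2 D.
have := cosh_ge1 D; set P := mink x _; set Q := mink u _ => h1 h2 h3 h4 h5 h6.
have h7 : 1 < cosh D by nra.
nra.
Qed.

Variable l : R.
Hypothesis l_gt0 : 0 < l.
Hypothesis c_periodic : forall t, c (t + l) = c t.

Lemma c_periodicn t (k : nat) : c (t + l *+ k) = c t.
Proof.
by elim: k => [|k IH]; rewrite ?mulr0n ?addr0 // mulrSr addrA c_periodic.
Qed.

Lemma lift_periodic i x u t r (k : nat) : lift i x u (t + l *+ k) r -> lift i x u t r.
Proof.
case=> h1 h2 h3 h4 h5 h6; split=> //; first by rewrite h2 c_periodicn.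
move=> a y ha Ty xy; have e : a + l *+ k - (t + l *+ k) = a - t by ring.
by rewrite -(c_periodicn a k) h6 ?e.
Qed.

(* If no exit occurs during four periods, the same tetrahedron point is seen five
   times, so a developed vertex returns to the same vertex. *)
Lemma exit_exists S F G t i x a : a \in S -> develops_at S F G t i x ->
  exists2 t', t <= t' <= t + 4 * l & exit S F G t'.
Proof.
move=> Sa h; apply: contrapT => hB.
have hB' t' : t <= t' <= t + 4 * l -> ~ exit S F G t' by move=> ht hx; apply: hB; exists t'.
have [Tx xt] := develops_map h.
have hk (k : 'I_5) : develops_at S F G (t + l *+ k) i x.
  have kl : l *+ k <= 4 * l.
    rewrite -[leLHS]mulr_natl; apply: ler_wpM2r; first exact: ltW.
    by rewrite (ler_nat _ k 4) -ltnS.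
  have kl0 : 0 <= l *+ k by rewrite mulrn_wge0 // ltW.
  apply: (develops_propagate _ h); rewrite ?c_periodicn //; first by lra.
  by move=> t' ht; apply: hB'; lra.
have /choice[f hf] : forall k : 'I_5, exists p : 'rV[R]_4 * ('I_4 -> 'I_4),
    develops S F G (t + l *+ k) i x p.1 p.2.
  by move=> k; have [u [idx hh]] := hk k; exists (u, idx).
have [k [k' [kk e]]] : exists k k' : 'I_5, (k < k')%N /\ (f k).2 a = (f k').2 a.
  have /injectivePn[k [k' kk e]] : ~~ injectiveb (fun k => (f k).2 a).
    by apply/negP => /injectiveP /leq_card; rewrite !card_ord.
  case: (ltngtP k k') => [h1|h1|/ord_inj h1]; first by exists k, k'.
    by exists k', k.
  by rewrite h1 eqxx in kk.
have [[r L] hv _] := hf k; have [[r' L'] hv' _] := hf k'.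
have {r' L'}eu := lift_unique (lift_periodic L) (lift_periodic L').
apply: (@hline_vertex_nonperiodic (V i) ((f k).2 a) x (f k).1 (l *+ (k' - k)));
  rewrite ?(lift_orth L) ?(lift_unit L) //.
- exact: ideal.
- exact: (lift_tetrahedron L).1.
- by rewrite pmulrn_rgt0 // subn_gt0.
move=> t'; have := hv a Sa (t' + (t + l *+ k')); rewrite (hv' a Sa) -eu -e.
have -> : t' + (t + l *+ k') - (t + l *+ k') = t' by ring.
have -> : t' + (t + l *+ k') - (t + l *+ k) = t' + l *+ (k' - k).
  by rewrite mulrnBr ?(ltnW kk) //; ring.
by move/oppr_inj => ->.
Qed.

Variable sn : R.
Hypothesis sn_gt0 : 0 < sn.
Hypothesis fat_tau : forall i, fat sn (V i).
Hypothesis link_tau : forall i a b c, [&& a != b, a != c & b != c] ->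
  (sn ^+ 2) ^+ (4 * m) <= link_side (V i) a b c <= 1.

Lemma develops_value0 S F G t i x u idx a : develops S F G t i x u idx -> a \in S ->
  F a t = - mink x (row (idx a) (V i)).
Proof. by move=> h Sa; rewrite (develops_value h Sa) subrr hline0. Qed.

Lemma face_height1 i a x : face (V i) a x -> 3 <= mink x (row a (V i)) ^+ 2.
Proof.
move=> fx; apply: (face_height (ideal i) fx) => b d h1 h2 h3.
by have /andP[] := link_tau i (introT and3P (And3 h1 h2 h3)).
Qed.

(* Within four periods a vertex function smaller than 1 stays smaller than sqrt 3,
   while by face_height it is at least sqrt 3 at an exit. *)
Lemma lift_height i x u t r a : 4 * l <= 4^-1 -> lift i x u t r -> 1 <= - mink x (row a (V i)).
Proof.
move=> l1 L; rewrite leNgt; apply/negP => h1.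
have hx := (lift_tetrahedron L).1.
have [t' ht' [j [y [w [idx [b [h]]]]]]] := exit_exists (set11 a) (develops_self [set a] L).
rewrite inE => /eqP -> fy; have hv := develops_value0 h (set11 a); rewrite /= in hv.
have := face_height1 fy; rewrite -sqrrN -hv.
have ts : 0 <= t' - t by lra.
have := vertex_growth a (ideal i) hx (lift_orth L) (lift_unit L) ts.
have := expR_le_small ts; have := mink_hyp3_vertex (ideal i) a hx.
have := mink_hyp3_vertex (ideal i) a (hline_hyp3 (t' - t) hx (lift_orth L) (lift_unit L)).
have := expR_gt0 (t' - t).
set X := expR _; set P := - mink x _ in h1 *; set Q := - mink _ _ => h2 h3 h4 h5 h6 h7.
(* The elapsed time is at most 1/4, so the exponential is at most 4/3; the square of 3/2 is still
   below 3. *)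
have {}h5 : X <= 3/2 by lra.
have {}h6 : Q <= 3/2 by nra.
nra.
Qed.

Lemma develops_neq S F G t i x u idx a b : develops S F G t i x u idx -> a \in S -> b \in S ->
  G a b != 0 -> idx a != idx b.
Proof.
move=> h Sa Sb; apply: contraNneq => e.
by rewrite -(develops_gram h Sa Sb) e (vgramii (ideal _)).
Qed.

(* Developing preserves the Gram matrix, so the point with the same coordinates as x1
   with respect to the developed vertices has product -1 with the point of the line
   at time t1, and equals it. *)
Lemma develops_face_plane i1 x1 u1 t1 r1 a1 t2 i2 x2 u2 idx d : lift i1 x1 u1 t1 r1 ->
  bcoord (V i1) x1 0 a1 = 0 ->
  develops [set~ a1] (fun a t' => - mink (hline x1 u1 (t' - t1)) (row a (V i1))) (vgram (V i1))
    t2 i2 x2 u2 idx ->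
  (forall a, a != a1 -> idx a != d) ->
  bcoord (V i2) (hline x2 u2 (t1 - t2)) 0 d = 0.
Proof.
move=> L e1 h hd; have hx1 := (lift_tetrahedron L).1.
have [[r2 L2] hv hg] := h.
have hy := hline_hyp3 (t1 - t2) (lift_tetrahedron L2).1 (lift_orth L2) (lift_unit L2).
set y := hline _ _ _ in hy *; set be := bcoord (V i1) x1 in e1.
have hval a : a != a1 -> mink y (row (idx a) (V i2)) = mink x1 (row a (V i1)).
  move=> aa; have Sa : a \in [set~ a1]%SET by rewrite in_setC1.
  by have := hv a Sa t1; rewrite subrr hline0 => /oppr_inj.
have hgram a b : a != a1 -> b != a1 ->
    mink (row (idx a) (V i2)) (row (idx b) (V i2)) = mink (row a (V i1)) (row b (V i1)).
  by move=> aa bb; apply/oppr_inj; apply: hg; rewrite in_setC1.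
pose z := \sum_a be 0 a *: row (idx a) (V i2).
have ex1 : x1 = \sum_a be 0 a *: row a (V i1) by exact: bcoord_sum (ideal _) _.
have be0 a (P Q : R) : (a != a1 -> P = Q) -> be 0 a * P = be 0 a * Q.
  by case: eqVneq => [->|_ ->//]; rewrite e1 !mul0r.
have yz : mink y z = -1.
  rewrite mink_sumr -hx1.1 {2}ex1 mink_sumr; apply: eq_bigr => a _.
  by rewrite !minkZr; apply: (be0); exact: hval.
have zz : mink z z = -1.
  rewrite -hx1.1 {1 2}ex1 /z !mink_suml; apply: eq_bigr => a _.
  rewrite !minkZl; apply: (be0) => aa; rewrite !mink_sumr; apply: eq_bigr => b _.
  by rewrite !minkZr; apply: (be0) => bb; exact: hgram.
have ez : z = y.
  apply/subr0_eq/(mink_orth_eq0 (hyp3_timelike hy)).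
    by rewrite minkDl minkNl (minkC z) yz hy.1; ring.
  by rewrite mink_sqrB zz (minkC z) yz hy.1; ring.
rewrite -ez /z /bcoord mulmx_suml summxE big1 // => a _.
rewrite -/(bcoord (V i2) _) bcoordZE (bcoord_vertexE (ideal _)).
have [->|aa] := eqVneq a a1; first by rewrite e1 mul0r.
by rewrite eq_sym (negbTE (hd a aa)) mulr0.
Qed.

Lemma face_edge_sinh2 i a b x : face (V i) a x -> a != b -> 1 <= - mink x (row b (V i)) ->
  sn ^+ 2 * (sn ^+ 2) ^+ (4 * m) <= edge_sinh2 (V i) a b x.
Proof.
move=> fx ab h1; have [p [q hpq]] := ord4_complete2 ab.
have [[_ ap _] [ba bp _] _ _] := uniq4_neq hpq.
apply: le_trans (edge_sinh2_face (ideal i) (fat_tau i) hpq fx).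
have /andP[h2 _] := link_tau i (introT and3P (And3 ba bp ap)).
have s0 : 0 <= sn ^+ 2 by rewrite sqr_ge0.
rewrite -[mink x _]opprK sqrrN -mulrA ler_wpM2l // -[leLHS]mulr1.
by apply: ler_pM => //; [exact: exprn_ge0|exact: exprn_ege1].
Qed.

Lemma short_geodesic_contra : 32 * l < sn ^+ (4 * m + 2) -> False.
Proof.
move=> hl; have [i0 [x0 Tx0 e0]] := tri_surjective tau (c 0).
have sn1 : sn <= 1 by exact: (fat_le1 (ideal i0) (ltW sn_gt0) (fat_tau i0)).
have hsn : sn ^+ (4 * m + 2) <= 1 by rewrite exprn_ile1 // ltW.
have l1 : 4 * l <= 4^-1 by lra.
have [u0 [r0 L0]] := lift_exists charts geodesic Tx0 e0.
(* Any exit serves to find a point x1 of the geodesic on a face, the one opposite to a1. *)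
have [t1 _ [i1 [x1 [u1 [idx1 [b1 [h1 _ fx1]]]]]]] :=
  exit_exists (set11 ord0) (develops_self [set ord0]%SET L0).
have [[r1 L1] _ _] := h1; move: (idx1 b1) fx1 => a1 fx1 {h1}.
have [_ _ e1] := (faceP (ideal i1) a1 x1).1 fx1.
have [p [_ [_ /uniq4_neq[_ [pa1 _ _] _ _]]]] := ord4_complete1 a1.
have Sp : p \in [set~ a1]%SET by rewrite in_setC1.
(* The three vertices of this face are followed until the face opposite to one of them, q; the other
   two, a and b, span the common edge. *)
have [t2 ht2 [i2 [x2 [u2 [idx [q [h2 + fx2]]]]]]] :=
  exit_exists Sp (develops_self [set~ a1]%SET L1).
rewrite in_setC1 => qa1; have [[r2 L2] hv hg] := h2.
have hx2 := (lift_tetrahedron L2).1.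
have [a [b hab]] := ord4_complete2 qa1.
have [[_ qa qb] [_ a1a a1b] [aq aa1 ab] [bq ba1 ba]] := uniq4_neq hab.
have Sa : a \in [set~ a1]%SET by rewrite in_setC1.
have Sb : b \in [set~ a1]%SET by rewrite in_setC1.
have ne k k' : k != a1 -> k' != a1 -> k != k' -> idx k != idx k'.
  by move=> ka ka' kk; apply: (develops_neq h2); rewrite ?in_setC1 // gt_eqF // (vgram_gt0 (ideal i1)).
(* The developed first face has its vertices at the positions of a, b and q, so it spans the plane
   opposite to the remaining position d. *)
have [d hd] : exists d, uniq [:: idx a; idx b; idx q; d].
  by apply: ord4_complete3; rewrite /= !inE negb_or !ne.
have [[_ _ ad] [_ _ bd] [_ _ qd] _] := uniq4_neq hd.
have plane : bcoord (V i2) (hline x2 u2 (t1 - t2)) 0 d = 0.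
  apply: (develops_face_plane L1 e1 h2) => k ka1.
  by have := mem_uniq4 k hab; rewrite !inE (negbTE ka1) /= => /or3P[] /eqP ->.
have [_ _ eq2] := (faceP (ideal i2) _ x2).1 fx2.
have pen := edge_sinh2_pencil (ideal i2) (fat_tau i2) hd hx2 (lift_orth L2) (lift_unit L2) eq2 plane.
have S2 : [set a; b]%SET \subset [set~ a1]%SET.
  by apply/fintype.subsetP => k; rewrite !inE => /orP[]/eqP ->.
have [t3 ht3 [i3 [x3 [u3 [idx3 [k [h3 kS fx3]]]]]]] := exit_exists (set21 a b)
  (develops_at_subset S2 (ex_intro _ u2 (ex_intro _ idx h2))).
have [[r3 L3] _ _] := h3.
have v3 f : f \in [set a; b]%SET ->
    mink (hline x2 u2 (t3 - t2)) (row (idx f) (V i2)) = mink x3 (row (idx3 f) (V i3)).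
  move=> Sf; have Sf' := fintype.subsetP S2 f Sf.
  by apply/oppr_inj; rewrite -(develops_value0 h3 Sf) (hv f Sf').
have eE : edge_sinh2 (V i3) (idx3 a) (idx3 b) x3 =
    edge_sinh2 (V i2) (idx a) (idx b) (hline x2 u2 (t3 - t2)).
  rewrite /edge_sinh2 !v3 ?set21 ?set22 //.
  by rewrite (develops_gram h3) ?set21 ?set22 // (develops_gram h2).
have low : sn ^+ 2 * (sn ^+ 2) ^+ (4 * m) <= edge_sinh2 (V i3) (idx3 a) (idx3 b) x3.
  have ab3 : idx3 a != idx3 b.
    by apply: (develops_neq h3); rewrite ?set21 ?set22 // gt_eqF // (vgram_gt0 (ideal i1)).
  (* The exit is opposite to one end of the edge; [lift_height] controls the product with the other
     end. *)
  move: kS; rewrite !inE => /orP[]/eqP ek; rewrite ek in fx3; last rewrite (edge_sinh2C _ _ _ (ideal i3)).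
    by apply: face_edge_sinh2 => //; exact: lift_height L3.
  by apply: face_edge_sinh2; rewrite // 1?eq_sym //; exact: lift_height L3.
have ts : 0 <= t3 - t2 by lra.
have [K0 up] := edge_sinh2_hline (ideal i2) (ne _ _ aa1 ba1 ab) hx2 (lift_orth L2) (lift_unit L2) ts.
move: low; rewrite eE => low.
move: up low pen K0; set K := edge_sinh2 _ _ _ x2; set K3 := edge_sinh2 _ _ _ _ => up low pen K0.
have ht12 : `|t1 - t2| <= 4 * l by rewrite ler_norml; lra.
have ht23 : 0 <= t3 - t2 <= 4 * l by lra.
have X1 := edge_escape_bound sn_gt0 sn1 l1 K0 ht12 ht23 pen.
set X := sinh _ * _ + _ in up X1.
(* X is the hyperbolic sine of the distance from x2 to the edge plus the elapsed time t3 - t2; its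
   square bounds [K3] above, and [low] bounds [K3] below. *)
have X2 : X < sn * sn ^+ (4 * m).
  rewrite -(ltr_pM2l sn_gt0) (le_lt_trans X1) // (lt_le_trans hl) //.
  by rewrite exprD mulrC mulrA -expr2.
have X0 : 0 <= X.
  have c0 := le_trans ler01 (cosh_ge1 (t3 - t2)).
  by apply: addr_ge0; apply: mulr_ge0; rewrite // sinh_ge0.
have := le_trans low up; rewrite leNgt => /negP; apply.
by rewrite exprAC -exprMn ltrXn2r.
Qed.

End Development.

(** * The bound on the systole *)

Lemma closed_geodesic_length (R : realType) (M : completeMetricType R) (m : nat)
    (tau : geometric_ideal_triangulation M m) (sn : R) (c : R -> M) (l : R) :
  (forall p : M, exists (U : set M) (f : M -> 'rV[R]_4), hyp_chart U f /\ U p) ->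
  0 < sn -> (forall i, fat sn (tri_vertices tau i)) -> closed_geodesic c l ->
  sn ^+ (4 * m + 2) <= 32 * l.
Proof.
move=> charts sn0 ftau [l0 cl hc]; rewrite leNgt; apply/negP.
have [tau' [h1 h2 h3]] := exists_normalised (ltW sn0) ftau.
exact: (short_geodesic_contra charts h2 hc l0 cl sn0 h1 h3).
Qed.

Theorem theorem1p4 (R : realType) (M : completeMetricType R)
    (hM : cusped_hyperbolic M) (hor : orientable M)
    (m : nat) (tau : geometric_ideal_triangulation M m)
    (theta0 : R) (htheta0 : 0 < theta0)
    (hangle : forall (i : 'I_m) (j k : 'I_4), j != k ->
       theta0 <= dihedral_angle (tri_vertices tau i) j k) :
  ((2 ^- 9 * (sin theta0 `^ (4 * m%:R + 7 / 2) / m%:R `^ (3 / 2)))%:E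
     <= systole M)%E.
Proof.
apply: le_ereal_inf_tmp => _ [l [c hc] <-]; rewrite lee_fin.
have [l0 _ _] := hc.
have [i [x Tx _]] := tri_surjective tau (c 0).
have m1 : 1 <= m%:R :> R by rewrite ler1n; exact: leq_ltn_trans (ltn_ord i).
have hpi : 0 <= theta0 <= pi.
  rewrite ltW //=; have [b [_ [_ /uniq4_neq[[ab _ _] _ _ _]]]] := ord4_complete1 ord0.
  exact: le_trans (hangle i _ _ ab) (dihedral_le_pi (tri_ideal tau i) ab).
set sn := sin theta0.
have fat_tau j : fat sn (tri_vertices tau j) := fat_sin (tri_ideal tau j) hpi (hangle j).
have : 0 <= sn by exact: sin_ge0_pi.
(* Only theta0 <= pi is known here; if sin theta0 = 0, the claimed bound is 0. *)
rewrite le_eqVlt => /predU1P[<-|sn0].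
  by rewrite powR0 ?mul0r ?mulr0 ?ltW // gt_eqF // addr_gt0 // mulr_gt0 // (lt_le_trans ltr01).
have sn1 : sn <= 1 by exact: sin_le1.
have hl := closed_geodesic_length hM.(cusped_manifold).2 sn0 fat_tau hc.
have p1 : 1 <= m%:R `^ (3 / 2) :> R 
  by rewrite -[leLHS](powRr0 m%:R) ler_powR.
(* The base is at most 1 and 7/2 exceeds 2. *)
have p2 : sn `^ (4 * m%:R + 7 / 2) <= sn ^+ (4 * m + 2).
  rewrite -powR_mulrn ?(ltW sn0) // natrD natrM; apply: ger_powR; rewrite ?sn0 //; lra.
have p3 : sn `^ (4 * m%:R + 7 / 2) / m%:R `^ (3 / 2) <= 32 * l.
  apply: le_trans hl; apply: le_trans p2; rewrite ler_pdivrMr ?(lt_le_trans ltr01) //.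
  by rewrite ler_peMr // powR_ge0.
(* Since 32 = 2^5, the factor 2^-9 leaves l / 16 on the right. *)
have : 2 ^- 9 * (sn `^ (4 * m%:R + 7 / 2) / m%:R `^ (3 / 2)) <= 2 ^- 9 * (32 * l).
  by rewrite ler_wpM2l.
by move/le_trans; apply; rewrite -!exprVn; lra.
Qed.
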